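(* Let $\mathcal{Q}=\{(s_{\mathrm{ph}},s_{\mathrm{el}})\in\mathbb{R}^2:s_{\mathrm{ph}}<s_{\mathrm{el}}\}$. Let $\rho:[0,\infty)\times\overline{\mathcal{Q}}\to[0,\infty)$ and $J=(J^1,J^2):[0,\infty)\times\overline{\mathcal{Q}}\to\mathbb{R}^2$ be locally Lipschitz continuous with: (1) $\partial_t\rho+\mathrm{div}\,J=0$ almost everywhere (Lebesgue); (2) $\rho>0$ whenever $\rho\neq0$; (3) $\int_{\mathcal{Q}}\rho(t,q)\,dq=1$ for all $t\ge0$; (4) there is $C>0$ with $|J|\le C\rho$; (5) $J$ and the first-order derivatives of $\rho$ (where they exist) are bounded on bounded sets; (6) $|J^1(t,q)-J^2(t,q)|=0$ for all $t\ge0$ and all $q\in\partial\mathcal{Q}$. Let $\mu_t(dq)=\rho(t,q)\,dq$. Then for $\mu_0$-almost every $q\in\mathcal{Q}$, the solution of $\frac{dQ}{dt}=\frac{J(t,Q)}{\rho(t,Q)}$ with $Q(0)=q$ exists for all $t\ge0$, satisfies $Q(t)\in\mathcal{Q}$ for all $t\ge0$, and the family of measures $(\mu_t)$ is equivariant.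
   Context: Let $\mathcal{N}_t=\{q:\rho(t,q)=0\}$. Away from the nodes the velocity field $J/\rho$ is locally Lipschitz, so for $q\in\mathcal{Q}\setminus\mathcal{N}_0$ there is a unique maximal solution $Q_q$ in $\mathcal{Q}\setminus\mathcal{N}_t$ with $Q_q(0)=q$ on a maximal interval $(\tau^-_q,\tau^+_q)$. Adjoin a ''graveyard'' point $\diamondsuit$ to $\mathcal{Q}$ and set $\varphi_t(q)=Q_q(t)$ for $t\in(\tau_q^-,\tau_q^+)$ and $\varphi_t(q)=\diamondsuit$ otherwise (also for $q\in\mathcal{N}_0$ and $t\neq0$, and when a trajectory reaches $\partial\mathcal{Q}$). The family $(\mu_t)$ is called equivariant if $\mu_0\circ\varphi_t^{-1}=\mu_t$ for all $t\ge0$ (as measures on $\mathcal{Q}$). *)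

(* Defs.v *)
From mathcomp Require Import all_boot all_order all_algebra.
From mathcomp Require Import all_classical all_reals all_analysis.
Set Implicit Arguments.
Unset Strict Implicit.
Unset Printing Implicit Defensive.
Import Order.TTheory GRing.Theory Num.Theory.
Import numFieldNormedType.Exports.
Local Open Scope classical_set_scope.
Local Open Scope ring_scope.

Section Defs.
Context {R : realType}.

Definition QQ : set (R * R) := [set q | q.1 < q.2].
Definition QQbar : set (R * R) := [set q | q.1 <= q.2].

Definition dom : set (R * (R * R)) := [set p | 0 <= p.1 /\ QQbar p.2].

Definition leb2 := ((@lebesgue_measure R) \x (@lebesgue_measure R))%E.
Definition leb3 := ((@lebesgue_measure R) \x leb2)%E.

Definition dist3 (x y : R * (R * R)) : R :=
  Num.max `|x.1 - y.1| (Num.max `|x.2.1 - y.2.1| `|x.2.2 - y.2.2|).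

Definition loc_lipschitz_on (D : set (R * (R * R))) (f : R * (R * R) -> R) :=
  forall p, D p -> exists r : R, 0 < r /\ exists L : R,
    forall x y, D x -> D y -> dist3 x p < r -> dist3 y p < r ->
      `|f x - f y| <= L * dist3 x y.

Definition mu (rho : R -> R * R -> R) (t : R) (A : set (R * R)) : \bar R :=
  (\int[leb2]_(q in A `&` QQ) (rho t q)%:E)%E.

Definition is_sol (rho : R -> R * R -> R) (J : R -> R * R -> R * R)
    (q : R * R) (b : R) (X : R -> R * R) : Prop :=
  [/\ X 0 = q,
      (forall s, 0 <= s < b -> QQ (X s) /\ rho s (X s) != 0),
      (forall s, 0 < s < b ->
         [/\ derivable (fun u => (X u).1) s 1,
             derivable (fun u => (X u).2) s 1,
             derive1 (fun u => (X u).1) s = (J s (X s)).1 / rho s (X s)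
           & derive1 (fun u => (X u).2) s = (J s (X s)).2 / rho s (X s)])
    & X u @[u --> (0 : R)^'+] --> q].

(* p is the position at time t of the (maximal) solution started at q. *)
Definition flow_rel rho J (t : R) (q p : R * R) : Prop :=
  exists b X, t < b /\ is_sol rho J q b X /\ X t = p.

(* phi_t(q); None plays the role of the graveyard point. *)
Definition flow rho J (t : R) (q : R * R) : option (R * R) :=
  if t == 0 then Some q else
  match pselect (exists p, flow_rel rho J t q p) with
  | left h => Some (proj1_sig (cid h))
  | right _ => None
  end.

End Defs.

(* Main.v *)
(* For eps > 0 the velocity w = J / (rho + eps) is bounded and Lipschitz, and
   (rho + eps) w = J.  Hence one explicit Euler step of length h along w carries
   (rho_s + eps) dq to (rho_(s+h) + eps) dq up to O(h^2) against Lipschitz test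
   functions.  The step is made one coordinate at a time: on a line one compares
   the mass crossing a point with the flux through it, so that the merely
   Lipschitz density is never differentiated, and the continuity equation is
   needed in weak form only.  Along a trajectory of J / rho with rho >= delta,
   Euler's scheme for w stays close to the trajectory, with a Gronwall constant
   that depends on delta but not on eps, because w is bounded by C at every
   point.  Letting h and then eps tend to 0, the part of mu_0 that lives on
   trajectories with rho >= delta up to time t is carried to a measure below
   mu_t.

   A trajectory that starts where rho >= 2 delta and drops below delta spends a
   time of order delta in the region delta < rho < 2 delta.  By Fubini and the
   previous inequality the mu_0-measure of such starting points in a box is at
   most a constant times the space-time volume of 0 < rho < 2 delta in a box,
   which tends to 0 with delta: almost no trajectory reaches a node.  The carried
   measure therefore has total mass 1, as mu_t has, and being below mu_t it is
   equal to it.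

   To avoid a boundary, rho and J are folded across the diagonal; (6) says that
   the folded current is continuous there, and it makes the diagonal invariant. *)

From HB Require Import structures.
Require Import Defs.
From mathcomp Require Import all_boot all_order all_algebra.
From mathcomp Require Import all_classical all_reals all_analysis.
From mathcomp Require Import measurable_realfun.
From mathcomp Require Import ring lra.
Set Implicit Arguments.
Unset Strict Implicit.
Unset Printing Implicit Defensive.
Import Order.TTheory GRing.Theory Num.Theory.
Import numFieldNormedType.Exports.
Local Open Scope classical_set_scope.
Local Open Scope ring_scope.

(** * Euler's scheme and integrals in one and two variables *)

Section RealFacts.
Context {R : realType}.
Implicit Types (x y c : R) (p q : R * R).

(** Test functions are only Lipschitz, so in the weak equation their gradient is replaced by
    backward difference quotients of a width [k]. An Euler step produces the same quotients, so with
    a common [k] the two flux terms cancel and no limit of them is ever taken; the remaining error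
    is of order [h ^+ 2] once [k] is small, hence of order [h] after [t / h] steps.

    Two regularised denominators are needed. [rho + eps] satisfies the same continuity equation, but
    its flow is not that of [J / rho]; the maximum of [dl] and [rho] violates the equation, but its
    flow solves [J / rho] while [rho >= dl]. Masses are moved with the first, trajectories are built
    with the second, and [euler_trajectory] compares them.

    Lipschitz constants are available on bounded sets only. As the speed is at most [C], all paths
    from the [n]-th square up to time [t] stay in a fixed larger box, so the fields may be truncated
    outside it. The map phi_t becomes an increasing union of restrictions of Lipschitz maps, one for
    each [n], and this is the source of its measurability. *)

Lemma norm_le_bounds x c : `|x| <= c -> - c <= x /\ x <= c.
Proof. by rewrite ler_norml => /andP. Qed.

Lemma bounds_norm_le x c : - c <= x -> x <= c -> `|x| <= c.
Proof. by rewrite ler_norml => -> ->. Qed.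

Lemma pair_norm_le p c : `|p.1| <= c -> `|p.2| <= c -> `|p| <= c.
Proof. by rewrite prod_normE ge_max => -> ->. Qed.

Lemma fst_norm_le p : `|p.1| <= `|p|.
Proof. by rewrite prod_normE le_max lexx. Qed.

Lemma snd_norm_le p : `|p.2| <= `|p|.
Proof. by rewrite prod_normE le_max lexx orbT. Qed.

Lemma le_of_le_add_geometric x y c :
  0 <= c -> (forall n : nat, x <= y + c * 2^-1 ^+ n) -> x <= y.
Proof.
move=> c0 H; apply/ler_addgt0Pr => e e0.
have [n hn] : exists n : nat, c * 2^-1 ^+ n <= e.
  have /cvgrPdist_le /(_ e e0) [n _ /(_ n (leqnn n))] :
    (fun n : nat => c * 2^-1 ^+ n) @ \oo --> (0:R).
    rewrite -[X in _ --> X](mulr0 c); apply: cvgM; first exact: cvg_cst.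
    by apply: cvg_expr; rewrite ger0_norm; lra.
  rewrite sub0r normrN ger0_norm; last by rewrite mulr_ge0 ?exprn_ge0; lra.
  by move=> h; exists n.
by apply: (le_trans (H n)); rewrite lerD2l.
Qed.

Lemma le_of_le_add_harmonic x y c :
  (forall n : nat, x <= y + c / n.+1%:R) -> x <= y.
Proof.
move=> H; apply/ler_addgt0Pr => e e0.
have [n hn] : exists n : nat, c / n.+1%:R <= e.
  have /cvgrPdist_le /(_ e e0) [n _ /(_ n (leqnn n))] :
    (fun n : nat => c * harmonic n) @ \oo --> (0:R).
    by rewrite -[X in _ --> X](mulr0 c); apply: cvgM;
      [exact: cvg_cst|exact: cvg_harmonic].
  by rewrite sub0r normrN => h; exists n; apply: le_trans h; exact: ler_norm.
by apply: (le_trans (H n)); rewrite lerD2l.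
Qed.

Lemma max_sub_min (y z : R) : Num.max y z - Num.min y z = `|y - z|.
Proof. by case: (leP y z) => h; [rewrite ler0_norm; lra|rewrite ger0_norm; lra]. Qed.

Lemma between_dist (x y z : R) : Num.min y z <= x <= Num.max y z -> `|x - y| <= `|y - z|.
Proof.
by rewrite -(max_sub_min y z); case: (leP y z) => h /andP[h1 h2]; apply: bounds_norm_le; lra.
Qed.

Lemma step_outside (x y z : R) : ~ (Num.min y z <= x <= Num.max y z) ->
  ((x <= y)%R%:R - (x <= z)%R%:R) = 0 :> R.
Proof.
move=> hx; case: (leP x y) => h1; case: (leP x z) => h2; rewrite ?subrr//; exfalso; apply: hx.
  by rewrite ge_min le_max h1 (ltW h2) orbT.
by rewrite ge_min le_max h2 (ltW h1) orbT.
Qed.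

Lemma telescope_norm (A0 A1 A2 A3 h x y z u1 u2 u3 u4 : R) : `|A0 - A1| <= u1 ->
  `|A1 - A2 - h * x| <= u2 -> `|A2 - A3 - h * z| <= u3 -> `|h * (x - y)| <= u4 ->
  `|A0 - A3 - h * (y + z)| <= u1 + u2 + u3 + u4.
Proof.
move=> h1 h2 h3 h4.
have -> : A0 - A3 - h * (y + z) = (A0 - A1) + (A1 - A2 - h * x) + (A2 - A3 - h * z) + h * (x - y) by ring.
apply: le_trans (ler_normD _ _) _; apply: lerD => //.
apply: le_trans (ler_normD _ _) _; apply: lerD => //.
by apply: le_trans (ler_normD _ _) _; exact: lerD.
Qed.

Lemma mixed_bound (c B Q k k' : R) : 0 <= c -> 0 <= B -> 0 <= Q -> 0 <= k -> 0 <= k' ->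
  4 * c * B * k + 2 * c * Q * k' <= (4 * c * B + 2 * c * Q) * (k + k').
Proof.
move=> c0 B0 Q0 k0 k'0.
have -> : (4 * c * B + 2 * c * Q) * (k + k') = (4 * c * B * k + 2 * c * Q * k') + (4 * c * B * k' + 2 * c * Q * k) by ring.
by rewrite lerDl addr_ge0// !mulr_ge0.
Qed.

Lemma maxr_dist (x y z : R) : `|Num.max x y - Num.max x z| <= `|y - z|.
Proof.
have := ler_norm (y - z); have := ler_norm (z - y); rewrite (distrC z y).
case: (leP x y) => ?; case: (leP x z) => ? ? ?; apply: bounds_norm_le; lra.
Qed.

Lemma minr_dist (x y z : R) : `|Num.min x y - Num.min x z| <= `|y - z|.
Proof.
have := ler_norm (y - z); have := ler_norm (z - y); rewrite (distrC z y).
case: (leP x y) => ?; case: (leP x z) => ? ? ?; apply: bounds_norm_le; lra.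
Qed.

Lemma min_dist (x y z w a b : R) : `|x - z| <= a -> `|y - w| <= b ->
  `|Num.min x y - Num.min z w| <= a + b.
Proof.
move=> xz yw; rewrite -(subrKA (Num.min z y)); apply: le_trans (ler_normD _ _) _; apply: lerD.
  by rewrite (minC x) (minC z); exact: le_trans (minr_dist _ _ _) xz.
exact: le_trans (minr_dist _ _ _) yw.
Qed.

(* The limit is the supremum of the lower barriers [u n - 2 c / 2 ^ n]. *)
Lemma geometric_cauchy (u : nat -> R) c :
  (forall n, `|u n.+1 - u n| <= c * 2^-1 ^+ n) ->
  exists l, forall n, `|l - u n| <= 2 * c * 2^-1 ^+ n.
Proof.
move=> H.
have c0 : 0 <= c by have := H 0%N; rewrite expr0 mulr1; apply: le_trans.
pose g n : R := 2 * c * 2^-1 ^+ n.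
have gS n : g n = g n.+1 + c * 2^-1 ^+ n by rewrite /g exprS; lra.
have lo n m : u n - g n <= u (n + m)%N - g (n + m)%N.
  elim: m => [|m IH]; first by rewrite addn0.
  rewrite addnS; have [h1 _] := norm_le_bounds (H (n + m)%N).
  by have := gS (n + m)%N; lra.
have hi n m : u (n + m)%N + g (n + m)%N <= u n + g n.
  elim: m => [|m IH]; first by rewrite addn0.
  rewrite addnS; have [_ h1] := norm_le_bounds (H (n + m)%N).
  by have := gS (n + m)%N; lra.
have g0 n : 0 <= g n by rewrite /g !mulr_ge0 ?exprn_ge0; lra.
have ub n m : u n - g n <= u m + g m.
  have [nm|/ltnW mn] := leqP n m.
    by have := lo n (m - n)%N; rewrite subnKC//; have := g0 m; lra.
  by have := hi m (n - m)%N; rewrite subnKC//; have := g0 n; lra.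
pose S := [set u n - g n | n in [set: nat]].
have S0 : S !=set0 by exists (u 0%N - g 0%N); exists 0%N.
exists (sup S) => n; apply: bounds_norm_le; rewrite -/(g n).
  suff : u n - g n <= sup S by lra.
  apply: ub_le_sup; last by exists n.
  by exists (u 0%N + g 0%N) => _ [m _ <-].
suff : sup S <= u n + g n by lra.
by apply: ge_sup => // _ [m _ <-].
Qed.

(** The term [n%:R * b] stands in for the sharper geometric sum [b * ((1 + a) ^+ n - 1) / a], which
    would exclude [a = 0]. *)
Lemma discrete_gronwall (e : nat -> R) (a b : R) (n : nat) :
  0 <= a -> 0 <= b -> 0 <= e 0%N ->
  (forall k, (k < n)%N -> e k.+1 <= (1 + a) * e k + b) ->
  e n <= expR (n%:R * a) * (e 0%N + n%:R * b).
Proof.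
move=> a0 b0 e0 H.
suff h k : (k <= n)%N -> e k <= (1 + a) ^+ k * (e 0%N + k%:R * b).
  apply: le_trans (h n (leqnn n)) _; rewrite expRM_natl.
  apply: ler_wpM2r; first by rewrite addr_ge0 ?mulr_ge0.
  by apply: lerXn2r; rewrite ?nnegrE ?expR_ge0 ?expR_ge1Dx//; lra.
elim: k => [|k IH] kn; first by rewrite expr0 mul0r addr0 mul1r.
apply: le_trans (H _ kn) _.
have a1 : 0 <= 1 + a by lra.
have h1 := ler_wpM2l a1 (IH (ltnW kn)).
have h2 : 1 <= (1 + a) ^+ k.+1 by apply: exprn_ege1; lra.
have h3 := ler_wpM2r b0 h2.
rewrite mulrA -exprS in h1.
by rewrite -natr1; nra.
Qed.

End RealFacts.

Section Euler.
Context {R : realType}.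
Implicit Types (p q : R * R).

(** The boolean index lets one argument serve both coordinates. The norm of [R * R] is the maximum
    norm, so a bound on both coordinates is a bound on the norm without loss. *)
Definition cd (b : bool) p : R := if b then p.1 else p.2.

Lemma cd_norm_le b p : `|cd b p| <= `|p|.
Proof. by case: b; [exact: fst_norm_le|exact: snd_norm_le]. Qed.

Lemma cdB_norm_le b p q : `|cd b p - cd b q| <= `|p - q|.
Proof. by have := cd_norm_le b (p - q); case: b. Qed.

Lemma cd_pair_norm_le p q c : (forall b, `|cd b p - cd b q| <= c) -> `|p - q| <= c.
Proof. by move=> H; apply: pair_norm_le; [exact: (H true)|exact: (H false)]. Qed.

Fixpoint euler (w : R -> R * R -> R * R) (h : R) (k : nat) q : R * R :=
  if k is k'.+1 then
    let p := euler w h k' q in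
    (p.1 + h * (w (k'%:R * h) p).1, p.2 + h * (w (k'%:R * h) p).2)
  else q.

Lemma eulerS w h k q b : cd b (euler w h k.+1 q) =
  cd b (euler w h k q) + h * cd b (w (k%:R * h) (euler w h k q)).
Proof. by case: b. Qed.

Variables (w : R -> R * R -> R * R) (L C : R).
Hypotheses (L0 : 0 <= L) (C0 : 0 <= C)
  (wL : forall s s' q q', `|w s q - w s' q'| <= L * (`|s - s'| + `|q - q'|))
  (wC : forall s q, `|w s q| <= C).

Local Notation E := (euler w).

Let LC0 : 0 <= L * (1 + C).
Proof. by apply: mulr_ge0 => //; exact: addr_ge0. Qed.


Lemma euler_speed h k m q : 0 <= h ->
  `|E h (k + m) q - E h k q| <= m%:R * h * C.
Proof.
move=> h0; elim: m => [|m IH]; first by rewrite addn0 subrr normr0 !mul0r.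
apply: cd_pair_norm_le => b; rewrite addnS eulerS.
have [h1 h2] := norm_le_bounds (le_trans (cdB_norm_le b _ _) IH).
have [h3 h4] := norm_le_bounds (le_trans (cd_norm_le b _) (wC ((k + m)%:R * h) (E h (k + m) q))).
have := ler_wpM2l h0 h3; have := ler_wpM2l h0 h4.
by rewrite -natr1; move=> h5 h6; apply: bounds_norm_le; nra.
Qed.

(** In time [m%:R * h] the polygon moves by at most [m%:R * h * C], so its velocity stays within
    [L * (1 + C) * (m%:R * h)] of the initial one; summing over the steps gives a quadratic
    error. *)
Lemma euler_consistent h k m q b : 0 <= h ->
  `|cd b (E h (k + m) q) - cd b (E h k q) - m%:R * h * cd b (w (k%:R * h) (E h k q))|
   <= L * (1 + C) * (m%:R * h) ^+ 2.
Proof.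
move=> h0; elim: m => [|m IH]; first by rewrite addn0 !mul0r expr0n mulr0 !subrr normr0.
rewrite addnS eulerS.
have := le_trans (cdB_norm_le b _ _) (wL ((k + m)%:R * h) (k%:R * h) (E h (k + m) q) (E h k q)).
set W := cd b (w ((k + m)%:R * h) _); set W0 := cd b (w (k%:R * h) _) in IH * => hW.
have {}hW : `|W - W0| <= L * (1 + C) * (m%:R * h).
  apply: le_trans hW _; rewrite -mulrA; apply: ler_wpM2l => //.
  have -> : (k + m)%:R * h - k%:R * h = m%:R * h by rewrite natrD; ring.
  rewrite ger0_norm ?mulr_ge0//.
  by have := euler_speed k m q h0; nra.
have [h1 h2] := norm_le_bounds IH; have [h3 h4] := norm_le_bounds hW.
have h5 := ler_wpM2l h0 h3; have h6 := ler_wpM2l h0 h4.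
have m0 : 0 <= m%:R :> R by [].
have h7 : 0 <= L * (1 + C) * (m%:R * h) * h by rewrite mulr_ge0// mulr_ge0// mulr_ge0.
have h8 : 0 <= L * (1 + C) * h ^+ 2 by rewrite mulr_ge0 ?sqr_ge0.
by rewrite -natr1; apply: bounds_norm_le; nra.
Qed.

(** From a common point, two half steps and one full step differ by at most [L * (1 + C) * h ^+ 2],
    since only the second half step sees another velocity. Gronwall accumulates these local
    errors. *)
Lemma euler_halving h k q : 0 <= h ->
  `|E (h / 2) k.*2 q - E h k q| <=
    expR (k%:R * (h * L)) * (k%:R * (L * (1 + C) * h ^+ 2)).
Proof.
move=> h0; have hL : 0 <= h * L by rewrite mulr_ge0.
have hb : 0 <= L * (1 + C) * h ^+ 2 by rewrite mulr_ge0 ?sqr_ge0.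
have := @discrete_gronwall R (fun k => `|E (h / 2) k.*2 q - E h k q|) _ _ k hL hb.
cbv beta; rewrite (_ : E (h / 2) 0.*2 q - E h 0 q = 0) ?subrr// normr0 add0r.
apply => // i _; rewrite doubleS.
apply: cd_pair_norm_le => b; rewrite !eulerS.
have -> : i.*2%:R * (h / 2) = i%:R * h by rewrite -muln2 natrM; field.
have -> : i.*2.+1%:R * (h / 2) = i%:R * h + h / 2 by rewrite -natr1 -muln2 natrM; field.
set y := E (h / 2) i.*2 q; set y1 := E (h / 2) i.*2.+1 q; set x := E h i q.
have h20 : 0 <= h / 2 by lra.
have hy : `|y1 - x| <= `|y - x| + h / 2 * C.
  have := euler_speed i.*2 1 q h20; rewrite addn1 -/y -/y1 mul1r => hs.
  have -> : y1 - x = (y - x) + (y1 - y) by rewrite [in RHS]addrC addrA subrK.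
  by apply: le_trans (ler_normD _ _) _; lra.
have [h1 h2] := norm_le_bounds (cdB_norm_le b y x).
have h3 := le_trans (cdB_norm_le b _ _) (wL (i%:R * h) (i%:R * h) y x).
rewrite subrr normr0 add0r in h3.
have h4 := le_trans (cdB_norm_le b _ _) (wL (i%:R * h + h / 2) (i%:R * h) y1 x).
rewrite addrAC subrr add0r (ger0_norm h20) in h4.
have {h4} h4 := le_trans h4 (ler_wpM2l L0 (lerD (lexx (h / 2)) hy)).
have [a1 a2] := norm_le_bounds h3; have [b1 b2] := norm_le_bounds h4.
have := ler_wpM2l h20 a1; have := ler_wpM2l h20 a2.
have := ler_wpM2l h20 b1; have := ler_wpM2l h20 b2.
move=> c1 c2 c3 c4; have : 0 <= L * (1 + C) * h ^+ 2 by [].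
by move=> c5; apply: bounds_norm_le; nra.
Qed.

Lemma euler_lipschitz h k q q' : 0 <= h ->
  `|E h k q - E h k q'| <= expR (k%:R * (h * L)) * `|q - q'|.
Proof.
move=> h0; have hL : 0 <= h * L by rewrite mulr_ge0.
have := @discrete_gronwall R (fun k => `|E h k q - E h k q'|) _ 0 k hL (lexx _).
rewrite mulr0 addr0; apply => // i _; rewrite addr0.
apply: cd_pair_norm_le => b; rewrite !eulerS.
have [h1 h2] := norm_le_bounds (cdB_norm_le b (E h i q) (E h i q')).
have := le_trans (cdB_norm_le b _ _) (wL (i%:R * h) (i%:R * h) (E h i q) (E h i q')).
rewrite subrr normr0 add0r => /norm_le_bounds[h3 h4].
have := ler_wpM2l h0 h3; have := ler_wpM2l h0 h4.
by move=> ? ?; apply: bounds_norm_le; nra.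
Qed.

(** At height [u = p.2 - p.1] above the diagonal both components of [w] are within [L * u] of one
    common value, that of [w] at [(p.1, p.1)]. One step therefore shrinks the gap by at most the
    factor [1 - 2 * (h * L)]. *)
Lemma euler_above_diagonal h k q : (forall s x, (w s (x, x)).1 = (w s (x, x)).2) ->
  0 <= h -> 4 * (h * L) <= 1 -> q.1 < q.2 ->
  expR (- (k%:R * (4 * (h * L)))) * (q.2 - q.1) <= (E h k q).2 - (E h k q).1.
Proof.
move=> wd h0 hL q12; elim: k => [|k IH]; first by rewrite mul0r oppr0 expR0 mul1r.
set p := E h k q in IH *.
have u0 : 0 <= p.2 - p.1.
  by apply: le_trans IH; rewrite mulr_ge0 ?expR_ge0//; lra.
have h1 b := le_trans (cdB_norm_le b _ _) (wL (k%:R * h) (k%:R * h) p (p.1, p.1)).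
have hn : `|p - (p.1, p.1)| = p.2 - p.1.
  by rewrite prod_normE /= subrr normr0 max_r// ger0_norm.
rewrite hn subrr normr0 add0r in h1.
have [a1 a2] := norm_le_bounds (h1 true); have [b1 b2] := norm_le_bounds (h1 false).
rewrite /= wd in a1 a2; rewrite /= in b1 b2.
(* With [x = h * L]: [exp (4 x) >= 1 + 4 x], and [(1 + 4 x) (1 - 2 x) >= 1] because [4 x <= 1]. *)
have hE : expR (- (4 * (h * L))) <= 1 - 2 * (h * L).
  have e0 : 0 <= h * L by rewrite mulr_ge0.
  have := expR_ge1Dx (4 * (h * L)).
  rewrite expRN; set e := expR _ => he.
  by rewrite -div1r ler_pdivrMr; nra.
have -> : - (k.+1%:R * (4 * (h * L))) = - (k%:R * (4 * (h * L))) + - (4 * (h * L)).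
  by rewrite -natr1; ring.
rewrite expRD mulrAC.
have h2 := ler_wpM2r (expR_ge0 (- (4 * (h * L)))) IH.
apply: le_trans h2 _; have h3 := ler_wpM2l u0 hE.
apply: le_trans h3 _; rewrite /= -/p.
have := ler_wpM2l h0 a1; have := ler_wpM2l h0 a2.
have := ler_wpM2l h0 b1; have := ler_wpM2l h0 b2.
by move=> *; nra.
Qed.

Let cst s : R := expR (s * L) * (s * (L * (1 + C))) + C.

Lemma dyadic_index s n : 0 <= s ->
  (Num.truncn (s * 2 ^+ n))%:R * 2^-1 ^+ n <= s
  /\ s < (Num.truncn (s * 2 ^+ n)).+1%:R * 2^-1 ^+ n :> R.
Proof.
move=> s0; have /truncn_itv /andP[h1 h2] : 0 <= s * 2 ^+ n :> R by rewrite mulr_ge0 ?exprn_ge0.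
have e : 2 ^+ n * 2^-1 ^+ n = 1 :> R by rewrite -exprMn mulfV ?expr1n.
have p0 : 0 < 2^-1 ^+ n :> R by rewrite exprn_gt0.
have := ler_wpM2r (ltW p0) h1; have : s * 2 ^+ n * 2^-1 ^+ n < (Num.truncn (s * 2 ^+ n)).+1%:R * 2^-1 ^+ n.
  by rewrite ltr_pM2r.
by rewrite -mulrA e mulr1.
Qed.

Let dyadic_half s n : 0 <= s ->
  exists2 d : nat, (d <= 1)%N & Num.truncn (s * 2 ^+ n.+1 : R) = ((Num.truncn (s * 2 ^+ n : R)).*2 + d)%N.
Proof.
move=> s0; have /truncn_itv : 0 <= s * 2 ^+ n :> R by rewrite mulr_ge0 ?exprn_ge0.
have /truncn_itv : 0 <= s * 2 ^+ n.+1 :> R by rewrite mulr_ge0 ?exprn_ge0.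
set k := Num.truncn _; set k' := Num.truncn _ => /andP[h1 h2] /andP[h3 h4].
have e : s * 2 ^+ n.+1 = (s * 2 ^+ n) * 2 by rewrite exprS; ring.
rewrite e in h1 h2.
have a1 : (k'.*2 < k.+1)%N.
  by rewrite -(ltr_nat R) -muln2 natrM; lra.
have a2 : (k < k'.+1.*2)%N.
  by rewrite -(ltr_nat R) -muln2 natrM; lra.
exists (k - k'.*2)%N; last by rewrite subnKC.
by rewrite leq_subLR addn1 -ltnS; rewrite doubleS in a2.
Qed.

(** From one dyadic level to the next the rounded index doubles, up to one extra half step. Halving
    and the extra step both cost a multiple of [2^-1 ^+ n], so the approximations are geometrically
    Cauchy at each point. Choice gives [X] no regularity; that is recovered later from the explicit
    rate. *)
Lemma euler_limit : exists X : R -> R * R -> R * R, forall s q n, 0 <= s ->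
  `|X s q - E (2^-1 ^+ n) (Num.truncn (s * 2 ^+ n)) q| <= 2 * cst s * 2^-1 ^+ n.
Proof.
suff H (sq : R * (R * R)) : exists l : R * R, forall n, 0 <= sq.1 ->
    `|l - E (2^-1 ^+ n) (Num.truncn (sq.1 * 2 ^+ n)) sq.2| <= 2 * cst sq.1 * 2^-1 ^+ n.
  have [X HX] := choice H; exists (fun s q => X (s, q)) => s q n s0.
  exact: (HX (s, q)).
case: sq => s q /=; have [s0|s0] := leP 0 s; last by exists q => n; lra.
pose u n := E (2^-1 ^+ n) (Num.truncn (s * 2 ^+ n)) q.
have hu b n : `|cd b (u n.+1) - cd b (u n)| <= cst s * 2^-1 ^+ n.
  apply: le_trans (cdB_norm_le _ _ _) _; rewrite /u.
  have [d d1 ->] := dyadic_half n s0.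
  have h0 : 0 <= 2^-1 ^+ n.+1 :> R by rewrite exprn_ge0.
  have h0' : 0 <= 2^-1 ^+ n :> R by rewrite exprn_ge0.
  have [i1 i2] := dyadic_index n s0.
  set k := Num.truncn _ in i1 i2 *.
  have a1 := euler_speed k.*2 d q h0.
  have a2 := euler_halving k q h0'.
  have e : 2^-1 ^+ n / 2 = 2^-1 ^+ n.+1 :> R by rewrite exprSr.
  rewrite e in a2.
  have a3 : d%:R * 2^-1 ^+ n.+1 * C <= 2^-1 ^+ n * C.
    apply: ler_wpM2r => //; rewrite -e.
    have : d%:R <= 1 :> R by rewrite -[1]/(1%:R) ler_nat.
    by move=> dd; have := ler_wpM2r h0' dd; lra.
  have a4 : expR (k%:R * (2^-1 ^+ n * L)) * (k%:R * (L * (1 + C) * (2^-1 ^+ n) ^+ 2))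
     <= expR (s * L) * (s * (L * (1 + C))) * 2^-1 ^+ n.
    have -> : k%:R * (2^-1 ^+ n * L) = (k%:R * 2^-1 ^+ n) * L by ring.
    have -> : k%:R * (L * (1 + C) * (2^-1 ^+ n) ^+ 2) = (k%:R * 2^-1 ^+ n) * (L * (1 + C)) * 2^-1 ^+ n by ring.
    rewrite [X in X <= _]mulrA; apply: ler_wpM2r => //.
    apply: ler_pM; rewrite ?expR_ge0//.
      by rewrite mulr_ge0// mulr_ge0.
      by rewrite ler_expR ler_wpM2r.
    by rewrite ler_wpM2r.
  have -> : E (2^-1 ^+ n.+1) (k.*2 + d) q - E (2^-1 ^+ n) k q =
    (E (2^-1 ^+ n.+1) (k.*2 + d) q - E (2^-1 ^+ n.+1) k.*2 q) +
    (E (2^-1 ^+ n.+1) k.*2 q - E (2^-1 ^+ n) k q) by rewrite addrA subrK.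
  by apply: le_trans (ler_normD _ _) _; rewrite /cst; lra.
have [l1 H1] := geometric_cauchy (hu true).
have [l2 H2] := geometric_cauchy (hu false).
exists (l1, l2) => n _; apply: cd_pair_norm_le => -[].
- exact: H1.
- exact: H2.
Qed.

End Euler.

(** * Flows of bounded Lipschitz velocity fields *)

Section Flow.
Context {R : realType}.
Implicit Types (p q : R * R).
Variables (w : R -> R * R -> R * R) (L C : R).
Hypotheses (L0 : 0 <= L) (C0 : 0 <= C)
  (wL : forall s s' q q', `|w s q - w s' q'| <= L * (`|s - s'| + `|q - q'|))
  (wC : forall s q, `|w s q| <= C).

Let bound_by_dyadic x y c c' :
  0 <= c -> 0 <= c' -> (forall n, x <= y + c * 2^-1 ^+ n + c' * 2^-1 ^+ n) -> x <= y :> R.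
Proof.
move=> c0 c0' H; apply: (@le_of_le_add_geometric R _ _ (c + c')); first exact: addr_ge0.
by move=> n; rewrite mulrDl addrA; exact: H.
Qed.

(** The differential equation is expressed as a Taylor bound based at any time [s], forward and
    backward: this form passes to the limit without derivatives or integrals and is exactly the
    local error that Euler's scheme consumes. The last clause is invariance of the region above the
    diagonal under a velocity tangent to it. *)
Theorem cauchy_lipschitz : exists X : R -> R * R -> R * R,
  [/\ forall q, X 0 q = q,
      forall s s' q, 0 <= s -> 0 <= s' -> `|X s' q - X s q| <= C * `|s' - s|,
      forall s s' q b, 0 <= s -> 0 <= s' ->
        `|cd b (X s' q) - cd b (X s q) - (s' - s) * cd b (w s (X s q))|
        <= 2 * (L * (1 + C)) * (s' - s) ^+ 2,
      forall s q q', 0 <= s -> `|X s q - X s q'| <= expR (s * L) * `|q - q'|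
    & (forall s x, (w s (x, x)).1 = (w s (x, x)).2) ->
      forall s q, 0 <= s -> q.1 < q.2 -> (X s q).1 < (X s q).2].
Proof.
have [X HX] := euler_limit L0 C0 wL wC.
set K := fun s : R => 2 * (expR (s * L) * (s * (L * (1 + C))) + C) in HX.
have LC0 : 0 <= L * (1 + C) by apply: mulr_ge0 => //; exact: addr_ge0.
have K0 s : 0 <= s -> 0 <= K s.
  by move=> s0; rewrite /K mulr_ge0// addr_ge0// mulr_ge0 ?expR_ge0// mulr_ge0.
pose h n : R := 2^-1 ^+ n.
have h0 n : 0 <= h n by rewrite exprn_ge0.
have h1 n : h n <= 1 by apply: exprn_ile1; lra.
pose N (s : R) n := Num.truncn (s * 2 ^+ n).
have idx (s : R) n : 0 <= s -> (N s n)%:R * h n <= s /\ s < (N s n)%:R * h n + h n.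
  move=> s0; have [a1 a2] := dyadic_index n s0; split=> //.
  by rewrite -[X in _ + X]mul1r -mulrDl natr1.
have Xcd (s : R) q n b : 0 <= s ->
    `|cd b (X s q) - cd b (euler w (h n) (N s n) q)| <= K s * h n.
  by move=> s0; apply: le_trans (cdB_norm_le b _ _) (HX s q n s0).
have idx_mono s s' n : s <= s' -> (N s n <= N s' n)%N.
  by move=> ss; apply: le_truncn; rewrite ler_wpM2r ?exprn_ge0.
have gap s s' n : 0 <= s -> s <= s' ->
    `|(N s' n - N s n)%N%:R * h n - (s' - s)| <= h n.
  move=> s0 ss'; have s0' : 0 <= s' by exact: le_trans ss'.
  have [a1 a2] := idx s n s0; have [b1 b2] := idx s' n s0'.
  rewrite natrB ?idx_mono// mulrBl.
  by apply: bounds_norm_le; lra.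
have X0 q : X 0 q = q.
  have e n b : `|cd b (X 0 q) - cd b q| <= K 0 * 2^-1 ^+ n.
    by have := Xcd 0 q n b (lexx _); rewrite /N mul0r truncn0.
  have e0 b : cd b (X 0 q) = cd b q.
    apply/eqP; rewrite -subr_eq0 -normr_le0; apply: (@le_of_le_add_geometric R _ _ (K 0)).
      exact: K0.
    by move=> n; rewrite add0r; exact: e.
  by rewrite [LHS]surjective_pairing [RHS]surjective_pairing; congr pair;
    [exact: (e0 true)|exact: (e0 false)].
have speed s s' q : 0 <= s -> s <= s' -> `|X s' q - X s q| <= C * (s' - s).
  move=> s0 ss'; have s0' : 0 <= s' by exact: le_trans ss'.
  apply: cd_pair_norm_le => b.
  apply: (@bound_by_dyadic _ _ (K s' + K s) C) => //; first by rewrite addr_ge0 ?K0.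
  move=> n; rewrite -/(h n).
  have [a1 a2] := norm_le_bounds (Xcd s q n b s0).
  have [b1 b2] := norm_le_bounds (Xcd s' q n b s0').
  have := euler_speed wC (N s n) (N s' n - N s n) q (h0 n).
  rewrite subnKC ?idx_mono// => /(le_trans (cdB_norm_le b _ _)) /norm_le_bounds[c1 c2].
  have [_ d2] := norm_le_bounds (gap s s' n s0 ss').
  have := ler_wpM2r C0 d2.
  by move=> d3; apply: bounds_norm_le; nra.
have quad s s' q b : 0 <= s -> s <= s' ->
    `|cd b (X s' q) - cd b (X s q) - (s' - s) * cd b (w s (X s q))|
        <= L * (1 + C) * (s' - s) ^+ 2.
  move=> s0 ss'; have s0' : 0 <= s' by exact: le_trans ss'.
  apply: (@bound_by_dyadic _ _ (K s' + K s) (L * (1 + C) * (2 * (s' - s) + 1) + C + (s' - s) * (L * (1 + K s)))).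
  - by rewrite addr_ge0 ?K0.
  - apply: addr_ge0; first by apply: addr_ge0 => //; apply: mulr_ge0 => //; lra.
    apply: mulr_ge0; first lra.
    by apply: mulr_ge0 => //; apply: addr_ge0 => //; exact: K0.
  move=> n; rewrite -/(h n).
  have [a1 a2] := norm_le_bounds (Xcd s q n b s0).
  have [b1 b2] := norm_le_bounds (Xcd s' q n b s0').
  have := euler_consistent L0 C0 wL wC (N s n) (N s' n - N s n) q b (h0 n).
  rewrite subnKC ?idx_mono//; set W0 := cd b (w (_ * _) _) => /norm_le_bounds[c1 c2].
  have := gap s s' n s0 ss'; set m := (N s' n - N s n)%N in c1 c2 *.
  move=> /norm_le_bounds[d1 d2].
  have W0C : `|W0| <= C by apply: le_trans (cd_norm_le _ _) (wC _ _).
  have hW : `|W0 - cd b (w s (X s q))| <= L * (h n + K s * h n).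
    apply: le_trans (cdB_norm_le b _ _) _; apply: le_trans (wL _ _ _ _) _.
    apply: ler_wpM2l => //; apply: lerD.
      have [e1 e2] := idx s n s0.
      by apply: bounds_norm_le; lra.
    by rewrite distrC; exact: HX.
  have [w1 w2] := norm_le_bounds W0C; have [v1 v2] := norm_le_bounds hW.
  have p1 : `|(m%:R * h n - (s' - s)) * W0| <= h n * C.
    by rewrite normrM; apply: ler_pM => //; apply: bounds_norm_le; lra.
  have s's : 0 <= s' - s by lra.
  have q1 := ler_wpM2l s's v1; have q2 := ler_wpM2l s's v2.
  have [r1 r2] := norm_le_bounds p1.
  have sq : (m%:R * h n) ^+ 2 <= (s' - s) ^+ 2 + (2 * (s' - s) + 1) * h n.
    have m0 : 0 <= m%:R * h n by rewrite mulr_ge0.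
    have mle : m%:R * h n <= s' - s + h n by lra.
    have := ler_pM m0 m0 mle mle; have := ler_wpM2r (h0 n) (h1 n).
    by rewrite !expr2; lra.
  have sq' := ler_wpM2l LC0 sq.
    by apply: bounds_norm_le; nra.
exists X; split => //.
- move=> s s' q s0 s0'; have [ss'|/ltW ss'] := leP s s'.
    by rewrite (@ger0_norm _ (s' - s)) ?subr_ge0//; exact: speed.
  by rewrite distrC (distrC s') (@ger0_norm _ (s - s')) ?subr_ge0//; exact: speed.
- move=> s s' q b s0 s0'; have [ss'|/ltW ss'] := leP s s'.
    apply: le_trans (quad _ _ _ _ s0 ss') _.
    by apply: ler_wpM2r; [exact: sqr_ge0|lra].
  (* Backward in time the bound is taken from [s'], and moving the velocity from [s'] to [s] costs
     the second [L * (1 + C)]. *)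
  have [a1 a2] := norm_le_bounds (quad s' s q b s0' ss').
  have d0 : 0 <= s - s' by lra.
  have := le_trans (cdB_norm_le b _ _) (wL s s' (X s q) (X s' q)).
  rewrite (@ger0_norm _ (s - s'))// => hw.
  have {hw} : `|cd b (w s (X s q)) - cd b (w s' (X s' q))| <= L * (1 + C) * (s - s').
    apply: le_trans hw _; rewrite -mulrA; apply: ler_wpM2l => //.
    by have := speed s' s q s0' ss'; nra.
  move=> /norm_le_bounds[b1 b2].
  have := ler_wpM2l d0 b1; have := ler_wpM2l d0 b2.
  by move=> c1 c2; apply: bounds_norm_le; nra.
- move=> s q q' s0; apply: cd_pair_norm_le => b.
  apply: (@bound_by_dyadic _ _ (K s) (K s)); [exact: K0|exact: K0|move=> n].
  have [a1 a2] := norm_le_bounds (Xcd s q n b s0).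
  have [b1 b2] := norm_le_bounds (Xcd s q' n b s0).
  have := le_trans (cdB_norm_le b _ _) (euler_lipschitz L0 wL (N s n) q q' (h0 n)).
  move=> /norm_le_bounds[c1 c2].
  have : expR ((N s n)%:R * (h n * L)) * `|q - q'| <= expR (s * L) * `|q - q'|.
    apply: ler_wpM2r => //; rewrite ler_expR mulrA; apply: ler_wpM2r => //.
    by have [] := idx s n s0.
  by move=> d; rewrite -/(h n); apply: bounds_norm_le; lra.
- move=> wd s q s0 q12; rewrite -subr_gt0.
  apply: (@lt_le_trans _ _ (expR (- (4 * (s * L))) * (q.2 - q.1))).
    by rewrite mulr_gt0 ?expR_gt0 ?subr_gt0.
  (* The estimate of the gap requires [4 * (h * L) <= 1], so finitely many dyadic levels are
     skipped. *)
  have [n0 hn0] : exists n0, forall n, 4 * (h (n + n0)%N * L) <= 1.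
    have : (fun n => 4 * (h n * L)) @ \oo --> 4 * (0 * L).
      apply: cvgM; first exact: cvg_cst.
      by apply: cvgM; [apply: cvg_expr; rewrite ger0_norm; lra|exact: cvg_cst].
    rewrite mul0r mulr0 => /cvgrPdist_le /(_ 1 ltr01)[n0 _ hn0].
    exists n0 => n; have /= := hn0 (n + n0)%N (leq_addl _ _).
    by rewrite sub0r normrN; apply: le_trans; exact: ler_norm.
  apply: (@bound_by_dyadic _ _ (K s) (K s)); [exact: K0|exact: K0|move=> n].
  have [a1 a2] := norm_le_bounds (Xcd s q (n + n0)%N true s0).
  have [b1 b2] := norm_le_bounds (Xcd s q (n + n0)%N false s0).
  have := euler_above_diagonal L0 wL (N s (n + n0)%N) wd (h0 (n + n0)%N) (hn0 n) q12.
  have : expR (- (4 * (s * L))) * (q.2 - q.1) <= expR (- ((N s (n + n0))%:R * (4 * (h (n + n0)%N * L)))) * (q.2 - q.1).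
    apply: ler_wpM2r; first by lra.
    rewrite ler_expR lerN2; have [i1 _] := idx s (n + n0)%N s0.
    by have := ler_wpM2r L0 i1 => ?; nra.
  have : K s * h (n + n0)%N <= K s * h n.
    apply: ler_wpM2l; first exact: K0.
    by rewrite /h exprD ler_piMr// exprn_ile1; lra.
  by rewrite -/(h n) /= in a1 a2 b1 b2 *; lra.
Qed.

End Flow.

(** * Integrals of bounded functions supported in a set of finite measure *)

Section BoundedIntegrals.
Context d {T : measurableType d} {R : realType} (m : {measure set T -> \bar R}).
Implicit Types (D : set T) (f g : T -> R).

Lemma bounded_integrable D (B : R) f : measurable D -> (m D < +oo)%E ->
  measurable_fun setT f -> (forall x, `|f x| <= B) -> (forall x, ~ D x -> f x = 0) ->
  m.-integrable setT (EFin \o f).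
Proof.
move=> mD Dfin mf fB f0.
suff : m.-integrable D (EFin \o f).
  move=> /(integrable_mkcond _ mD); congr (m.-integrable _ _).
  apply/funext => x; rewrite patchE; case: ifPn => // /negP xD /=.
  by rewrite f0//; apply: contra_not xD => /mem_set.
apply: (@le_integrable _ _ _ _ _ mD _ (cst B%:E)).
- by apply: measurable_funTS; exact/measurable_EFinP.
- by move=> x _; rewrite /= lee_fin (le_trans (fB x))// ler_norm.
- by rewrite /cst; apply/integrableP; split => //; rewrite integral_cst// lte_mul_pinfty.
Qed.

Lemma norm_Rintegral_le D (B : R) f : measurable D -> (m D < +oo)%E ->
  measurable_fun setT f -> (forall x, `|f x| <= B) -> (forall x, ~ D x -> f x = 0) ->
  `|\int[m]_x f x| <= B * fine (m D).
Proof.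
move=> mD Dfin mf fB f0.
have intf := bounded_integrable mD Dfin mf fB f0.
have B0 : 0 <= B by exact: le_trans (fB point).
apply: le_trans (le_normr_Rintegral _ intf) _ => //.
rewrite -Rintegral_cst// [leRHS]Rintegral_mkcond.
apply: le_Rintegral => //.
- apply: (bounded_integrable (B := B) mD Dfin).
  + exact: measurableT_comp.
  + by move=> x; rewrite normr_id.
  + by move=> x Dx; rewrite f0 ?normr0.
- apply: (bounded_integrable (B := B) mD Dfin).
  + by apply/(measurable_restrictT _ mD); exact: measurable_cst.
  + by move=> x; rewrite patchE; case: ifP => _; rewrite ?ger0_norm ?normr0.
  + by move=> x Dx; rewrite patchE memNset.
move=> x _; rewrite patchE; case: ifPn => [_|/negP xD]; first exact: fB.
by rewrite f0 ?normr0//; apply: contra_not xD => /mem_set.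
Qed.

End BoundedIntegrals.

Section Measurability.
Context {R : realType}.

(** Rounding the first argument down to a grid of mesh [1 / (n + 1)] makes every preimage a
    countable union of rectangles; continuity in the first argument makes the rounded functions
    converge pointwise. *)
Lemma caratheodory_measurable d (T : measurableType d) (f : R -> T -> R) :
  (forall t, measurable_fun setT (f t)) -> (forall q, continuous (f ^~ q)) ->
  measurable_fun setT (fun p : R * T => f p.1 p.2).
Proof.
move=> mf cf.
pose t n (x : R) : R := (Num.floor (x * n.+1%:R))%:~R / n.+1%:R.
have n0 n : 0 < n.+1%:R :> R by [].
have tcvg x : t ^~ x @ \oo --> x.
  apply/cvgrPdist_le => e e0.
  have /cvgrPdist_le /(_ e e0) [N _ HN] := @cvg_harmonic R.
  exists N => // n /HN; rewrite /= sub0r normrN ger0_norm ?invr_ge0// => hn.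
  apply: le_trans hn; rewrite /t.
  have := floor_itv (x * n.+1%:R); rewrite intrD => /andP[a b].
  have -> : x = (x * n.+1%:R) / n.+1%:R by rewrite mulfK ?gt_eqF.
  rewrite -mulrBl normrM (@ger0_norm _ (n.+1%:R^-1)) ?invr_ge0// ler_piMl ?invr_ge0//.
  by rewrite mulfK ?gt_eqF// ger0_norm; lra.
apply: (@measurable_fun_cvg _ _ _ _ (fun n p => f (t n p.1) p.2)); last first.
  move=> p _; exact: (continuous_cvg _ (cf p.2 p.1) (tcvg p.1)).
move=> n _ Y mY; rewrite setTI.
rewrite [X in measurable X](_ : _ = \bigcup_(k : int)
   (((fun x : R => Num.floor (x * n.+1%:R)) @^-1` [set k]) `*`
     (f (k%:~R / n.+1%:R) @^-1` Y))); last first.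
  apply/seteqP; split => [[x q] /= H|[x q] [k _ [/= <-]]//].
  by exists (Num.floor (x * n.+1%:R)).
apply: countable_bigcupT_measurable => [|k]; first exact: countableP.
apply: measurableX; last by rewrite -[X in measurable X]setTI; exact: mf.
rewrite [X in measurable X](_ : _ = `[k%:~R / n.+1%:R, (k + 1)%:~R / n.+1%:R[%classic)//.
apply/seteqP; split => x /=; rewrite in_itv/= ler_pdivrMr// ltr_pdivlMr//.
  by move=> <-; exact: floor_itv.
by move=> h; apply/eqP; rewrite floor_eq.
Qed.

Definition lipschitz2 (L : R) (f : R * R -> R) :=
  forall p q, `|f p - f q| <= L * `|p - q|.

Definition lipschitz3 (L : R) (f : R -> R * R -> R) :=
  forall s s' q q', `|f s q - f s' q'| <= L * (`|s - s'| + `|q - q'|).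

Lemma lipschitz_continuous (L : R) (f : R -> R) :
  (forall x y, `|f x - f y| <= L * `|x - y|) -> continuous f.
Proof.
move=> fL x; apply/cvgrPdist_le => e e0.
near=> y; apply: le_trans (fL x y) _.
apply: (@le_trans _ _ ((`|L| + 1) * `|x - y|)).
  by apply: ler_wpM2r => //; have := ler_norm L; lra.
have L1 : 0 < `|L| + 1 by have := normr_ge0 L; lra.
rewrite -ler_pdivlMl// mulrC ltW//.
by near: y; apply: cvgr_dist_lt => //; rewrite divr_gt0.
Unshelve. all: by end_near. Qed.

(** Measurability on [R * R] refers to the product sigma-algebra, so the argument goes through the
    two variables separately. *)
Lemma lipschitz2_measurable L f : lipschitz2 L f -> measurable_fun setT f.
Proof.
move=> fL; rewrite (_ : f = fun p => (fun x y => f (x, y)) p.1 p.2); last first.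
  by apply/funext => -[].
apply: (@caratheodory_measurable _ _ (fun x y => f (x, y))) => [x|y].
  apply: continuous_measurable_fun; apply: (@lipschitz_continuous L) => y y'.
  apply: le_trans (fL _ _) _.
  by rewrite prod_normE /= subrr normr0 max_r.
apply: (@lipschitz_continuous L) => x x'.
apply: le_trans (fL _ _) _.
by rewrite prod_normE /= subrr normr0 max_l.
Qed.

Lemma lipschitz3_slice L f s : lipschitz3 L f -> lipschitz2 L (f s).
Proof. by move=> fL p q; have := fL s s p q; rewrite subrr normr0 add0r. Qed.

Lemma lipschitz3_measurable L f : lipschitz3 L f ->
  measurable_fun setT (fun p : R * (R * R) => f p.1 p.2).
Proof.
move=> fL; apply: caratheodory_measurable => [s|q].
  exact: lipschitz2_measurable (lipschitz3_slice s fL).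
apply: (@lipschitz_continuous L) => s s'.
by have := fL s s' q q; rewrite subrr normr0 addr0.
Qed.

Definition square (b : R) : set (R * R) := [set q | `|q| <= b].

Lemma squareE b : square b = `[- b, b]%classic `*` `[- b, b]%classic.
Proof.
apply/seteqP; split => -[x y]; rewrite /square /= prod_normE /= ge_max !in_itv /= !ler_norml.
  by move=> /andP[].
by move=> [-> ->].
Qed.

Lemma measurable_square b : measurable (square b).
Proof. by rewrite squareE; apply: measurableX. Qed.

Lemma lebesgue_measure_segment (b : R) : 0 <= b ->
  @lebesgue_measure R `[- b, b] = (2 * b)%:E.
Proof.
move=> b0; rewrite lebesgue_measure_itv /= lte_fin.
case: ltP => bb; last by rewrite (_ : b = 0) ?mulr0//; lra.
by rewrite -EFinB; congr EFin; ring.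
Qed.

Lemma leb2_square b : 0 <= b -> @leb2 R (square b) = ((2 * b) ^+ 2)%:E.
Proof.
move=> b0; rewrite squareE /leb2.
have := @product_measure1E _ _ _ _ R lebesgue_measure lebesgue_measure
  `[- b, b]%classic `[- b, b]%classic (measurable_itv _) (measurable_itv _).
move=> e; apply: (eq_trans e); transitivity ((2 * b)%:E * (2 * b)%:E)%E.
  by congr (_ * _)%E; exact: lebesgue_measure_segment.
by rewrite -EFinM expr2.
Qed.

Lemma leb2_square_fin b : (@leb2 R (square b) < +oo)%E.
Proof.
have [b0|b0] := leP 0 b; first by rewrite leb2_square// ltry.
have -> : square b = set0.
  apply/seteqP; split=> // q; rewrite /square /= => h.
  by have := normr_ge0 q; lra.
have -> : @leb2 R set0 = 0%E by exact: measure0.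
exact: ltry.
Qed.

(** The image of Lebesgue measure under a translation has the same values on half-open intervals,
    hence is Lebesgue measure; the rest is change of variables. *)
Lemma ge0_integral_shift (f : R -> \bar R) (c : R) : measurable_fun setT f ->
  (forall x, 0 <= f x)%E ->
  integral (@lebesgue_measure R) setT (fun x : R => f (x + c)) =
  integral (@lebesgue_measure R) setT f.
Proof.
move=> mf f0; have mphi : @measurable_fun _ _ (measurableTypeR R) (measurableTypeR R) setT (fun x : R => x + c).
  by apply: measurable_funD => //; exact: measurable_cst.
have := @ge0_integral_pushforward _ _ _ _ R _ mphi (@lebesgue_measure R) setT f measurableT mf (fun x _ => f0 x).
rewrite preimage_setT => <-.
apply: eq_measure_integral => A mA _; apply/esym.
apply: lebesgue_measure_unique => //.
move=> _ [[a b] _ <-] /=; rewrite /pushforward.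
rewrite (_ : _ @^-1` _ = `]a - c, b - c]%classic); last first.
  by apply/seteqP; split => x /=; rewrite !in_itv /= => /andP[? ?]; apply/andP; split; lra.
by rewrite !lebesgue_measure_itv /= !lte_fin ltrD2r; case: ifP => // _; rewrite -!EFinB; congr EFin; lra.
Qed.

Lemma Rintegral_shift (f : R -> R) (c : R) : measurable_fun setT f ->
  Rintegral (@lebesgue_measure R) setT (fun x : R => f (x + c)) =
  Rintegral (@lebesgue_measure R) setT f.
Proof.
move=> mf; rewrite /Rintegral; congr fine; rewrite [LHS]integralE [RHS]integralE.
have mfE : measurable_fun setT (EFin \o f) by exact/measurable_EFinP.
congr (_ - _)%E.
  have h := ge0_integral_shift c (measurable_funepos mfE) (fun x => funepos_ge0 _ x).
  by apply: (eq_trans _ (eq_trans h _)); apply: eq_integral => x _; rewrite !funeposE.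
have h := ge0_integral_shift c (measurable_funeneg mfE) (fun x => funeneg_ge0 _ x).
  by apply: (eq_trans _ (eq_trans h _)); apply: eq_integral => x _; rewrite !funenegE.
Qed.

End Measurability.

Section BoundedFinite.
Context d {T : measurableType d} {R : realType} (m : {measure set T -> \bar R}).
Implicit Types (D : set T) (f g : T -> R).

(** A class of integrable functions stable under linear combinations and under products with bounded
    measurable functions: integrability conditions reduce to closure properties. *)
Definition bounded_finite f := measurable_fun setT f /\ exists D (B : R),
  [/\ measurable D, (m D < +oo)%E, forall x, `|f x| <= B & forall x, ~ D x -> f x = 0].

Lemma bounded_finite_integrable f : bounded_finite f -> m.-integrable setT (EFin \o f).
Proof. by move=> [mf [D [B [mD Dfin fB f0]]]]; exact: (bounded_integrable mD Dfin mf fB f0). Qed.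

Lemma bounded_finiteM f g (B : R) : bounded_finite f -> measurable_fun setT g ->
  (forall x, `|g x| <= B) -> bounded_finite (fun x => f x * g x).
Proof.
move=> [mf [D [B' [mD Dfin fB f0]]]] mg gB; split; first exact: measurable_funM.
exists D, (B' * B); split => // x; last by move=> Dx; rewrite f0 ?mul0r.
by rewrite normrM; apply: ler_pM.
Qed.

Lemma bounded_finiteD f g : bounded_finite f -> bounded_finite g ->
  bounded_finite (fun x => f x + g x).
Proof.
move=> [mf [D [B [mD Dfin fB f0]]]] [mg [D' [B' [mD' Dfin' gB g0]]]].
split; first exact: measurable_funD.
exists (D `|` D'), (B + B'); split => [|||x].
- exact: measurableU.
- by apply: le_lt_trans (measureU2 m mD mD') _; rewrite lte_add_pinfty.
- by move=> x; apply: le_trans (ler_normD _ _) (lerD (fB x) (gB x)).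
- by move=> /not_orP[? ?]; rewrite f0// g0// addr0.
Qed.

Lemma bounded_finiteZ c f : bounded_finite f -> bounded_finite (fun x => c * f x).
Proof.
move=> [mf [D [B [mD Dfin fB f0]]]]; split.
  by apply: measurable_funM => //; exact: measurable_cst.
exists D, (`|c| * B); split => // x; last by move=> Dx; rewrite f0 ?mulr0.
by rewrite normrM ler_wpM2l.
Qed.

Lemma bounded_finiteB f g : bounded_finite f -> bounded_finite g ->
  bounded_finite (fun x => f x - g x).
Proof.
move=> bf bg; have := bounded_finiteD bf (bounded_finiteZ (-1) bg).
by congr bounded_finite; apply/funext => x; rewrite mulN1r.
Qed.

End BoundedFinite.

Section LineIntegral.
Context {R : realType}.
Implicit Types (f g : R -> R) (q : R * R).

Definition int1 f : R := Rintegral (@lebesgue_measure R) setT f.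
Definition int2 (F : R * R -> R) : R := Rintegral (@leb2 R) setT F.
Definition bf1 f := bounded_finite (@lebesgue_measure R) f.
Definition bf2 (F : R * R -> R) := bounded_finite (@leb2 R) F.

Lemma bf1_supp f b B : measurable_fun setT f -> (forall x, `|f x| <= B) ->
  (forall x, b < `|x| -> f x = 0) -> bf1 f.
Proof.
move=> mf fB f0; split=> //; exists `[- `|b|, `|b|]%classic, B; split => //.
  by have s := lebesgue_measure_segment (normr_ge0 b); rewrite [X in (X < _)%E]s ltry.
move=> x /= /negP; rewrite in_itv /= -ler_norml -ltNge => h; apply: f0.
exact: le_lt_trans (ler_norm b) h.
Qed.

Lemma bf2_supp (F : R * R -> R) b B : measurable_fun setT F -> (forall q, `|F q| <= B) ->
  (forall q, b < `|q| -> F q = 0) -> bf2 F.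
Proof.
move=> mf fB f0; split=> //; exists (square b), B; split => //.
- exact: measurable_square.
- exact: leb2_square_fin.
- by move=> q /negP; rewrite -ltNge => h; apply: f0.
Qed.

Lemma int1B f g : bf1 f -> bf1 g -> int1 (fun x => f x - g x) = int1 f - int1 g.
Proof. by move=> ? ?; apply: RintegralB => //; exact: bounded_finite_integrable. Qed.

Lemma int1Z c f : bf1 f -> int1 (fun x => c * f x) = c * int1 f.
Proof. by move=> ?; apply: RintegralZl => //; exact: bounded_finite_integrable. Qed.

Lemma int2D (f g : R * R -> R) : bf2 f -> bf2 g -> int2 (fun x => f x + g x) = int2 f + int2 g.
Proof. by move=> ? ?; apply: RintegralD => //; exact: bounded_finite_integrable. Qed.

Lemma int2B (f g : R * R -> R) : bf2 f -> bf2 g -> int2 (fun x => f x - g x) = int2 f - int2 g.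
Proof. by move=> ? ?; apply: RintegralB => //; exact: bounded_finite_integrable. Qed.

Lemma int2Z c (f : R * R -> R) : bf2 f -> int2 (fun x => c * f x) = c * int2 f.
Proof. by move=> ?; apply: RintegralZl => //; exact: bounded_finite_integrable. Qed.

Lemma int2_le (f g : R * R -> R) : bf2 f -> bf2 g -> (forall q, f q <= g q) -> int2 f <= int2 g.
Proof. by move=> ? ? ?; apply: le_Rintegral => //; exact: bounded_finite_integrable. Qed.

Lemma int1_norm_le f (u v B : R) : measurable_fun setT f -> u <= v ->
  (forall x, `|f x| <= B) -> (forall x, ~ (u <= x <= v) -> f x = 0) ->
  `|int1 f| <= B * (v - u).
Proof.
move=> mf uv fB f0.
have mE : @lebesgue_measure R `[u, v] = (v - u)%:E.
  rewrite lebesgue_measure_itv /= lte_fin; case: ltP => uv'; first by rewrite -EFinB.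
  by rewrite (_ : v - u = 0)//; lra.
rewrite -[v - u]/(fine (v - u)%:E) -mE; apply: norm_Rintegral_le => //.
  by rewrite [X in (X < _)%E]mE ltry.
Qed.

Lemma int2_norm_le (F : R * R -> R) (b B : R) : measurable_fun setT F -> 0 <= b ->
  (forall q, `|F q| <= B) -> (forall q, b < `|q| -> F q = 0) ->
  `|int2 F| <= B * (2 * b) ^+ 2.
Proof.
move=> mf b0 fB f0.
rewrite -[(2 * b) ^+ 2]/(fine ((2 * b) ^+ 2)%:E) -leb2_square//; apply: norm_Rintegral_le => //.
- exact: measurable_square.
- exact: leb2_square_fin.
- by move=> q /negP; rewrite -ltNge; exact: f0.
Qed.

Lemma int1_shift f c : measurable_fun setT f -> int1 (fun x => f (x + c)) = int1 f.
Proof. exact: Rintegral_shift. Qed.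

Lemma eq_int1 f g : f =1 g -> int1 f = int1 g.
Proof. by move=> /funext ->. Qed.

Lemma eq_int2 (f g : R * R -> R) : f =1 g -> int2 f = int2 g.
Proof. by move=> /funext ->. Qed.

Lemma int1_itv (i : interval R) (u v : R) : u <= v ->
  @lebesgue_measure R [set` i] = (v - u)%:E ->
  int1 (fun x => (x \in i)%:R) = v - u.
Proof.
move=> uv mE; rewrite /int1 /Rintegral.
transitivity (fine (\int[@lebesgue_measure R]_x (\1_[set` i] x)%:E)%E).
  congr fine; apply: eq_integral => x _; congr EFin; rewrite indicE.
  by congr (nat_of_bool _)%:R; apply/idP/idP => [xi|/set_mem//]; exact: mem_set.
by rewrite integral_indic// setIT; exact: (congr1 fine mE).
Qed.

Lemma step_bf1 (u v : R) : bf1 (fun x => (u <= x)%R%:R - (v <= x)%R%:R).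
Proof.
apply: (@bf1_supp _ (`|u| + `|v|) 2).
- by apply: measurable_funB; apply: measurableT_comp => //;
    apply: measurable_fun_ler => //; exact: measurable_cst.
- by move=> x; case: (leP u x) => _; case: (leP v x) => _; apply: bounds_norm_le => /=; lra.
move=> x hx; have [u1 u2] := norm_le_bounds (lexx `|u|); have [v1 v2] := norm_le_bounds (lexx `|v|).
have u0 := normr_ge0 u; have v0 := normr_ge0 v.
have [h|h] := leP 0 x.
  rewrite (@ger0_norm _ x)// in hx.
  have ux : u <= x by lra.
  have vx : v <= x by lra.
  by rewrite ux vx subrr.
rewrite (@ltr0_norm _ x)// in hx.
have /lt_geF -> : x < u by lra.
have /lt_geF -> : x < v by lra.
by rewrite subrr.
Qed.

Lemma int1_step (u v : R) : int1 (fun x => (u <= x)%R%:R - (v <= x)%R%:R) = v - u.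
Proof.
wlog uv : u v / u <= v.
  move=> H; have [uv|/ltW vu] := leP u v; first exact: H.
  rewrite -opprB -(H _ _ vu) -[RHS]mulN1r -int1Z; last exact: step_bf1.
  by apply: eq_int1 => x; rewrite mulN1r opprB.
rewrite -(@int1_itv `[u, v[ u v uv); last first.
  rewrite lebesgue_measure_itv /= lte_fin; case: ltP => uv'; first by rewrite -EFinB.
  by rewrite (_ : v - u = 0)//; lra.
apply: eq_int1 => x; rewrite in_itv /=.
case: (leP u x) => ux; case: (leP v x) => vx; rewrite /= ?subr0 ?subrr//.
by exfalso; lra.
Qed.

Lemma bf2_slice1 (F : R * R -> R) (y : R) b B : measurable_fun setT F -> (forall q, `|F q| <= B) ->
  (forall q : R * R, b < `|q| -> F q = 0) -> bf1 (fun x => F (x, y)).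
Proof.
move=> mF FB F0; apply: (@bf1_supp _ b B) => //.
- exact: measurableT_comp mF (pair2_measurable y).
- by move=> x hx; apply: F0; apply: lt_le_trans hx _; exact: (fst_norm_le (x, y)).
Qed.

Lemma bf2_slice2 (F : R * R -> R) (x : R) b B : measurable_fun setT F -> (forall q, `|F q| <= B) ->
  (forall q : R * R, b < `|q| -> F q = 0) -> bf1 (fun y => F (x, y)).
Proof.
move=> mF FB F0; apply: (@bf1_supp _ b B) => //.
- exact: measurableT_comp mF (pair1_measurable x).
- by move=> y hx; apply: F0; apply: lt_le_trans hx _; exact: (snd_norm_le (x, y)).
Qed.

(** The second conjunct returns the inner integral to the class [bf1], so that linear operations can
    go on in one variable. *)
Lemma int2_fubini1 (F : R * R -> R) b B : measurable_fun setT F -> (forall q, `|F q| <= B) ->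
  (forall q, b < `|q| -> F q = 0) ->
  int2 F = int1 (fun x => int1 (fun y => F (x, y))) /\
  bf1 (fun x => int1 (fun y => F (x, y))).
Proof.
move=> mF FB F0.
have iF := bounded_finite_integrable (bf2_supp mF FB F0).
have e x : (\int[@lebesgue_measure R]_y (F (x, y))%:E)%E = (int1 (fun y => F (x, y)))%:E.
  rewrite /int1 /Rintegral fineK//; apply: integrable_fin_num => //.
  exact: (bounded_finite_integrable (bf2_slice2 x mF FB F0)).
have F12 := @integral12_prod_meas1 _ _ _ _ R (@lebesgue_measure R) (@lebesgue_measure R) _ iF.
split.
  apply: (eq_trans (congr1 fine (esym F12))).
  by rewrite [RHS]/int1 /Rintegral; congr fine; apply: eq_integral => x _; exact: e.
have mF1 := @measurable_fubini_F _ _ _ _ R (@lebesgue_measure R) (@lebesgue_measure R) _ iF.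
apply: (@bf1_supp _ `|b| (B * (2 * `|b|))).
- apply/measurable_EFinP; move: mF1; congr (measurable_fun _ _).
  by apply/funext => x; exact: e.
- move=> x; have := @int1_norm_le (fun y => F (x, y)) (- `|b|) `|b| B.
  rewrite opprK mulr2n mulrDl mul1r; apply => //.
  + exact: measurableT_comp mF (pair1_measurable x).
  + by have := normr_ge0 b; lra.
  + move=> y hy; apply: F0; apply: lt_le_trans (snd_norm_le (x, y)).
    rewrite /= ltNge; apply/negP => h; apply: hy; rewrite -ler_norml.
    exact: le_trans h (ler_norm b).
- move=> x hx; rewrite /int1 /Rintegral integral0_eq// => y _.
  rewrite F0//; apply: lt_le_trans (fst_norm_le (x, y)) => /=.
  by apply: le_lt_trans hx; exact: ler_norm.
Qed.

Lemma int2_fubini2 (F : R * R -> R) b B : measurable_fun setT F -> (forall q, `|F q| <= B) ->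
  (forall q, b < `|q| -> F q = 0) ->
  int2 F = int1 (fun y => int1 (fun x => F (x, y))) /\
  bf1 (fun y => int1 (fun x => F (x, y))).
Proof.
move=> mF FB F0.
have mS : measurable_fun setT (fun q : R * R => F (q.2, q.1)).
  by apply: measurableT_comp mF _; apply: measurable_fun_pair; [exact: measurable_snd|exact: measurable_fst].
have S0 q : b < `|q| -> F (q.2, q.1) = 0.
  by move=> h; apply: F0; move: h; rewrite !prod_normE /= maxC.
have [_ bS] := int2_fubini1 mS (fun q => FB _) S0; split => //.
have iF := bounded_finite_integrable (bf2_supp mF FB F0).
have F21 := @integral21_prod_meas1 _ _ _ _ R (@lebesgue_measure R) (@lebesgue_measure R) _ iF.
apply: (eq_trans (congr1 fine (esym F21))).
rewrite [RHS]/int1 /Rintegral; congr fine; apply: eq_integral => y _.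
rewrite /fubini_G /= /int1 /Rintegral fineK//; apply: integrable_fin_num => //.
exact: (bounded_finite_integrable (bf2_slice1 y mF FB F0)).
Qed.

End LineIntegral.


(** * One Euler step on a line *)

Section TransportLine.
Context {R : realType}.

Lemma int1_step_ge (u v : R) : u <= v ->
  int1 (fun x => (x <= v)%R%:R - (x <= u)%R%:R) = v - u.
Proof.
move=> uv; rewrite -(@int1_itv R `]u, v] u v uv); last first.
  rewrite lebesgue_measure_itv /= lte_fin; case: ltP => uv'; first by rewrite -EFinB.
  by rewrite (_ : v - u = 0)//; lra.
apply: eq_int1 => x; rewrite in_itv /=.
case: (leP x u) => ux; case: (leP x v) => vx; rewrite /= ?subr0 ?subrr//.
by exfalso; lra.
Qed.

Lemma lebesgue_segment_fin (u v : R) : (@lebesgue_measure R `[u, v] < +oo)%E.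
Proof. by rewrite lebesgue_measure_itv /= lte_fin; case: ifP => _; rewrite ?ltry// -EFinB ltry. Qed.

Lemma lipschitz_line_measurable (L : R) (f : R -> R) :
  (forall x y, `|f x - f y| <= L * `|x - y|) -> measurable_fun setT f.
Proof. by move=> fL; apply: continuous_measurable_fun; exact: lipschitz_continuous fL. Qed.

Lemma measurable_ind_le d (T : measurableType d) (f g : T -> R) :
  measurable_fun setT f -> measurable_fun setT g ->
  measurable_fun setT (fun x => (f x <= g x)%R%:R : R).
Proof. by move=> mf mg; apply: measurableT_comp => //; exact: measurable_fun_ler. Qed.

Lemma norm_ind_le (b b' : bool) : `|b%:R - b'%:R| <= 1 :> R.
Proof. by case: b b' => -[]; rewrite ?subrr ?subr0 ?sub0r ?normrN ?normr0 ?normr1. Qed.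

Lemma bf1M (f g : R -> R) B : bf1 f -> measurable_fun setT g ->
  (forall x, `|g x| <= B) -> bf1 (fun x => f x * g x).
Proof. by move=> bf mg gB; exact: (bounded_finiteM bf mg gB). Qed.

Lemma bf1_measurable (f : R -> R) : bf1 f -> measurable_fun setT f.
Proof. by case. Qed.

Lemma bf1B (f g : R -> R) : bf1 f -> bf1 g -> bf1 (fun x => f x - g x).
Proof. exact: bounded_finiteB. Qed.

Lemma bf1Z c (f : R -> R) : bf1 f -> bf1 (fun x => c * f x).
Proof. exact: bounded_finiteZ. Qed.

Lemma measurable_translate (f : R -> R) c : measurable_fun setT f ->
  measurable_fun setT (fun x : R => f (x + c)).
Proof.
move=> mf; apply: (measurableT_comp (f := f)) => //.
by apply: measurable_funD => //; exact: measurable_cst.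
Qed.

(* [mean F k z] is the average of [F] over [z - k, z]; writing it as minus the
   integral over [y >= z] of the difference quotient of [F] turns every
   statement about moving points into one about distribution functions. *)
Definition dquot (F : R -> R) (k y : R) := (F y - F (y - k)) / k.
Definition mean (F : R -> R) k z := - int1 (fun y => dquot F k y * (z <= y)%R%:R).

Section Mean.
Variables (F : R -> R) (M a k : R).
Hypotheses (M0 : 0 <= M) (k0 : 0 < k) (k1 : k <= 1)
  (FM : forall x y, `|F x - F y| <= M * `|x - y|)
  (F0 : forall x, a <= `|x| -> F x = 0).

Let mF : measurable_fun setT F. Proof. exact: lipschitz_line_measurable FM. Qed.

Lemma lipschitz_cpt_bounded x : `|F x| <= M * (2 * `|a|).
Proof.
have [h|h] := leP a `|x|; first by rewrite F0// normr0 mulr_ge0// mulr_ge0.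
have -> : F x = F x - F a by rewrite [F a]F0 ?subr0// ler_norm.
apply: le_trans (FM _ _) _; apply: ler_wpM2l => //.
have h1 := ler_normB x a; have h2 := ler_norm a; lra.
Qed.

Lemma measurable_dquot : measurable_fun setT (dquot F k).
Proof.
apply: measurable_funM; last exact: measurable_cst.
by apply: measurable_funB => //; exact: measurable_translate.
Qed.

Lemma dquot_norm_le y : `|dquot F k y| <= M.
Proof.
rewrite normrM (@gtr0_norm _ k^-1) ?invr_gt0// ler_pdivrMr//.
apply: le_trans (FM _ _) _; rewrite opprB addrC subrK gtr0_norm//.
Qed.

Lemma dquot_supp y : `|a| + 1 < `|y| -> dquot F k y = 0.
Proof.
move=> hy; have k1' := k1; have h1 : `|y| - k <= `|y - k| by rewrite -[X in _ - X](gtr0_norm k0); exact: lerB_dist.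
have h2 : a <= `|y| by have := ler_norm a; lra.
have h3 : a <= `|y - k| by apply: le_trans (ler_norm a) (le_trans _ h1); lra.
by rewrite /dquot !F0 ?subrr ?mul0r.
Qed.

Lemma mean_close z : `|mean F k z - F z| <= M * k.
Proof.
have k1' := k1; have k0' := k0.
pose B := M * (2 * `|a|).
have FB : forall x, `|F x| <= B := lipschitz_cpt_bounded.
have mi u : measurable_fun setT (fun y : R => (u <= y)%R%:R : R).
  by apply: measurable_ind_le => //; exact: measurable_cst.
have ib (b : bool) : `|b%:R| <= 1 :> R by case: b; rewrite ?normr1 ?normr0.
have bFi u : bf1 (fun y => F y * (u <= y)%R%:R).
  apply: (@bf1M _ _ 1) => //.
  by apply: (@bf1_supp _ _ `|a| B) => // x hx; apply: F0; have := ler_norm a; lra.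
have mFk := measurable_translate (- k) mF.
have bFk : bf1 (fun y => F (y - k) * (z <= y)%R%:R).
  apply: (@bf1M _ _ 1) => //.
  apply: (@bf1_supp _ _ (`|a| + 1) B) => // x hx; apply: F0.
  have h1 : `|x| - k <= `|x - k| by rewrite -[X in _ - X](gtr0_norm k0); exact: lerB_dist.
  by apply: le_trans (ler_norm a) (le_trans _ h1); lra.
(* Translating the half of the quotient taken at [y - k] leaves the average of [F] over
   [[z - k, z]], on which [F] varies by at most [M * k]. *)
have e1 : mean F k z = k^-1 * int1 (fun y => F y * ((z - k <= y)%R%:R - (z <= y)%R%:R)).
  rewrite /mean (_ : int1 _ = k^-1 * (int1 (fun y => F y * (z <= y)%R%:R) - int1 (fun y => F (y - k) * (z <= y)%R%:R))); last first.
    rewrite -int1B// -int1Z; last exact: bf1B.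
    by apply: eq_int1 => y; rewrite /dquot; ring.
  have -> : int1 (fun y => F (y - k) * (z <= y)%R%:R) = int1 (fun y => F y * (z - k <= y)%R%:R).
    rewrite -[RHS](@int1_shift _ _ (- k)); last exact: measurable_funM.
    by apply: eq_int1 => y; rewrite lerD2r.
  rewrite -mulrN opprB -int1B//; congr (_ * _).
  by apply: eq_int1 => y; rewrite mulrBr.
have e2 : F z = k^-1 * int1 (fun y => F z * ((z - k <= y)%R%:R - (z <= y)%R%:R)).
  rewrite int1Z; last exact: step_bf1.
  by rewrite int1_step; field; rewrite gt_eqF.
have bs := step_bf1 (z - k) z.
have b1 : bf1 (fun y => F y * ((z - k <= y)%R%:R - (z <= y)%R%:R)).
  by have := bf1B (bFi (z - k)) (bFi z); congr bf1; apply/funext => y; rewrite mulrBr.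
have b2 : bf1 (fun y => F z * ((z - k <= y)%R%:R - (z <= y)%R%:R)) by exact: bf1Z.
rewrite e1 [X in _ - X]e2 -mulrBr -int1B// normrM (@gtr0_norm _ k^-1) ?invr_gt0//.
rewrite ler_pdivrMl//.
have -> : k * (M * k) = (M * k) * (z - (z - k)) by ring.
apply: int1_norm_le; [|lra| |].
- by apply: measurable_funB; exact: bf1_measurable.
- move=> y; rewrite -mulrBl normrM; case: (leP (z - k) y) => h1; case: (leP z y) => h2;
    rewrite ?subrr ?normr0 ?mulr0 ?mulr_ge0 ?(ltW k0)//.
    rewrite subr0 normr1 mulr1; apply: le_trans (FM _ _) _; apply: ler_wpM2l => //.
    by apply: bounds_norm_le; lra.
  by exfalso; lra.
- move=> y hy; rewrite -mulrBl; case: (leP (z - k) y) => h1; case: (leP z y) => h2;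
    rewrite ?subrr ?mulr0//.
    by exfalso; apply: hy; apply/andP; split; lra.
  by exfalso; lra.
Qed.

End Mean.

Variables (F sg w : R -> R) (M a B L La C h k : R).
Hypotheses (M0 : 0 <= M) (a0 : 0 <= a) (h0 : 0 < h) (k0 : 0 < k) (k1 : k <= 1)
  (B0 : 0 <= B) (L0 : 0 <= L) (La0 : 0 <= La) (C0 : 0 <= C)
  (hLa : h * La <= 1 / 2) (hC : h * C <= 1)
  (FM : forall x y, `|F x - F y| <= M * `|x - y|)
  (F0 : forall x, a <= `|x| -> F x = 0)
  (sg0 : forall x, 0 <= sg x) (sgB : forall x, sg x <= B)
  (sgL : forall x y, `|sg x - sg y| <= L * `|x - y|)
  (wL : forall x y, `|w x - w y| <= La * `|x - y|)
  (wC : forall x, `|w x| <= C).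

(** [dquot F k] lives in [|y| <= a + 1] because [k <= 1], and a step moves points by at most
    [h * C <= 1]. Truncating [sg] at radius [b] thus changes none of the integrals and makes [S]
    integrable. *)
Let b := a + 3.
Let S x := sg x * (`|x| <= b)%R%:R.

Let mF : measurable_fun setT F. Proof. exact: lipschitz_line_measurable FM. Qed.
Let mw : measurable_fun setT w. Proof. exact: lipschitz_line_measurable wL. Qed.
Let msg : measurable_fun setT sg. Proof. exact: lipschitz_line_measurable sgL. Qed.
Let mT : measurable_fun setT (fun x : R => x + h * w x).
Proof. by apply: measurable_funD => //; apply: measurable_funM => //; exact: measurable_cst. Qed.
Let mS : measurable_fun setT S.
Proof.
apply: measurable_funM => //; apply: measurable_ind_le; last exact: measurable_cst.
exact: normr_measurable.
Qed.

Let S_norm x : `|S x| <= B.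
Proof.
rewrite /S normrM (ger0_norm (sg0 x)); case: (leP `|x| b) => _.
  by rewrite normr1 mulr1.
by rewrite normr0 mulr0.
Qed.

Let S_bf : bf1 S.
Proof.
apply: (@bf1_supp _ _ b B) => // x hx.
by rewrite /S (lt_geF hx) mulr0.
Qed.

Let S_id x : `|x| <= b -> S x = sg x.
Proof. by rewrite /S => ->; rewrite mulr1. Qed.

(* Mass crossing the point [y] during time [h]. *)
Let crossing y := int1 (fun x => ((x <= y)%R%:R - (x + h * w x <= y)%R%:R) * S x).

(** The map [x + h * w x] is first replaced by the translation by [c = h * w y], then [S] by its
    value at [y] on the interval of length [|c|] that the translation sweeps across [y]. Each
    replacement costs order [h ^+ 2]. *)
Let crossing_close y : `|y| <= a + 1 ->
  `|crossing y - h * (w y * sg y)| <= (4 * B * La * C + L * C ^+ 2) * h ^+ 2.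
Proof.
move=> ya; pose c := h * w y.
have h0' := h0; have hC' := hC; have hLa' := hLa; have a0' := a0.
have cC : `|c| <= h * C by rewrite normrM gtr0_norm// ler_wpM2l// ltW.
have [c1 c2] := norm_le_bounds cC.
have [y1 y2] := norm_le_bounds ya.
have mle (f : R -> R) u : measurable_fun setT f -> measurable_fun setT (fun x : R => (f x <= u)%R%:R : R).
  by move=> mf; apply: measurable_ind_le => //; exact: measurable_cst.
pose E := int1 (fun x => ((x <= y)%R%:R - (x <= y - c)%R%:R) * S x).
have bS (f g : R -> R) u v : measurable_fun setT f -> measurable_fun setT g ->
    bf1 (fun x => ((f x <= u)%R%:R - (g x <= v)%R%:R) * S x).
  move=> mf mg.
  have -> : (fun x => ((f x <= u)%R%:R - (g x <= v)%R%:R) * S x) = (fun x => S x * ((f x <= u)%R%:R - (g x <= v)%R%:R)).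
    by apply/funext => x; rewrite mulrC.
  apply: (@bf1M _ _ 1) => //; last by move=> x; exact: norm_ind_le.
  by apply: measurable_funB; exact: mle.
have DE : `|crossing y - E| <= 4 * B * La * C * h ^+ 2.
  rewrite /crossing /E -int1B; [|exact: bS|exact: bS].
  (* The two indicators differ only where [|h * (w x - w y)|] reaches the distance from [x] to
     [y - c]. As [h * La <= 1 / 2], the former is at most half that distance plus [h ^+ 2 * La * C],
     so the distance is at most [r]. *)
  pose r := 2 * h ^+ 2 * La * C.
  have r0 : 0 <= r by rewrite /r; do 3 (apply: mulr_ge0 => //); exact: sqr_ge0.
  have -> : 4 * B * La * C * h ^+ 2 = B * ((y - c + r) - (y - c - r)) by rewrite /r; ring.
  apply: int1_norm_le; [|lra| |].
  - by apply: measurable_funB; [exact: bf1_measurable (bS id _ y y _ mT)|exact: bf1_measurable (bS id id y (y - c) _ _)].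
  - move=> x; rewrite -mulrBl normrM -[leRHS]mul1r; apply: ler_pM => //.
    have -> : (x <= y)%R%:R - (x + h * w x <= y)%R%:R - ((x <= y)%R%:R - (x <= y - c)%R%:R)
      = (x <= y - c)%R%:R - (x + h * w x <= y)%R%:R :> R by ring.
    exact: norm_ind_le.
  - move=> x hx; rewrite -mulrBl.
    have -> : (x <= y)%R%:R - (x + h * w x <= y)%R%:R - ((x <= y)%R%:R - (x <= y - c)%R%:R)
      = (x <= y - c)%R%:R - (x + h * w x <= y)%R%:R :> R by ring.
    suff -> : (x + h * w x <= y) = (x <= y - c) by rewrite subrr mul0r.
    have hw : `|h * (w x - w y)| <= h * La * (`|x - (y - c)| + h * C).
      rewrite normrM gtr0_norm// -mulrA; apply: ler_wpM2l; first exact: ltW.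
      apply: le_trans (wL _ _) _; apply: ler_wpM2l => //.
      have -> : x - y = x - (y - c) - c by ring.
      by apply: le_trans (ler_normB _ _) _; lra.
    set dd := `|x - (y - c)| in hw.
    have dr : r < dd.
      rewrite ltNge; apply/negP => /norm_le_bounds[d1 d2]; apply: hx.
      by apply/andP; split; lra.
    have h1 : h * La * (dd + h * C) < dd.
      have : h * La * dd <= 1 / 2 * dd by apply: ler_wpM2r => //; exact: normr_ge0.
      by move: dr; rewrite /r => *; nra.
    have [h2 h3] := norm_le_bounds (le_trans hw (ltW h1)).
    have {}h1 : `|h * (w x - w y)| < dd by exact: le_lt_trans hw h1.
    move: h1; rewrite ltr_norml => /andP[h4 h5].
    have ec : h * w y = c by [].
    have [dp|dn] := leP 0 (x - (y - c)).
      rewrite /dd ger0_norm// in h4 h5 dr.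
      have /lt_geF -> : y < x + h * w x by lra.
      by have /lt_geF -> : y - c < x by lra.
    rewrite /dd ltr0_norm// in h4 h5 dr.
    have -> : x + h * w x <= y by lra.
    by have -> : x <= y - c by lra.
have Ec : `|E - c * sg y| <= L * C ^+ 2 * h ^+ 2.
  have stepE : c = int1 (fun x => (x <= y)%R%:R - (x <= y - c)%R%:R)
      /\ bf1 (fun x : R => (x <= y)%R%:R - (x <= y - c)%R%:R : R).
    have bst u v : u <= v -> bf1 (fun x : R => (x <= v)%R%:R - (x <= u)%R%:R : R).
      move=> uv; split; first by apply: measurable_funB; exact: mle.
      exists `[u, v]%classic, 1; split => //.
      - exact: lebesgue_segment_fin.
      - by move=> x; exact: norm_ind_le.
      move=> x /=; rewrite in_itv /=; case: (leP x v) => xv; case: (leP x u) => xu; rewrite ?subrr//.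
        by rewrite (ltW xu).
      by exfalso; lra.
    have [cp|cn] := leP 0 c.
      split; last by apply: bst; lra.
      by rewrite int1_step_ge; lra.
    have bb : bf1 (fun x : R => (x <= y - c)%R%:R - (x <= y)%R%:R : R) by apply: bst; lra.
    split; last first.
      by have := bf1Z (-1) bb; congr bf1; apply/funext => x; ring.
    have -> : (fun x : R => (x <= y)%R%:R - (x <= y - c)%R%:R : R) = (fun x => -1 * ((x <= y - c)%R%:R - (x <= y)%R%:R)).
      by apply/funext => x; ring.
    by rewrite int1Z// int1_step_ge; lra.
  have [st bst] := stepE.
  have -> : c * sg y = int1 (fun x => sg y * ((x <= y)%R%:R - (x <= y - c)%R%:R)).
    by rewrite int1Z// -st mulrC.
  have bst' := bf1Z (sg y) bst.
  rewrite /E -int1B//; last exact: bS.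
  have -> : L * C ^+ 2 * h ^+ 2 = L * (h * C) * (h * C) by ring.
  apply: (@le_trans _ _ (L * (h * C) * `|c|)); last first.
    by apply: ler_wpM2l => //; rewrite mulr_ge0// mulr_ge0// ltW.
  have mI : measurable_fun setT (fun x : R => ((x <= y)%R%:R - (x <= y - c)%R%:R) * S x - sg y * ((x <= y)%R%:R - (x <= y - c)%R%:R)).
    by apply: measurable_funB; [exact: bf1_measurable (bS id id y (y - c) _ _)|exact: bf1_measurable bst'].
  have key x : Num.min y (y - c) <= x <= Num.max y (y - c) ->
      `|S x - sg y| <= L * (h * C).
    move=> hx; have /andP[x1 x2] : y - `|c| <= x <= y + `|c|.
      have /norm_le_bounds[d1 d2] := between_dist hx; move: d1 d2.
      have -> : y - (y - c) = c by ring.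
      by rewrite lerBrDl => ->; rewrite lerBlDl => ->.
    rewrite S_id; last by apply: bounds_norm_le; rewrite /b; lra.
    apply: le_trans (sgL _ _) _; apply: ler_wpM2l => //.
    by apply: le_trans cC; apply: bounds_norm_le; lra.
  have out x : ~ (Num.min y (y - c) <= x <= Num.max y (y - c)) ->
      ((x <= y)%R%:R - (x <= y - c)%R%:R) = 0 :> R.
    exact: step_outside.
  have LC0 : 0 <= L * (h * C) by rewrite mulr_ge0// mulr_ge0// ltW.
  have -> : `|c| = Num.max y (y - c) - Num.min y (y - c).
    by rewrite max_sub_min; congr `|_|; ring.
  apply: int1_norm_le => //.
  - by rewrite ge_min !le_max lexx.
  - move=> x; rewrite (mulrC (sg y)) -mulrBr normrM.
    have [/key hx|/negP/out ->] := boolP (Num.min y (y - c) <= x <= Num.max y (y - c)).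
      by rewrite -[leRHS]mul1r; apply: ler_pM => //; exact: norm_ind_le.
    by rewrite normr0 mul0r.
  - by move=> x /out ->; rewrite mul0r mulr0 subrr.
have -> : crossing y - h * (w y * sg y) = (crossing y - E) + (E - c * sg y) by rewrite /c; ring.
by apply: le_trans (ler_normD _ _) _; lra.
Qed.

(** Replacing [F] by [mean F k] costs [M * k] per unit of mass in each of the two integrals. Both
    then test distribution functions against [dquot F k], and their difference tests [crossing]. No
    negative power of [k] appears in the error, so [k] can be made small after [h] is fixed. *)
Lemma transport_line :
  `|int1 (fun x => F (x + h * w x) * sg x) - int1 (fun x => F x * sg x)
    - h * int1 (fun x => dquot F k x * (w x * sg x))|
  <= M * (4 * (a + 3) * B * k + 2 * (a + 3) * (4 * B * La * C + L * C ^+ 2) * h ^+ 2).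
Proof.
have k1' := k1; have h0' := h0; have a0' := a0; have hC' := hC.
set K := 4 * B * La * C + L * C ^+ 2.
have K0 : 0 <= K by rewrite /K; apply: addr_ge0; apply: mulr_ge0 => //; rewrite ?sqr_ge0// mulr_ge0// mulr_ge0.
have nb : `|a| = a by rewrite ger0_norm.
have b0 : - b <= b by rewrite /b; lra.
pose T x := x + h * w x.
have Tx x : `|x| - 1 <= `|T x|.
  have : `|x| - `|h * w x| <= `|T x| by rewrite -(normrN (h * w x)) /T -[X in `|_ + X|]opprK; exact: lerB_dist.
  by rewrite normrM (gtr0_norm h0); have := ler_wpM2l (ltW h0) (wC x); lra.
have cut (G : R -> R) : (forall x, b < `|x| -> G x = 0) ->
    int1 (fun x => G x * sg x) = int1 (fun x => G x * S x).
  move=> G0; apply: eq_int1 => x; have [xb|xb] := leP `|x| b; first by rewrite S_id.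
  by rewrite G0// !mul0r.
have FB := lipschitz_cpt_bounded M0 FM F0.
have mFT : measurable_fun setT (fun x : R => F (T x)) by apply: (measurableT_comp (f := F)).
rewrite (cut (fun x => F (T x))); last first.
  by move=> x xb; apply: F0; have := Tx x; rewrite /b in xb; lra.
rewrite (cut F); last by move=> x xb; apply: F0; rewrite /b in xb; lra.
have mean_bound z : `|mean F k z - F z| <= M * k by apply: (@mean_close F M a k).
pose f := dquot F k.
have fM y : `|f y| <= M by apply: (@dquot_norm_le F M k).
have f0 y : a + 1 < `|y| -> f y = 0 by rewrite -{1}nb; apply: (@dquot_supp F a k).
have mf : measurable_fun setT f by apply: (@measurable_dquot F M k).
have m1 (g : R -> R) : measurable_fun setT g -> measurable_fun setT (fun q : R * R => g q.1).
  by move=> mg; apply: (measurableT_comp (f := g)) => //; exact: measurable_fst.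
have m2 (g : R -> R) : measurable_fun setT g -> measurable_fun setT (fun q : R * R => g q.2).
  by move=> mg; apply: (measurableT_comp (f := g)) => //; exact: measurable_snd.
(* Integrated in [y], [H g] gives [- mean F k (g x) * S x]; integrated in [x], it gives [f y] times
   the mass that [g] sends to the left of [y]. Exchanging the order in [H id - H T] produces
   [crossing]. *)
pose H (g : R -> R) (q : R * R) := f q.2 * (g q.1 <= q.2)%R%:R * S q.1.
have mH g : measurable_fun setT g -> measurable_fun setT (H g).
  move=> mg; apply: measurable_funM; last exact: m1.
  apply: measurable_funM; first exact: m2.
  by apply: measurable_ind_le; [exact: m1|exact: (m2 id)].
have ind1 (c : bool) : `|c%:R| <= 1 :> R by case: c; rewrite ?normr1 ?normr0.
have HB g q : `|H g q| <= M * B.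
  rewrite normrM; apply: ler_pM => //.
  by rewrite normrM -[M]mulr1; apply: ler_pM.
have H0 g q : b < `|q| -> H g q = 0.
  rewrite prod_normE lt_max => /orP[h1|h2]; rewrite /H.
    by rewrite /S (lt_geF h1) !mulr0.
  by rewrite f0 ?mul0r//; rewrite /b in h2; lra.
have bstep z : bf1 (fun y => f y * (z <= y)%R%:R).
  apply: (@bf1M _ _ 1) => //.
    by apply: (@bf1_supp _ _ (a + 1) M).
  by apply: measurable_ind_le => //; exact: measurable_cst.
have inner g x : int1 (fun y => H g (x, y)) = - (mean F k (g x) * S x).
  rewrite -mulNr opprK mulrC -int1Z//; by apply: eq_int1 => y; rewrite /H /= mulrC.
have bmean g : measurable_fun setT g -> bf1 (fun x => mean F k (g x) * S x).
  move=> mg; have [_ bH] := int2_fubini1 (mH g mg) (HB g) (@H0 g).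
  have := bf1Z (-1) bH; congr bf1; apply/funext => x.
  by rewrite inner mulN1r opprK.
have int_mean g : measurable_fun setT g -> int1 (fun x => mean F k (g x) * S x) = - int2 (H g).
  move=> mg; have [-> bH] := int2_fubini1 (mH g mg) (HB g) (@H0 g).
  rewrite -mulN1r -int1Z//; apply: eq_int1 => x.
  by rewrite inner mulN1r opprK.
have bF g : measurable_fun setT g -> bf1 (fun x => F (g x) * S x).
  move=> mg.
  have -> : (fun x => F (g x) * S x) = (fun x => S x * F (g x)) by apply/funext => x; rewrite mulrC.
  by apply: (@bf1M _ _ (M * (2 * `|a|))) => //; apply: (measurableT_comp (f := F)).
have mid : measurable_fun setT (@id R) by exact: measurable_id.
have approx g : measurable_fun setT g ->
    `|int1 (fun x => F (g x) * S x) - int1 (fun x => mean F k (g x) * S x)| <= M * k * B * (b - - b).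
  move=> mg; rewrite -int1B; [|exact: bF|exact: bmean].
  apply: int1_norm_le => //.
  - by apply: measurable_funB; apply: bf1_measurable; [exact: bF|exact: bmean].
  - move=> x; rewrite -mulrBl normrM; apply: ler_pM => //.
    by rewrite distrC; exact: mean_bound.
  - move=> x hx; rewrite -mulrBl /S; case: (leP `|x| b) => [h1|_]; last by rewrite !mulr0.
    by exfalso; apply: hx; rewrite -ler_norml.
have := approx _ mT; have := approx _ mid.
rewrite (int_mean _ mT) (int_mean _ mid) -/T.
have bH g : measurable_fun setT g -> bf2 (H g).
  by move=> mg; exact: (bf2_supp (mH g mg) (HB g) (@H0 g)).
have bfc : bf1 (fun y => f y * crossing y) /\ int2 (H id) - int2 (H T) = int1 (fun y => f y * crossing y).
  rewrite -int2B; [|exact: bH|exact: bH].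
  pose G q := H id q - H T q.
  have mG : measurable_fun setT G by apply: measurable_funB; exact: mH.
  have GB q : `|G q| <= 2 * (M * B).
    by apply: le_trans (ler_normB _ _) _; have := HB id q; have := HB T q; lra.
  have G0 q : b < `|q| -> G q = 0 by move=> h1; rewrite /G !H0// subrr.
  have [-> bG] := int2_fubini2 mG GB G0.
  have e y : int1 (fun x => G (x, y)) = f y * crossing y.
    rewrite /crossing -int1Z; first by apply: eq_int1 => x; rewrite /G /H /= /T; ring.
    apply: (@bf1_supp _ _ b B).
    - apply: measurable_funM => //; apply: measurable_funB; apply: measurable_ind_le => //; exact: measurable_cst.
    - by move=> x; rewrite normrM -[leRHS]mul1r; apply: ler_pM => //; exact: norm_ind_le.
    - by move=> x h1; rewrite /S (lt_geF h1) !mulr0.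
  split; last by apply: eq_int1.
  by move: bG; congr bf1; apply/funext => y; rewrite e.
have [bfc1 efc] := bfc.
have bfj : bf1 (fun y => f y * (w y * sg y)).
  have -> : (fun y => f y * (w y * sg y)) = (fun y => f y * w y * sg y).
    by apply/funext => y; rewrite mulrA.
  apply: (@bf1M _ _ B) => //; last by move=> y; rewrite ger0_norm.
  by apply: (@bf1M _ _ C) => //; apply: (@bf1_supp _ _ (a + 1) M).
have main : `|int1 (fun y => f y * crossing y) - h * int1 (fun y => f y * (w y * sg y))|
    <= M * (K * h ^+ 2) * (b - - b).
  rewrite -int1Z// -int1B//; last exact: bf1Z.
  apply: int1_norm_le => //.
  - by apply: bf1_measurable; apply: bf1B => //; exact: bf1Z.
  - move=> y; have [h1|h1] := leP `|y| (a + 1); last first.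
      by rewrite f0// !mul0r mulr0 subrr normr0 mulr_ge0// mulr_ge0// sqr_ge0.
    have -> : f y * crossing y - h * (f y * (w y * sg y)) = f y * (crossing y - h * (w y * sg y)) by ring.
    by rewrite normrM; apply: ler_pM => //; exact: crossing_close.
  - move=> y hy; rewrite f0 ?mul0r ?mulr0 ?subrr// ltNge; apply/negP => /norm_le_bounds[? ?].
    by apply: hy; apply/andP; rewrite /b; split; lra.
rewrite -efc in main; have [m1a m1b] := norm_le_bounds main.
move=> /norm_le_bounds[p1 p2] /norm_le_bounds[p3 p4].
have -> : M * (4 * (a + 3) * B * k + 2 * (a + 3) * K * h ^+ 2) =
  M * (K * h ^+ 2) * (b - - b) + M * k * B * (b - - b) + M * k * B * (b - - b) by rewrite /b; ring.
by rewrite -/f; apply: bounds_norm_le; lra.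
Qed.

End TransportLine.

(** * One Euler step in the plane *)

Section PlanarStep.
Context {R : realType}.
Implicit Types (G F : R * R -> R) (q : R * R).

Definition swap q := (q.2, q.1).
Definition dq1 G (k : R) q := (G q - G (q.1 - k, q.2)) / k.
Definition dq2 G (k : R) q := (G q - G (q.1, q.2 - k)) / k.

Lemma norm_swap q : `|swap q| = `|q|.
Proof. by rewrite !prod_normE maxC. Qed.

Lemma swap_dist p q : `|swap p - swap q| = `|p - q|.
Proof. by rewrite !prod_normE maxC. Qed.

Lemma lipschitz2_swap M G : lipschitz2 M G -> lipschitz2 M (fun q => G (swap q)).
Proof. by move=> GM p q; apply: le_trans (GM _ _) _; rewrite swap_dist. Qed.

Lemma bf2M (f g : R * R -> R) B : bf2 f -> measurable_fun setT g ->
  (forall x, `|g x| <= B) -> bf2 (fun x => f x * g x).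
Proof. by move=> bf mg gB; exact: (bounded_finiteM bf mg gB). Qed.

Lemma bf2_measurable (f : R * R -> R) : bf2 f -> measurable_fun setT f.
Proof. by case. Qed.

Lemma bf2D (f g : R * R -> R) : bf2 f -> bf2 g -> bf2 (fun x => f x + g x).
Proof. exact: bounded_finiteD. Qed.

Lemma bf2B (f g : R * R -> R) : bf2 f -> bf2 g -> bf2 (fun x => f x - g x).
Proof. exact: bounded_finiteB. Qed.

Lemma bf2Z c (f : R * R -> R) : bf2 f -> bf2 (fun x => c * f x).
Proof. exact: bounded_finiteZ. Qed.

Lemma int2_swap F b B : measurable_fun setT F -> (forall q, `|F q| <= B) ->
  (forall q, b < `|q| -> F q = 0) -> int2 (fun q => F (swap q)) = int2 F.
Proof.
move=> mF FB F0; have [-> _] := int2_fubini2 mF FB F0.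
have mS : measurable_fun setT (fun q => F (swap q)).
  by apply: measurableT_comp mF _; apply: measurable_fun_pair; [exact: measurable_snd|exact: measurable_fst].
have S0 q : b < `|q| -> F (swap q) = 0 by rewrite -(norm_swap q); exact: F0.
by have [-> _] := int2_fubini1 mS (fun q => FB _) S0.
Qed.

Lemma int2_shift1 F c b B : measurable_fun setT F -> (forall q, `|F q| <= B) ->
  (forall q, b < `|q| -> F q = 0) -> int2 (fun q => F (q.1 + c, q.2)) = int2 F.
Proof.
move=> mF FB F0; have [-> _] := int2_fubini2 mF FB F0.
have mS : measurable_fun setT (fun q : R * R => F (q.1 + c, q.2)).
  apply: measurableT_comp mF _; apply: measurable_fun_pair; last exact: measurable_snd.
  by apply: measurable_funD; [exact: measurable_fst|exact: measurable_cst].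
have S0 (q : R * R) : b + `|c| < `|q| -> F (q.1 + c, q.2) = 0.
  move=> hq; apply: F0; rewrite ltNge; apply/negP => h; move: hq; apply/negP; rewrite -leNgt.
  have h1 := le_trans (fst_norm_le _) h; have h2 := le_trans (snd_norm_le _) h.
  rewrite /= in h1 h2; apply: pair_norm_le; last by have := normr_ge0 c; lra.
  have : `|q.1| <= `|q.1 + c| + `|c| by rewrite -{1}(addrK c q.1); exact: ler_normB.
  lra.
have [-> _] := int2_fubini2 mS (fun q => FB _) S0.
by apply: eq_int1 => y /=; rewrite (int1_shift (f := fun x => F (x, y)))//;
  exact: measurableT_comp mF (pair2_measurable y).
Qed.

Lemma lipschitz2_cpt_bounded G (M a : R) : 0 <= M -> 0 <= a -> lipschitz2 M G ->
  (forall q, a <= `|q| -> G q = 0) -> forall q, `|G q| <= M * (2 * a).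
Proof.
move=> M0 a0 GM G0 q; have [h|h] := leP a `|q|; first by rewrite G0// normr0 mulr_ge0// mulr_ge0.
have ea : `|(a, a)| = a by rewrite prod_normE /= ger0_norm// maxxx.
have -> : G q = G q - G (a, a) by rewrite [G (a, a)]G0 ?subr0// ea.
apply: le_trans (GM _ _) _; apply: ler_wpM2l => //.
by apply: le_trans (ler_normB _ _) _; rewrite ea; lra.
Qed.

Lemma lipschitz2_slice1 M G y : lipschitz2 M G ->
  forall x x', `|G (x, y) - G (x', y)| <= M * `|x - x'|.
Proof. by move=> GM x x'; apply: le_trans (GM _ _) _; rewrite prod_normE /= subrr normr0 max_l. Qed.

Lemma lipschitz2_slice2 M G x : lipschitz2 M G ->
  forall y y', `|G (x, y) - G (x, y')| <= M * `|y - y'|.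
Proof. by move=> GM y y'; apply: le_trans (GM _ _) _; rewrite prod_normE /= subrr normr0 max_r. Qed.

Lemma dq1_norm_le M G k q : 0 < k -> lipschitz2 M G -> `|dq1 G k q| <= M.
Proof.
move=> k0 GM; rewrite normrM (@gtr0_norm _ k^-1) ?invr_gt0// ler_pdivrMr//.
have := lipschitz2_slice1 q.2 GM q.1 (q.1 - k); rewrite -surjective_pairing => /le_trans; apply.
by rewrite opprB addrC subrK gtr0_norm.
Qed.

Lemma measurable_pairmap (f g : R * R -> R) G : measurable_fun setT G ->
  measurable_fun setT f -> measurable_fun setT g ->
  measurable_fun setT (fun q => G (f q, g q)).
Proof. by move=> mG mf mg; apply: measurableT_comp mG _; exact: measurable_fun_pair. Qed.

Lemma measurable_move1 G (g : R * R -> R) : measurable_fun setT G -> measurable_fun setT g ->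
  measurable_fun setT (fun q => G (q.1 + g q, q.2)).
Proof.
move=> mG mg; apply: (@measurable_pairmap (fun q => q.1 + g q) snd G) => //.
by apply: measurable_funD => //; exact: measurable_fst.
Qed.

Lemma dq1_measurable G k : measurable_fun setT G -> measurable_fun setT (dq1 G k).
Proof.
move=> mG; apply: measurable_funM; last exact: measurable_cst.
apply: measurable_funB => //; exact: (@measurable_move1 G (fun=> - k)).
Qed.

Lemma dq1_supp G (a k : R) q : 0 < k -> k <= 1 -> 0 <= a -> (forall q, a <= `|q| -> G q = 0) ->
  a + 1 < `|q| -> dq1 G k q = 0.
Proof.
move=> k0 k1 a0 G0 hq; rewrite /dq1 !G0 ?subrr ?mul0r//; last by lra.
move: hq; rewrite !prod_normE /= lt_max le_max => /orP[h|h]; apply/orP; [left|right]; last lra.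
have : `|q.1| <= `|q.1 - k| + `|k| by rewrite -{1}(subrK k q.1); exact: ler_normD.
by rewrite (gtr0_norm k0); lra.
Qed.

(** The line estimate is applied at each height and integrated; [2 * a] is the length of the
    interval of heights at which [G] does not vanish identically. *)
Lemma transport_step1 (sg w : R * R -> R) (B L La C : R) G (M a h k : R) :
  0 <= M -> 0 <= a -> 0 < h -> 0 < k -> k <= 1 -> 0 <= B -> 0 <= L -> 0 <= La -> 0 <= C ->
  h * La <= 1 / 2 -> h * C <= 1 ->
  lipschitz2 M G -> (forall q, a <= `|q| -> G q = 0) ->
  (forall q, 0 <= sg q) -> (forall q, sg q <= B) -> lipschitz2 L sg ->
  lipschitz2 La w -> (forall q, `|w q| <= C) ->
  `|int2 (fun q => G (q.1 + h * w q, q.2) * sg q) - int2 (fun q => G q * sg q)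
    - h * int2 (fun q => dq1 G k q * (w q * sg q))|
  <= M * (4 * (a + 3) * B * k + 2 * (a + 3) * (4 * B * La * C + L * C ^+ 2) * h ^+ 2) * (2 * a).
Proof.
move=> M0 a0 h0 k0 k1 B0 L0 La0 C0 hLa hC GM G0 sg0 sgB sgL wL wC.
have mG := lipschitz2_measurable GM; have msg := lipschitz2_measurable sgL.
have mw := lipschitz2_measurable wL.
have GB := lipschitz2_cpt_bounded M0 a0 GM G0.
have sgN q : `|sg q| <= B by rewrite ger0_norm.
have hw q : `|h * w q| <= 1.
  by rewrite normrM gtr0_norm//; apply: le_trans (ler_wpM2l (ltW h0) (wC q)) hC.
have far (q : R * R) : a + 1 < `|q| -> a <= `|(q.1 + h * w q, q.2)|.
  rewrite !prod_normE /= lt_max le_max => /orP[hq|hq]; apply/orP; [left|right; lra].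
  have : `|q.1| <= `|q.1 + h * w q| + `|h * w q| by rewrite -{1}(addrK (h * w q) q.1); exact: ler_normB.
  by have := hw q; lra.
have mGT : measurable_fun setT (fun q => G (q.1 + h * w q, q.2)).
  apply: (@measurable_move1 G (fun q => h * w q)) => //.
  by apply: measurable_funM => //; exact: measurable_cst.
have b1 : bf2 (fun q => G (q.1 + h * w q, q.2) * sg q).
  by apply: (@bf2M _ _ B) => //; apply: (@bf2_supp _ _ (a + 1) (M * (2 * a))) => // q hq; rewrite G0//; exact: far.
have b2 : bf2 (fun q => G q * sg q).
  by apply: (@bf2M _ _ B) => //; apply: (@bf2_supp _ _ a (M * (2 * a))) => // q hq; rewrite G0// ltW.
have b3 : bf2 (fun q => dq1 G k q * (w q * sg q)).
  apply: (@bf2M _ _ (C * B)).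
  - apply: (@bf2_supp _ _ (a + 1) M) => [|q|q].
    + exact: dq1_measurable.
    + exact: dq1_norm_le.
    + exact: dq1_supp.
  - exact: measurable_funM.
  - by move=> q; rewrite normrM; apply: ler_pM.
pose A q := G (q.1 + h * w q, q.2) * sg q - G q * sg q - h * (dq1 G k q * (w q * sg q)).
have -> : int2 (fun q => G (q.1 + h * w q, q.2) * sg q) - int2 (fun q => G q * sg q)
    - h * int2 (fun q => dq1 G k q * (w q * sg q)) = int2 A.
  by rewrite -int2Z// -int2B// -int2B//; [exact: bf2B|exact: bf2Z].
have mA : measurable_fun setT A.
  by apply: bf2_measurable; apply: bf2B; [exact: bf2B|exact: bf2Z].
have AB q : `|A q| <= M * (2 * a) * B + M * (2 * a) * B + h * (M * (C * B)).
  apply: le_trans (ler_normB _ _) _; apply: lerD.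
    by apply: le_trans (ler_normB _ _) _; apply: lerD; rewrite normrM; apply: ler_pM.
  rewrite normrM gtr0_norm//; apply: ler_wpM2l; first exact: ltW.
  rewrite normrM; apply: ler_pM => //; first exact: dq1_norm_le.
  by rewrite normrM; apply: ler_pM.
have A0 q : a + 1 < `|q| -> A q = 0.
  move=> hq; rewrite /A (dq1_supp k0 k1 a0 G0 hq) (G0 _ (far _ hq)) (G0 q) ?mul0r ?mulr0 ?subrr//.
  by lra.
have [-> bA] := int2_fubini2 mA AB A0.
have -> : 2 * a = a - - a by ring.
apply: int1_norm_le; [exact: bf1_measurable|lra| |].
- move=> y.
  have := @transport_line R (fun x => G (x, y)) (fun x => sg (x, y)) (fun x => w (x, y)) M a B L La C h k.
  set Kd := (X in _ <= X) => tl.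
  have fa x : a <= `|x| -> G (x, y) = 0.
    by move=> hx; apply: G0; apply: le_trans hx _; exact: (fst_norm_le (x, y)).
  have {}tl := tl M0 a0 h0 k0 k1 B0 L0 La0 C0 hLa hC (lipschitz2_slice1 y GM) fa
    (fun x => sg0 _) (fun x => sgB _) (lipschitz2_slice1 y sgL) (lipschitz2_slice1 y wL) (fun x => wC _).
  have sl F : bf2 F -> (exists b B', (forall q, `|F q| <= B') /\ (forall q, b < `|q| -> F q = 0)) ->
      bf1 (fun x => F (x, y)).
    by move=> bF [b [B' [F1 F2]]]; exact: (bf2_slice1 y (bf2_measurable bF) F1 F2).
  have c1 : bf1 (fun x => G (x + h * w (x, y), y) * sg (x, y)).
    apply: (sl _ b1); exists (a + 1), (M * (2 * a) * B); split => [q|q hq].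
      by rewrite normrM; apply: ler_pM.
    by rewrite G0 ?mul0r//; exact: far.
  have c2 : bf1 (fun x => G (x, y) * sg (x, y)).
    apply: (sl _ b2); exists a, (M * (2 * a) * B); split => [q|q hq].
      by rewrite normrM; apply: ler_pM.
    by rewrite G0 ?mul0r// ltW.
  have c3 : bf1 (fun x => dq1 G k (x, y) * (w (x, y) * sg (x, y))).
    apply: (sl _ b3); exists (a + 1), (M * (C * B)); split => [q|q hq].
      rewrite normrM; apply: ler_pM => //; first exact: dq1_norm_le.
      by rewrite normrM; apply: ler_pM.
    by rewrite (dq1_supp k0 k1 a0 G0 hq) mul0r.
  suff -> : int1 (fun x => A (x, y)) = int1 (fun x => G (x + h * w (x, y), y) * sg (x, y))
     - int1 (fun x => G (x, y) * sg (x, y)) - h * int1 (fun x => dquot (fun x => G (x, y)) k x * (w (x, y) * sg (x, y))) by [].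
  by rewrite -int1Z// -int1B// -int1B//; [exact: bf1B|exact: bf1Z].
- move=> y hy; have ya : a < `|y|.
    by rewrite ltNge; apply/negP => /norm_le_bounds[? ?]; apply: hy; apply/andP.
  rewrite (eq_int1 (g := fun _ => 0)); first by rewrite /int1 /Rintegral integral0.
  have zy x : G (x, y) = 0 by apply: G0; apply: le_trans (ltW ya) _; exact: (snd_norm_le (x, y)).
  by move=> x; rewrite /A /dq1 /= !zy !mul0r subrr mul0r mul0r mulr0 subrr.
Qed.

Lemma transport_step2 (sg w : R * R -> R) (B L La C : R) G (M a h k : R) :
  0 <= M -> 0 <= a -> 0 < h -> 0 < k -> k <= 1 -> 0 <= B -> 0 <= L -> 0 <= La -> 0 <= C ->
  h * La <= 1 / 2 -> h * C <= 1 ->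
  lipschitz2 M G -> (forall q, a <= `|q| -> G q = 0) ->
  (forall q, 0 <= sg q) -> (forall q, sg q <= B) -> lipschitz2 L sg ->
  lipschitz2 La w -> (forall q, `|w q| <= C) ->
  `|int2 (fun q => G (q.1, q.2 + h * w q) * sg q) - int2 (fun q => G q * sg q)
    - h * int2 (fun q => dq2 G k q * (w q * sg q))|
  <= M * (4 * (a + 3) * B * k + 2 * (a + 3) * (4 * B * La * C + L * C ^+ 2) * h ^+ 2) * (2 * a).
Proof.
move=> M0 a0 h0 k0 k1 B0 L0 La0 C0 hLa hC GM G0 sg0 sgB sgL wL wC.
have sw : forall F : R * R -> R, bf2 F ->
    (exists b B', (forall q, `|F q| <= B') /\ (forall q, b < `|q| -> F q = 0)) ->
    int2 (fun q => F (swap q)) = int2 F.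
  by move=> F bF [b [B' [F1 F2]]]; exact: (int2_swap (bf2_measurable bF) F1 F2).
have G0' q : a <= `|q| -> G (swap q) = 0 by rewrite -(norm_swap q); exact: G0.
have := @transport_step1 (fun q => sg (swap q)) (fun q => w (swap q)) B L La C
  (fun q => G (swap q)) M a h k M0 a0 h0 k0 k1 B0 L0 La0 C0 hLa hC (lipschitz2_swap GM) G0'
  (fun q => sg0 _) (fun q => sgB _) (lipschitz2_swap sgL) (lipschitz2_swap wL) (fun q => wC _).
have mG := lipschitz2_measurable GM; have msg := lipschitz2_measurable sgL.
have mw := lipschitz2_measurable wL.
have GB := lipschitz2_cpt_bounded M0 a0 GM G0.
have GB' := lipschitz2_cpt_bounded M0 a0 (lipschitz2_swap GM) G0'.
have sgN q : `|sg q| <= B by rewrite ger0_norm.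
have mS F : measurable_fun setT F -> measurable_fun setT (fun q => F (swap q)).
  by move=> mF; exact: (@measurable_pairmap snd fst F).
have hw q : `|h * w q| <= 1.
  by rewrite normrM gtr0_norm//; apply: le_trans (ler_wpM2l (ltW h0) (wC q)) hC.
have far (q : R * R) : a + 1 < `|q| -> a <= `|swap (q.1 + h * w (swap q), q.2)|.
  rewrite norm_swap !prod_normE /= lt_max le_max => /orP[hq|hq]; apply/orP; [left|right; lra].
  have : `|q.1| <= `|q.1 + h * w (swap q)| + `|h * w (swap q)|.
    by rewrite -{1}(addrK (h * w (swap q)) q.1); exact: ler_normB.
  by have := hw (swap q); lra.
have mGT : measurable_fun setT (fun q => G (swap (q.1 + h * w (swap q), q.2))).
  apply: (@measurable_move1 (fun q => G (swap q)) (fun q => h * w (swap q))); first exact: mS.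
  by apply: measurable_funM; [exact: measurable_cst|exact: mS].
have e1 : int2 (fun q => G (q.1, q.2 + h * w q) * sg q) =
    int2 (fun q => G (swap (q.1 + h * w (swap q), q.2)) * sg (swap q)).
  rewrite -(sw (fun q => G (swap (q.1 + h * w (swap q), q.2)) * sg (swap q))).
  - by apply: eq_int2 => -[x y].
  - apply: (@bf2M _ _ B) => //; last exact: mS.
    by apply: (@bf2_supp _ _ (a + 1) (M * (2 * a))) => // q hq; rewrite G0//; exact: far.
  - exists (a + 1), (M * (2 * a) * B); split => [q|q hq].
      by rewrite normrM; apply: ler_pM.
    by rewrite G0 ?mul0r//; exact: far.
have e2 : int2 (fun q => G q * sg q) = int2 (fun q => G (swap q) * sg (swap q)).
  rewrite (sw (fun q => G q * sg q))//.
    by apply: (@bf2M _ _ B) => //; apply: (@bf2_supp _ _ a (M * (2 * a))) => // q hq; rewrite G0// ltW.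
  exists a, (M * (2 * a) * B); split => [q|q hq].
    by rewrite normrM; apply: ler_pM.
  by rewrite G0 ?mul0r// ltW.
have e3 : int2 (fun q => dq2 G k q * (w q * sg q)) =
   int2 (fun q => dq1 (fun q => G (swap q)) k q * (w (swap q) * sg (swap q))).
  rewrite -(sw (fun q => dq1 (fun q => G (swap q)) k q * (w (swap q) * sg (swap q)))).
  - by apply: eq_int2 => -[x y].
  - apply: (@bf2M _ _ (C * B)).
    + apply: (@bf2_supp _ _ (a + 1) M) => [|q|q].
      * by apply: dq1_measurable; exact: mS.
      * by apply: dq1_norm_le => //; exact: lipschitz2_swap.
      * exact: dq1_supp.
    + by apply: measurable_funM; exact: mS.
    + by move=> q; rewrite normrM; apply: ler_pM.
  - exists (a + 1), (M * (C * B)); split => [q|q hq].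
      rewrite normrM; apply: ler_pM => //; first by apply: dq1_norm_le => //; exact: lipschitz2_swap.
      by rewrite normrM; apply: ler_pM.
    by rewrite (dq1_supp k0 k1 a0 G0' hq) mul0r.
by rewrite e1 e2 e3.
Qed.

(* [dq1] is moved onto the Lipschitz function [j]: no derivative of [G] is lost. *)
Lemma dq1_small (j G : R * R -> R) (L M' a k Bj : R) :
  0 < k -> k <= 1 -> 0 <= a -> 0 <= L -> 0 <= Bj -> 0 <= M' ->
  measurable_fun setT G -> (forall q, `|G q| <= M') -> (forall q, a <= `|q| -> G q = 0) ->
  lipschitz2 L j -> (forall q, `|j q| <= Bj) ->
  `|int2 (fun q => dq1 G k q * j q)| <= M' * L * (2 * a) ^+ 2.
Proof.
move=> k0 k1 a0 L0 Bj0 M0 mG GB G0 jL jB.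
have mj := lipschitz2_measurable jL.
have b1 : bf2 (fun q => G q * j q).
  by apply: (@bf2M _ _ Bj) => //; apply: (@bf2_supp _ _ a M') => // q hq; rewrite G0// ltW.
have far (q : R * R) : a + 1 < `|q| -> a <= `|(q.1 - k, q.2)|.
  rewrite !prod_normE /= lt_max le_max => /orP[h|h]; apply/orP; [left|right; lra].
  have : `|q.1| <= `|q.1 - k| + `|k| by rewrite -{1}(subrK k q.1); exact: ler_normD.
  by rewrite (gtr0_norm k0); lra.
have mGk : measurable_fun setT (fun q => G (q.1 - k, q.2)).
  exact: (@measurable_move1 G (fun=> - k)).
have b2 : bf2 (fun q => G (q.1 - k, q.2) * j q).
  apply: (@bf2M _ _ Bj) => //; apply: (@bf2_supp _ _ (a + 1) M') => // q hq.
  by rewrite G0//; exact: far.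
have mjk : measurable_fun setT (fun q => j (q.1 + k, q.2)).
  exact: (@measurable_move1 j (fun=> k)).
have b3 : bf2 (fun q => G q * j (q.1 + k, q.2)).
  by apply: (@bf2M _ _ Bj) => //; apply: (@bf2_supp _ _ a M') => // q hq; rewrite G0// ltW.
have e : int2 (fun q => G (q.1 - k, q.2) * j q) = int2 (fun q => G q * j (q.1 + k, q.2)).
  pose F q := G (q.1 - k, q.2) * j q.
  have <- := @int2_shift1 F k (a + 1) (M' * Bj) (bf2_measurable b2).
  - by apply: eq_int2 => -[x y]; rewrite /F /= addrK.
  - by move=> q; rewrite normrM; apply: ler_pM.
  - by move=> q hq; rewrite /F G0 ?mul0r//; exact: far.
have -> : int2 (fun q => dq1 G k q * j q) = int2 (fun q => k^-1 * (G q * j q - G q * j (q.1 + k, q.2))).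
  rewrite int2Z ?int2B//; last exact: bf2B.
  rewrite -e -int2B// -int2Z; last exact: bf2B.
  by apply: eq_int2 => q; rewrite /dq1; ring.
apply: int2_norm_le => //.
- by apply: bf2_measurable; apply: bf2Z; exact: bf2B.
- move=> q; rewrite -mulrBr mulrCA normrM; apply: ler_pM => //.
  rewrite normrM (@gtr0_norm _ k^-1) ?invr_gt0// ler_pdivrMl//.
  have := lipschitz2_slice1 q.2 jL q.1 (q.1 + k); rewrite -surjective_pairing => /le_trans; apply.
  by rewrite opprD addrA subrr sub0r normrN gtr0_norm// mulrC.
- by move=> q hq; rewrite G0 ?mul0r ?subrr ?mulr0// ltW.
Qed.

(** Up to order [h ^+ 2] the step is a horizontal move followed by a vertical one. Four errors add
    up: evaluating [w2] after the horizontal move, the two coordinate steps, and the use of [G]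
    instead of [G2] in the horizontal flux. [K] depends neither on the fields nor on [G], [h], [k],
    only on their bounds. *)
Lemma planar_step (B L La C LJ a : R) :
  0 <= B -> 0 <= L -> 0 <= La -> 0 <= C -> 0 <= LJ -> 0 <= a ->
  exists2 K : R, 0 <= K & forall (sg w1 w2 G : R * R -> R) (M h k : R),
  0 <= M -> 0 < h -> 0 < k -> k <= 1 -> h * La <= 1 / 2 -> h * C <= 1 ->
  lipschitz2 M G -> (forall q, a <= `|q| -> G q = 0) ->
  (forall q, 0 <= sg q) -> (forall q, sg q <= B) -> lipschitz2 L sg ->
  lipschitz2 La w1 -> (forall q, `|w1 q| <= C) ->
  lipschitz2 La w2 -> (forall q, `|w2 q| <= C) ->
  lipschitz2 LJ (fun q => w1 q * sg q) ->
  `|int2 (fun q => G (q.1 + h * w1 q, q.2 + h * w2 q) * sg q) - int2 (fun q => G q * sg q)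
    - h * (int2 (fun q => dq1 G k q * (w1 q * sg q)) + int2 (fun q => dq2 G k q * (w2 q * sg q)))|
  <= M * K * (k + h ^+ 2).
Proof.
move=> B0 L0 La0 C0 LJ0 a0.
pose Q := 4 * B * La * C + L * C ^+ 2.
have Q0 : 0 <= Q.
  by apply: addr_ge0; apply: mulr_ge0 => //; rewrite ?sqr_ge0// mulr_ge0// mulr_ge0.
pose K1 := La * C * B * (2 * (a + 2)) ^+ 2.
pose K2 := 2 * (4 * (a + 4) * B + 2 * (a + 4) * Q) * (2 * (a + 1)).
pose K3 := (4 * (a + 3) * B + 2 * (a + 3) * Q) * (2 * a).
pose K4 := C * LJ * (2 * (a + 1)) ^+ 2.
have K10 : 0 <= K1 by rewrite /K1 mulr_ge0 ?sqr_ge0// mulr_ge0// mulr_ge0.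
have K40 : 0 <= K4 by rewrite /K4 mulr_ge0 ?sqr_ge0// mulr_ge0.
have mix c : 0 <= c -> 0 <= 4 * c * B + 2 * c * Q.
  by move=> c0; apply: addr_ge0; apply: mulr_ge0 => //; lra.
have K20 : 0 <= K2.
  by rewrite /K2; apply: mulr_ge0; [apply: mulr_ge0 => //; apply: mix; lra|lra].
have K30 : 0 <= K3.
  by rewrite /K3; apply: mulr_ge0; [apply: mix; lra|lra].
exists (K1 + K2 + K3 + K4); first by rewrite !addr_ge0.
move=> sg w1 w2 G M h k M0 h0 k0 k1 hLa hC GM G0 sg0 sgB sgL w1L w1C w2L w2C jL.
have mG := lipschitz2_measurable GM; have msg := lipschitz2_measurable sgL.
have mw1 := lipschitz2_measurable w1L; have mw2 := lipschitz2_measurable w2L.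
have GB := lipschitz2_cpt_bounded M0 a0 GM G0.
have sgN q : `|sg q| <= B by rewrite ger0_norm.
have mhw w : measurable_fun setT w -> measurable_fun setT (fun q : R * R => h * w q).
  by move=> mw; apply: measurable_funM => //; exact: measurable_cst.
have hw w : (forall q, `|w q| <= C) -> forall q : R * R, `|h * w q| <= h * C.
  by move=> wC q; rewrite normrM gtr0_norm//; apply: ler_wpM2l => //; exact: ltW.
pose G2 q := G (q.1, q.2 + h * w2 q).
have G2M : lipschitz2 (2 * M) G2.
  move=> p q; apply: le_trans (GM _ _) _.
  rewrite (mulrC 2) -mulrA; apply: ler_wpM2l => //; apply: pair_norm_le => /=.
    by have := fst_norm_le (p - q); have := normr_ge0 (p - q); rewrite /=; lra.
  have -> : p.2 + h * w2 p - (q.2 + h * w2 q) = (p.2 - q.2) + h * (w2 p - w2 q) by ring.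
  apply: le_trans (ler_normD _ _) _.
  have h1 := snd_norm_le (p - q); rewrite /= in h1.
  rewrite normrM (gtr0_norm h0).
  have h2 := ler_wpM2l (ltW h0) (w2L p q).
  have h3 := ler_wpM2r (normr_ge0 (p - q)) hLa.
  by have := normr_ge0 (p - q); lra.
have mG2 := lipschitz2_measurable G2M.
have far2 (q : R * R) : a + 1 <= `|q| -> a <= `|(q.1, q.2 + h * w2 q)|.
  rewrite !prod_normE /= !le_max => /orP[h1|h1]; apply/orP; [left; lra|right].
  have : `|q.2| <= `|q.2 + h * w2 q| + `|h * w2 q| by rewrite -{1}(addrK (h * w2 q) q.2); exact: ler_normB.
  by have := hw w2 w2C q; lra.
have far1 (q : R * R) : a + 2 < `|q| -> a + 1 <= `|(q.1 + h * w1 q, q.2)|.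
  rewrite !prod_normE /= lt_max le_max => /orP[h1|h1]; apply/orP; [left|right; lra].
  have : `|q.1| <= `|q.1 + h * w1 q| + `|h * w1 q| by rewrite -{1}(addrK (h * w1 q) q.1); exact: ler_normB.
  by have := hw w1 w1C q; lra.
have far12 (q : R * R) : a + 2 < `|q| -> a <= `|(q.1 + h * w1 q, q.2 + h * w2 q)|.
  rewrite !prod_normE /= lt_max le_max => /orP[h1|h1]; apply/orP; [left|right].
    have : `|q.1| <= `|q.1 + h * w1 q| + `|h * w1 q| by rewrite -{1}(addrK (h * w1 q) q.1); exact: ler_normB.
    by have := hw w1 w1C q; lra.
  have : `|q.2| <= `|q.2 + h * w2 q| + `|h * w2 q| by rewrite -{1}(addrK (h * w2 q) q.2); exact: ler_normB.
  by have := hw w2 w2C q; lra.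
have G20 q : a + 1 <= `|q| -> G2 q = 0 by move=> hq; rewrite /G2 G0//; exact: far2.
have G2B q : `|G2 q| <= M * (2 * a) by exact: GB.
have a1 : 0 <= a + 1 by lra.
have M2 : 0 <= 2 * M by lra.
have t2 := transport_step1 M2 a1 h0 k0 k1 B0 L0 La0 C0 hLa hC G2M G20 sg0 sgB sgL w1L w1C.
have t3 := transport_step2 M0 a0 h0 k0 k1 B0 L0 La0 C0 hLa hC GM G0 sg0 sgB sgL w2L w2C.
(* [G2 - G] is of size [M * (h * C)], but its difference quotient need not be small uniformly in
   [k]. Moving the quotient onto the Lipschitz current gains the factor [h]; the other factor [h]
   multiplies the flux. *)
have t4 : `|int2 (fun q => dq1 (fun q => G2 q - G q) k q * (w1 q * sg q))| <= (M * (h * C)) * LJ * (2 * (a + 1)) ^+ 2.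
  apply: (@dq1_small _ _ LJ _ _ _ (C * B)) => //.
  - exact: mulr_ge0.
  - by apply: mulr_ge0 => //; apply: mulr_ge0 => //; exact: ltW.
  - exact: measurable_funB.
  - move=> [x y]; rewrite /G2 /=; apply: le_trans (lipschitz2_slice2 _ GM _ _) _.
    by apply: ler_wpM2l => //; rewrite addrAC subrr add0r; exact: hw.
  - by move=> q hq; rewrite G20// G0 ?subrr//; lra.
  - by move=> q; rewrite normrM; apply: ler_pM.
have bd F : lipschitz2 (2 * M) F -> (forall q, a + 1 <= `|q| -> F q = 0) ->
    bf2 (fun q => dq1 F k q * (w1 q * sg q)).
  move=> FM F0; apply: (@bf2M _ _ (C * B)).
  - apply: (@bf2_supp _ _ (a + 1 + 1) (2 * M)) => [|q|q].
    + by apply: dq1_measurable; exact: lipschitz2_measurable FM.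
    + exact: dq1_norm_le.
    + exact: dq1_supp.
  - exact: measurable_funM.
  - by move=> q; rewrite normrM; apply: ler_pM.
have GM' : lipschitz2 (2 * M) G.
  by move=> p q; apply: le_trans (GM p q) _; apply: ler_wpM2r => //; lra.
have e4 : int2 (fun q => dq1 (fun q => G2 q - G q) k q * (w1 q * sg q)) =
    int2 (fun q => dq1 G2 k q * (w1 q * sg q)) - int2 (fun q => dq1 G k q * (w1 q * sg q)).
  rewrite -int2B; [|exact: bd|].
    by apply: eq_int2 => q; rewrite /dq1; ring.
  by apply: bd => // q hq; apply: G0; lra.
have t1 : `|int2 (fun q => G (q.1 + h * w1 q, q.2 + h * w2 q) * sg q)
   - int2 (fun q => G2 (q.1 + h * w1 q, q.2) * sg q)| <= M * (h * (La * (h * C))) * B * (2 * (a + 2)) ^+ 2.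
  have b1 : bf2 (fun q => G (q.1 + h * w1 q, q.2 + h * w2 q) * sg q).
    apply: (@bf2M _ _ B) => //; apply: (@bf2_supp _ _ (a + 2) (M * (2 * a))) => //.
      apply: (@measurable_pairmap (fun q => q.1 + h * w1 q) (fun q => q.2 + h * w2 q)) => //.
        by apply: measurable_funD; [exact: measurable_fst|exact: mhw].
      by apply: measurable_funD; [exact: measurable_snd|exact: mhw].
    by move=> q hq; rewrite G0//; exact: far12.
  have b2 : bf2 (fun q => G2 (q.1 + h * w1 q, q.2) * sg q).
    apply: (@bf2M _ _ B) => //; apply: (@bf2_supp _ _ (a + 2) (M * (2 * a))) => //.
      by apply: (@measurable_move1 G2 (fun q => h * w1 q)) => //; exact: mhw.
    by move=> q hq; rewrite G20//; exact: far1.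
  rewrite -int2B//; apply: int2_norm_le.
  - by apply: bf2_measurable; exact: bf2B.
  - lra.
  - move=> q; rewrite -mulrBl normrM; apply: ler_pM => //.
    rewrite /G2 /=; apply: le_trans (lipschitz2_slice2 _ GM _ _) _.
    apply: ler_wpM2l => //; rewrite opprD addrACA subrr add0r -mulrBr normrM gtr0_norm//.
    apply: ler_wpM2l; first exact: ltW.
    have := lipschitz2_slice1 q.2 w2L q.1 (q.1 + h * w1 q); rewrite -surjective_pairing => /le_trans; apply.
    by apply: ler_wpM2l => //; rewrite opprD addrA subrr sub0r normrN; exact: hw.
  - by move=> q hq; rewrite (G0 _ (far12 q hq)) (G20 _ (far1 q hq)) mul0r subrr.
have {}t4 : `|h * int2 (fun q => dq1 (fun q => G2 q - G q) k q * (w1 q * sg q))| <= M * K4 * h ^+ 2.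
  rewrite normrM gtr0_norm//; have -> : M * K4 * h ^+ 2 = h * (M * (h * C) * LJ * (2 * (a + 1)) ^+ 2) by rewrite /K4; ring.
  by apply: ler_wpM2l => //; exact: ltW.
have h20 : 0 <= h ^+ 2 by exact: sqr_ge0.
have kh : h ^+ 2 <= k + h ^+ 2 by rewrite lerDr ltW.
rewrite -/Q in t2 t3; rewrite e4 in t4.
apply: le_trans (telescope_norm t1 t2 t3 t4) _.
have -> : M * (K1 + K2 + K3 + K4) * (k + h ^+ 2) =
  M * K1 * (k + h ^+ 2) + M * K2 * (k + h ^+ 2) + M * K3 * (k + h ^+ 2) + M * K4 * (k + h ^+ 2) by ring.
apply: lerD; [apply: lerD; [apply: lerD|]|].
- have -> : M * (h * (La * (h * C))) * B * (2 * (a + 2)) ^+ 2 = M * K1 * h ^+ 2 by rewrite /K1; ring.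
  by apply: ler_wpM2l => //; exact: mulr_ge0.
- have -> : M * K2 * (k + h ^+ 2) = 2 * M * (2 * (a + 1)) *
    ((4 * (a + 1 + 3) * B + 2 * (a + 1 + 3) * Q) * (k + h ^+ 2)) by rewrite /K2; ring.
  rewrite mulrAC; apply: ler_wpM2l; first by rewrite !mulr_ge0.
  by apply: mixed_bound => //; [rewrite addr_ge0|exact: ltW].
- have -> : M * K3 * (k + h ^+ 2) = M * (2 * a) *
    ((4 * (a + 3) * B + 2 * (a + 3) * Q) * (k + h ^+ 2)) by rewrite /K3; ring.
  rewrite mulrAC; apply: ler_wpM2l; first by rewrite !mulr_ge0.
  by apply: mixed_bound => //; [rewrite addr_ge0|exact: ltW].
- by apply: ler_wpM2l => //; exact: mulr_ge0.
Qed.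

End PlanarStep.

(* [leb2] with its sigma-finite structure, which the library only attaches to
   products of probability measures. *)
Definition plane_measure (R : realType) := (@lebesgue_measure R \x @lebesgue_measure R)%E.
HB.instance Definition _ (R : realType) := Measure.on (@plane_measure R).

Lemma plane_measure_sigma_finite (R : realType) : sigma_finite setT (@plane_measure R).
Proof.
exists (fun n => square n%:R); last first.
  by move=> n; split; [exact: measurable_square|exact: leb2_square_fin].
apply/seteqP; split => // q _; exists (Num.truncn `|q|).+1 => //=.
have /truncn_itv/andP[_ h] := normr_ge0 q.
exact: ltW.
Qed.

HB.instance Definition _ (R : realType) :=
  Measure_isSigmaFinite.Build _ _ _ (@plane_measure R) (@plane_measure_sigma_finite R).

(** * The weak continuity equation *)

Definition space_measure (R : realType) := (@lebesgue_measure R \x @plane_measure R)%E.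
HB.instance Definition _ (R : realType) := Measure.on (@space_measure R).

Section WeakContinuity.
Context {R : realType}.

Lemma derivable_quotient_cvg (f : R -> R) (x : R) : derivable f x 1 ->
  (fun n => (f (x + harmonic n) - f x) / harmonic n) @ \oo --> derive1 f x.
Proof.
move=> df.
have : (fun h : R => h^-1 *: ((f \o shift x) (h *: 1) - f x)) @ 0^' --> derive1 f x.
  by rewrite derive1E; exact: df.
move=> /cvgrPdist_le fl; apply/cvgrPdist_le => e /fl {fl} [d /= d0 H].
have /cvgrPdist_lt /(_ d d0) [N _ HN] := @cvg_harmonic R.
exists N => // n /HN /= hn.
have hp : harmonic n != 0 :> R by rewrite invr_neq0// pnatr_eq0.
have := H (harmonic n) hn hp.
by rewrite /= [_ *: 1]mulr1 [_ *: (_ - _)]mulrC [_ + x]addrC.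
Qed.

Lemma measurable_move2 (G g : R * R -> R) : measurable_fun setT G -> measurable_fun setT g ->
  measurable_fun setT (fun q : R * R => G (q.1, q.2 + g q)).
Proof.
move=> mG mg; apply: (@measurable_pairmap R fst (fun q => q.2 + g q) G) => //.
by apply: measurable_funD => //; exact: measurable_snd.
Qed.

Lemma step_ge_bf1 (u v : R) : u <= v -> bf1 (fun x : R => (x <= v)%R%:R - (x <= u)%R%:R : R).
Proof.
move=> uv; split.
  by apply: measurable_funB; apply: measurable_ind_le => //; exact: measurable_cst.
exists `[u, v]%classic, 1; split => //.
- exact: lebesgue_segment_fin.
- by move=> x; exact: norm_ind_le.
move=> x /=; rewrite in_itv /=; case: (leP x v) => xv; case: (leP x u) => xu; rewrite ?subrr//.
  by rewrite (ltW xu).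
by exfalso; lra.
Qed.

Lemma average_close (m : R -> R) (Km c k : R) : 0 < k -> 0 <= Km ->
  (forall x y, `|m x - m y| <= Km * `|x - y|) -> (exists B, forall x, `|m x| <= B) ->
  `|int1 (fun u => ((u <= c + k)%R%:R - (u <= c)%R%:R) * m u) - k * m c| <= Km * k * k.
Proof.
move=> k0 Km0 mL [B mB].
have ck : c <= c + k by lra.
have bs := step_ge_bf1 ck.
have mm := lipschitz_line_measurable mL.
have b1 : bf1 (fun u => ((u <= c + k)%R%:R - (u <= c)%R%:R) * m u) by apply: (bf1M bs mm mB).
have b2 : bf1 (fun u => m c * ((u <= c + k)%R%:R - (u <= c)%R%:R)) by exact: bf1Z.
have -> : k * m c = int1 (fun u => m c * ((u <= c + k)%R%:R - (u <= c)%R%:R)).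
  by rewrite int1Z// int1_step_ge//; ring.
rewrite -int1B//.
have -> : Km * k * k = (Km * k) * (c + k - c) by ring.
apply: int1_norm_le => //.
- by apply: bf1_measurable; exact: bf1B.
- move=> u; rewrite [m c * _]mulrC -mulrBr normrM.
  case: (leP u (c + k)) => h1; case: (leP u c) => h2; rewrite ?subrr ?normr0 ?mul0r;
    rewrite ?mulr_ge0 ?(ltW k0)//; last by exfalso; lra.
  rewrite subr0 normr1 mul1r; apply: le_trans (mL _ _) _.
  by apply: ler_wpM2l => //; apply: bounds_norm_le; lra.
- move=> u hu; rewrite [m c * _]mulrC -mulrBr.
  case: (leP u (c + k)) => h1; case: (leP u c) => h2; rewrite ?subrr ?mul0r//; exfalso;
    by apply: hu; apply/andP; split; lra.
Qed.

(** Arithmetic of [weak_continuity]: [A1] and [A2] are the integrals of the mass over windows of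
    length [k] at the end and at the start of the step, [A3] is that of the flux over the whole
    step, and [m1], [m0], [F] are the values that they approximate. *)
Lemma quotient_balance (k h Km eta F Fl A1 A2 A3 m1 m0 : R) : 0 < k -> 0 < h -> 0 <= Km ->
  k <= eta / (4 * Km + 1) ->
  - (Km * k * k) <= A1 - k * m1 -> A1 - k * m1 <= Km * k * k ->
  - (Km * k * k) <= A2 - k * m0 -> A2 - k * m0 <= Km * k * k ->
  - (Fl * h * h) <= A3 - h * F -> A3 - h * F <= Fl * h * h ->
  - (eta / 2) <= k^-1 * (A1 - A2) - A3 -> k^-1 * (A1 - A2) - A3 <= eta / 2 ->
  `|m1 - m0 - h * F| <= Fl * h ^+ 2 + eta.
Proof.
move=> k0 h0 Km0 kKm a1 a2 a3 a4 a5 a6 i1 i2.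
have kK : k * (4 * Km + 1) <= eta by rewrite -ler_pdivlMr// ltr_wpDl// mulr_ge0.
have X1 : k^-1 * (A1 - A2) <= m1 - m0 + 2 * Km * k by rewrite ler_pdivrMl//; lra.
have X2 : m1 - m0 - 2 * Km * k <= k^-1 * (A1 - A2) by rewrite ler_pdivlMl//; lra.
move: i1 i2 X1 X2; set Z := k^-1 * _ => i1 i2 X1 X2.
by apply: bounds_norm_le; lra.
Qed.

(** Local in time and space because truncated fields obey the equation only inside the region where
    they agree with the original or reflected ones. *)
Definition continuity_on (r j1 j2 : R -> R * R -> R) (T b : R) :=
  exists2 N : set (R * (R * R)), leb3.-negligible N &
   forall t q, 0 < t -> t < T -> `|q| < b -> ~ N (t, q) ->
    [/\ derivable (fun s => r s q) t 1,
        derivable (fun x => j1 t (x, q.2)) q.1 1,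
        derivable (fun y => j2 t (q.1, y)) q.2 1
      & derive1 (fun s => r s q) t + derive1 (fun x => j1 t (x, q.2)) q.1
        + derive1 (fun y => j2 t (q.1, y)) q.2 = 0].

Variables (r j1 j2 : R -> R * R -> R) (L T b : R).
Hypotheses (L0 : 0 <= L) (rL : lipschitz3 L r) (j1L : lipschitz3 L j1) (j2L : lipschitz3 L j2)
  (CE : continuity_on r j1 j2 T b).

(** The space-time divergence with forward quotients in place of derivatives. It is bounded
    everywhere by [3 * L] and tends to zero wherever the equation holds, as dominated convergence
    requires. *)
Definition dbal (k : R) u (q : R * R) :=
  (r (u + k) q - r u q) / k + (j1 u (q.1 + k, q.2) - j1 u q) / k + (j2 u (q.1, q.2 + k) - j2 u q) / k.

Lemma dbal_norm_le k u q : 0 < k -> `|dbal k u q| <= 3 * L.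
Proof.
move=> k0.
have step (f : R) : `|f| <= L * k -> `|f / k| <= L.
  by move=> h; rewrite normrM (@gtr0_norm _ k^-1) ?invr_gt0// ler_pdivrMr.
have d1 : `|(r (u + k) q - r u q) / k| <= L.
  apply: step; apply: le_trans (rL _ _ _ _) _.
  by rewrite subrr normr0 addr0 addrAC subrr add0r gtr0_norm.
have d2 : `|(j1 u (q.1 + k, q.2) - j1 u q) / k| <= L.
  apply: step; have := lipschitz2_slice1 q.2 (lipschitz3_slice u j1L) (q.1 + k) q.1.
  have -> : q.1 + k - q.1 = k by ring.
  by rewrite -surjective_pairing (gtr0_norm k0).
have d3 : `|(j2 u (q.1, q.2 + k) - j2 u q) / k| <= L.
  apply: step; have := lipschitz2_slice2 q.1 (lipschitz3_slice u j2L) (q.2 + k) q.2.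
  have -> : q.2 + k - q.2 = k by ring.
  by rewrite -surjective_pairing (gtr0_norm k0).
apply: le_trans (ler_normD _ _) _; have := ler_normD ((r (u + k) q - r u q) / k) ((j1 u (q.1 + k, q.2) - j1 u q) / k).
by lra.
Qed.

Lemma lipschitz3_move f k c1 c2 : lipschitz3 L f ->
  lipschitz3 L (fun u q => f (u + k) (q.1 + c1, q.2 + c2)).
Proof.
move=> fL s s' q q'; apply: le_trans (fL _ _ _ _) _.
apply: ler_wpM2l => //; apply: lerD; first by rewrite opprD addrACA subrr addr0.
by rewrite !prod_normE /= !opprD !(addrACA _ c1) !(addrACA _ c2) !subrr !addr0.
Qed.

Lemma dbal_measurable k : measurable_fun setT (fun p : R * (R * R) => dbal k p.1 p.2).
Proof.
have e0 f : lipschitz3 L f -> measurable_fun setT (fun p : R * (R * R) => f p.1 p.2).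
  exact: lipschitz3_measurable.
have er : lipschitz3 L (fun u q => r (u + k) q).
  by have := lipschitz3_move k 0 0 rL; congr lipschitz3; apply/funext => u; apply/funext => -[x y] /=; rewrite !addr0.
have e1 : lipschitz3 L (fun u q => j1 u (q.1 + k, q.2)).
  by have := lipschitz3_move 0 k 0 j1L; congr lipschitz3; apply/funext => u; apply/funext => -[x y] /=; rewrite !addr0.
have e2 : lipschitz3 L (fun u q => j2 u (q.1, q.2 + k)).
  by have := lipschitz3_move 0 0 k j2L; congr lipschitz3; apply/funext => u; apply/funext => -[x y] /=; rewrite !addr0.
apply: measurable_funD; first apply: measurable_funD.
- exact: measurable_funM (measurable_funB (e0 _ er) (e0 _ rL)) (measurable_cst _).
- exact: measurable_funM (measurable_funB (e0 _ e1) (e0 _ j1L)) (measurable_cst _).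
- exact: measurable_funM (measurable_funB (e0 _ e2) (e0 _ j2L)) (measurable_cst _).
Qed.

Lemma dbal_cvg N t q : (forall t q, 0 < t -> t < T -> `|q| < b -> ~ N (t, q) ->
    [/\ derivable (fun s => r s q) t 1,
        derivable (fun x => j1 t (x, q.2)) q.1 1,
        derivable (fun y => j2 t (q.1, y)) q.2 1
      & derive1 (fun s => r s q) t + derive1 (fun x => j1 t (x, q.2)) q.1
        + derive1 (fun y => j2 t (q.1, y)) q.2 = 0]) ->
  0 < t -> t < T -> `|q| < b -> ~ N (t, q) ->
  (fun n => dbal (harmonic n) t q) @ \oo --> (0 : R).
Proof.
move=> HN t0 tT qb /(HN _ _ t0 tT qb)[d1 d2 d3 <-].
apply: cvgD; first apply: cvgD.
- exact: derivable_quotient_cvg d1.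
- by have := derivable_quotient_cvg d2; rewrite -surjective_pairing.
- by have := derivable_quotient_cvg d3; rewrite -surjective_pairing.
Qed.

Section TestFunction.
Variables (G : R * R -> R) (M a : R) (B : R).
Hypotheses (M0 : 0 <= M) (a0 : 0 <= a) (ab : a < b)
  (GM : lipschitz2 M G) (G0 : forall q, a <= `|q| -> G q = 0)
  (rB : forall s q, `|r s q| <= B) (j1B : forall s q, `|j1 s q| <= B)
  (j2B : forall s q, `|j2 s q| <= B).

Let mass u := int2 (fun q => G q * r u q).
Let flux k u := int2 (fun q => dq1 G k q * j1 u q) + int2 (fun q => dq2 G k q * j2 u q).

Let mG : measurable_fun setT G. Proof. exact: lipschitz2_measurable GM. Qed.
Let GB : forall q, `|G q| <= M * (2 * a). Proof. exact: lipschitz2_cpt_bounded. Qed.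
Let B0 : 0 <= B. Proof. exact: le_trans (rB 0 (0, 0)). Qed.

Let bG (f : R * R -> R) : measurable_fun setT f -> (forall q, `|f q| <= B) -> bf2 (fun q => G q * f q).
Proof.
move=> mf fB; apply: (bf2M (B := B)) => //.
by apply: (@bf2_supp _ _ a (M * (2 * a))) => // q hq; rewrite G0// ltW.
Qed.

Let mslice f u : lipschitz3 L f -> measurable_fun setT (f u).
Proof. by move=> fL; exact: lipschitz2_measurable (lipschitz3_slice u fL). Qed.

Let Km := M * (2 * a) * L * (2 * a) ^+ 2.

Let mass_lip u u' : `|mass u - mass u'| <= Km * `|u - u'|.
Proof.
rewrite /mass -int2B; [|apply: bG => //; exact: mslice|apply: bG => //; exact: mslice].
have -> : Km * `|u - u'| = (M * (2 * a) * (L * `|u - u'|)) * (2 * a) ^+ 2 by rewrite /Km; ring.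
apply: int2_norm_le => //.
- by apply: bf2_measurable; apply: bf2B; apply: bG => //; exact: mslice.
- move=> q; rewrite -mulrBr normrM; apply: ler_pM => //.
  by apply: le_trans (rL _ _ _ _) _; rewrite subrr normr0 addr0.
- by move=> q hq; rewrite G0 ?mul0r ?subrr// ltW.
Qed.

Let mass_bounded u : `|mass u| <= M * (2 * a) * B * (2 * a) ^+ 2.
Proof.
apply: int2_norm_le => //.
- by apply: bf2_measurable; apply: bG => //; exact: mslice.
- by move=> q; rewrite normrM; apply: ler_pM.
- by move=> q hq; rewrite G0 ?mul0r// ltW.
Qed.

Let dq2_norm k q : 0 < k -> `|dq2 G k q| <= M.
Proof.
move=> k0; have := @dq1_norm_le R M (fun q => G (swap q)) k (swap q) k0 (lipschitz2_swap GM).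
by rewrite /dq1 /swap /= -surjective_pairing.
Qed.

Let dq2_supp k q : 0 < k -> k <= 1 -> a + 1 < `|q| -> dq2 G k q = 0.
Proof.
move=> k0 k1 hq.
have := @dq1_supp R (fun q => G (swap q)) a k (swap q) k0 k1 a0.
rewrite /dq1 /swap /= -surjective_pairing; apply.
  by move=> p hp; apply: G0; rewrite norm_swap.
by rewrite norm_swap.
Qed.

Let mdq1 k : measurable_fun setT (dq1 G k). Proof. exact: dq1_measurable. Qed.
Let mdq2 k : measurable_fun setT (dq2 G k).
Proof.
apply: measurable_funM; last exact: measurable_cst.
apply: measurable_funB => //.
exact: (@measurable_move2 G (fun=> - k)).
Qed.

Let bdq1 (f : R * R -> R) k : measurable_fun setT f -> (forall q, `|f q| <= B) -> 0 < k -> k <= 1 ->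
  bf2 (fun q => dq1 G k q * f q).
Proof.
move=> mf fB k0 k1; apply: (bf2M (B := B)) => //.
apply: (@bf2_supp _ _ (a + 1) M) => // q; first exact: dq1_norm_le.
exact: dq1_supp.
Qed.

Let bdq2 (f : R * R -> R) k : measurable_fun setT f -> (forall q, `|f q| <= B) -> 0 < k -> k <= 1 ->
  bf2 (fun q => dq2 G k q * f q).
Proof.
move=> mf fB k0 k1; apply: (bf2M (B := B)) => //.
apply: (@bf2_supp _ _ (a + 1) M) => // q; first exact: dq2_norm.
exact: dq2_supp.
Qed.

Let flux_lip k u u' : 0 < k -> k <= 1 ->
  `|flux k u - flux k u'| <= 2 * (M * L * (2 * (a + 1)) ^+ 2) * `|u - u'|.
Proof.
move=> k0 k1; have a0' := a0.
have d1 : `|int2 (fun q => dq1 G k q * j1 u q) - int2 (fun q => dq1 G k q * j1 u' q)| <=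
    M * (L * `|u - u'|) * (2 * (a + 1)) ^+ 2.
  have b1 u1 : bf2 (fun q => dq1 G k q * j1 u1 q) by apply: bdq1 => //; exact: mslice.
  rewrite -int2B//; apply: int2_norm_le; [by apply: bf2_measurable; exact: bf2B|lra| |].
  - move=> q; rewrite -mulrBr normrM; apply: ler_pM => //; first exact: dq1_norm_le.
    by apply: le_trans (j1L _ _ _ _) _; rewrite subrr normr0 addr0.
  - by move=> q hq; rewrite (dq1_supp k0 k1 a0 G0 hq) !mul0r subrr.
have d2 : `|int2 (fun q => dq2 G k q * j2 u q) - int2 (fun q => dq2 G k q * j2 u' q)| <=
    M * (L * `|u - u'|) * (2 * (a + 1)) ^+ 2.
  have b1 u1 : bf2 (fun q => dq2 G k q * j2 u1 q) by apply: bdq2 => //; exact: mslice.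
  rewrite -int2B//; apply: int2_norm_le; [by apply: bf2_measurable; exact: bf2B|lra| |].
  - move=> q; rewrite -mulrBr normrM; apply: ler_pM => //; first exact: dq2_norm.
    by apply: le_trans (j2L _ _ _ _) _; rewrite subrr normr0 addr0.
  - by move=> q hq; rewrite (dq2_supp k0 k1 hq) !mul0r subrr.
have [p1 p2] := norm_le_bounds d1; have [p3 p4] := norm_le_bounds d2.
by rewrite /flux; apply: bounds_norm_le; lra.
Qed.

(** An exact summation by parts: translating the variable turns a forward quotient of the current
    into a backward quotient of [G], with a change of sign. *)
Let int2_dbal k u : 0 < k -> k <= 1 ->
  int2 (fun q => G q * dbal k u q) = (mass (u + k) - mass u) / k - flux k u.
Proof.
move=> k0 k1; have a0' := a0; have k0' := k0.
have m1 : measurable_fun setT (fun q : R * R => j1 u (q.1 + k, q.2)).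
  by apply: (@measurable_move1 R (j1 u) (fun=> k)) => //; exact: mslice.
have m2 : measurable_fun setT (fun q : R * R => j2 u (q.1, q.2 + k)).
  by apply: (@measurable_move2 (j2 u) (fun=> k)) => //; exact: mslice.
have c1 : bf2 (fun q => G q * r (u + k) q) by apply: bG => //; exact: mslice.
have c2 : bf2 (fun q => G q * r u q) by apply: bG => //; exact: mslice.
have c3 : bf2 (fun q => G q * j1 u (q.1 + k, q.2)) by exact: bG.
have c4 : bf2 (fun q => G q * j1 u q) by apply: bG => //; exact: mslice.
have c5 : bf2 (fun q => G q * j2 u (q.1, q.2 + k)) by exact: bG.
have c6 : bf2 (fun q => G q * j2 u q) by apply: bG => //; exact: mslice.
have far1 (q : R * R) : a + 1 < `|q| -> a <= `|(q.1 - k, q.2)|.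
  rewrite !prod_normE /= lt_max le_max => /orP[h|h]; apply/orP; [left|right; lra].
  have : `|q.1| <= `|q.1 - k| + `|k| by rewrite -{1}(subrK k q.1); exact: ler_normD.
  by rewrite (gtr0_norm k0); lra.
have far2 (q : R * R) : a + 1 < `|q| -> a <= `|(q.1, q.2 - k)|.
  rewrite !prod_normE /= lt_max le_max => /orP[h|h]; apply/orP; [left; lra|right].
  have : `|q.2| <= `|q.2 - k| + `|k| by rewrite -{1}(subrK k q.2); exact: ler_normD.
  by rewrite (gtr0_norm k0); lra.
have mGk1 : measurable_fun setT (fun q : R * R => G (q.1 - k, q.2)) by exact: (@measurable_move1 R G (fun=> - k)).
have mGk2 : measurable_fun setT (fun q : R * R => G (q.1, q.2 - k)) by exact: (@measurable_move2 G (fun=> - k)).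
have mj1 := mslice u j1L; have mj2 := mslice u j2L.
have c7 : bf2 (fun q => G (q.1 - k, q.2) * j1 u q).
  apply: (bf2M (B := B)) => //; apply: (@bf2_supp _ _ (a + 1) (M * (2 * a))) => // q hq.
  by rewrite G0//; exact: far1.
have c8 : bf2 (fun q => G (q.1, q.2 - k) * j2 u q).
  apply: (bf2M (B := B)) => //; apply: (@bf2_supp _ _ (a + 1) (M * (2 * a))) => // q hq.
  by rewrite G0//; exact: far2.
have e1 : int2 (fun q => G q * j1 u (q.1 + k, q.2)) = int2 (fun q => G (q.1 - k, q.2) * j1 u q).
  rewrite -(@int2_shift1 R (fun q => G (q.1 - k, q.2) * j1 u q) k (a + 1) (M * (2 * a) * B)).
  - by apply: eq_int2 => -[x y] /=; rewrite addrK.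
  - exact: bf2_measurable c7.
  - by move=> q; rewrite normrM; apply: ler_pM.
  - by move=> q hq; rewrite G0 ?mul0r//; exact: far1.
have e2 : int2 (fun q => G q * j2 u (q.1, q.2 + k)) = int2 (fun q => G (q.1, q.2 - k) * j2 u q).
  pose F q := G (q.1, q.2 - k) * j2 u q.
  have FB q : `|F q| <= M * (2 * a) * B by rewrite normrM; apply: ler_pM.
  have F0 q : a + 1 < `|q| -> F q = 0 by move=> hq; rewrite /F G0 ?mul0r//; exact: far2.
  have mF : measurable_fun setT F by exact: bf2_measurable c8.
  have mFs : measurable_fun setT (fun q => F (swap q)).
    exact: (@measurable_pairmap R snd fst F).
  rewrite -[RHS](int2_swap mF FB F0).
  rewrite -(@int2_shift1 R (fun q => F (swap q)) k (a + 1) (M * (2 * a) * B)) //; last first.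
    by move=> q hq; rewrite F0// norm_swap.
  rewrite -[LHS](int2_swap (bf2_measurable c5) (b := a) (B := M * (2 * a) * B)).
  - by apply: eq_int2 => -[x y] /=; rewrite /F /swap /= addrK.
  - by move=> q; rewrite normrM; apply: ler_pM.
  - by move=> q hq; rewrite G0 ?mul0r// ltW.
have e3 : flux k u = k^-1 * (int2 (fun q => G q * j1 u q) - int2 (fun q => G (q.1 - k, q.2) * j1 u q))
   + k^-1 * (int2 (fun q => G q * j2 u q) - int2 (fun q => G (q.1, q.2 - k) * j2 u q)).
  rewrite /flux -!int2B// -!int2Z; [|exact: bf2B|exact: bf2B].
  by congr (_ + _); apply: eq_int2 => q; rewrite /dq1 /dq2; ring.
rewrite e3 /mass.
rewrite [LHS](_ : _ = int2 (fun q => k^-1 * (G q * r (u + k) q - G q * r u q)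
  + k^-1 * (G q * j1 u (q.1 + k, q.2) - G q * j1 u q)
  + k^-1 * (G q * j2 u (q.1, q.2 + k) - G q * j2 u q))); last first.
  by apply: eq_int2 => q; rewrite /dbal; ring.
have z1 := bf2Z k^-1 (bf2B c1 c2); have z2 := bf2Z k^-1 (bf2B c3 c4); have z3 := bf2Z k^-1 (bf2B c5 c6).
rewrite (int2D (bf2D z1 z2) z3) (int2D z1 z2) (int2Z _ (bf2B c1 c2)) (int2Z _ (bf2B c3 c4)) (int2Z _ (bf2B c5 c6)).
by rewrite (int2B c1 c2) (int2B c3 c4) (int2B c5 c6) e1 e2; ring.
Qed.

Let flux_bounded k u : 0 < k -> k <= 1 -> `|flux k u| <= M * B * (2 * (a + 1)) ^+ 2 + M * B * (2 * (a + 1)) ^+ 2.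
Proof.
move=> k0 k1; have a0' := a0; apply: le_trans (ler_normD _ _) _; apply: lerD.
- apply: int2_norm_le; [|lra| |].
  + by apply: bf2_measurable; apply: bdq1 => //; exact: mslice.
  + by move=> q; rewrite normrM; apply: ler_pM => //; exact: dq1_norm_le.
  + by move=> q hq; rewrite (dq1_supp k0 k1 a0 G0 hq) mul0r.
- apply: int2_norm_le; [|lra| |].
  + by apply: bf2_measurable; apply: bdq2 => //; exact: mslice.
  + by move=> q; rewrite normrM; apply: ler_pM => //; exact: dq2_norm.
  + by move=> q hq; rewrite (dq2_supp k0 k1 hq) mul0r.
Qed.

Let chi (s t u : R) : R := (u <= t)%R%:R - (u <= s)%R%:R.

Let measurable_chi s t : measurable_fun setT (chi s t).
Proof. by apply: measurable_funB; apply: measurable_ind_le => //; exact: measurable_cst. Qed.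

(** Dominated convergence in space-time along [k = harmonic n]. The factor [chi s t] restricts to
    [s < u <= t] and [G] to [|q| < a], so the equation is invoked only where [CE] grants it. *)
Let balance_cvg s t : 0 <= s -> s <= t -> t < T ->
  (fun n => int1 (fun u => chi s t u * int2 (fun q => G q * dbal (harmonic n) u q))) @ \oo --> (0 : R).
Proof.
move=> s0 st tT.
pose m3 := @space_measure R.
pose f n (p : R * (R * R)) : R := chi s t p.1 * (G p.2 * dbal (harmonic n) p.1 p.2).
pose D := (`[s, t]%classic `*` square a) : set (R * (R * R)).
have mD : measurable D by apply: measurableX => //; exact: measurable_square.
have Dfin : (m3 D < +oo)%E.
  have -> : m3 D = (@lebesgue_measure R `[s, t] * @plane_measure R (square a))%E.
    exact: (@product_measure1E _ _ _ _ R (@lebesgue_measure R) (@plane_measure R) _ _ (measurable_itv _) (@measurable_square R a)).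
  apply: lte_mul_pinfty => //; last exact: leb2_square_fin.
  by rewrite ge0_fin_numE//; exact: lebesgue_segment_fin.
have h0 n : 0 < harmonic n :> R by rewrite invr_gt0.
have h1 n : harmonic n <= 1 :> R by rewrite invf_le1// ler1n.
have mf n : measurable_fun setT (f n).
  apply: measurable_funM.
    by apply: (measurableT_comp (f := chi s t)) => //; exact: measurable_fst.
  apply: measurable_funM; last exact: dbal_measurable.
  by apply: (measurableT_comp (f := G)) => //; exact: measurable_snd.
have fB n p : `|f n p| <= M * (2 * a) * (3 * L).
  rewrite normrM -[leRHS]mul1r; apply: ler_pM => //; first exact: norm_ind_le.
  by rewrite normrM; apply: ler_pM => //; exact: dbal_norm_le.
have f0 n p : ~ D p -> f n p = 0.
  case: p => u q /= nD; rewrite /f /=.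
  have [hq|hq] := leP `|q| a; last by rewrite G0 ?mul0r ?mulr0// ltW.
  rewrite /chi; case: (leP u t) => ut; case: (leP u s) => us; rewrite ?subrr ?mul0r//.
    by exfalso; apply: nD; split => //=; rewrite in_itv /= ut (ltW us).
  by exfalso; lra.
have intf n : m3.-integrable setT (EFin \o f n) by exact: (@bounded_integrable _ _ R m3 D _ (f n) mD Dfin (mf n) (fB n) (f0 n)).
have fub n : (\int[m3]_p (f n p)%:E)%E =
    (int1 (fun u => chi s t u * int2 (fun q => G q * dbal (harmonic n) u q)))%:E.
  have e := @integral12_prod_meas1 _ _ _ _ R (@lebesgue_measure R) (@plane_measure R) _ (intf n).
  have mdb u : measurable_fun setT (fun q => dbal (harmonic n) u q).
    have := @dbal_measurable (harmonic n) => /(fun h => measurableT_comp h (pair1_measurable u)); exact.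
  have bGd u : bf2 (fun q => G q * dbal (harmonic n) u q).
    apply: (bf2M (B := 3 * L)) => //; last by move=> q; exact: dbal_norm_le.
    by apply: (@bf2_supp _ _ a (M * (2 * a))) => // q hq; rewrite G0// ltW.
  have inner u : (\int[@plane_measure R]_q (f n (u, q))%:E)%E = (chi s t u * int2 (fun q => G q * dbal (harmonic n) u q))%:E.
    rewrite -int2Z// /int2 /Rintegral fineK//.
    apply: integrable_fin_num => //.
    exact: (bounded_finite_integrable (bf2Z (chi s t u) (bGd u))).
  have mF := @measurable_fubini_F _ _ _ _ R (@lebesgue_measure R) (@plane_measure R) _ (intf n).
  have mI : measurable_fun setT (fun u => chi s t u * int2 (fun q => G q * dbal (harmonic n) u q)).
    apply/measurable_EFinP; move: mF; congr (measurable_fun _ _).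
    by apply/funext => u; exact: inner.
  have ib u : `|int2 (fun q => G q * dbal (harmonic n) u q)| <= M * (2 * a) * (3 * L) * (2 * a) ^+ 2.
    apply: int2_norm_le => //; first exact: bf2_measurable (bGd u).
      by move=> q; rewrite normrM; apply: ler_pM => //; exact: dbal_norm_le.
    by move=> q hq; rewrite G0 ?mul0r// ltW.
  have bI : bf1 (fun u => chi s t u * int2 (fun q => G q * dbal (harmonic n) u q)).
    apply: (@bf1_supp _ _ (`|s| + `|t|) (M * (2 * a) * (3 * L) * (2 * a) ^+ 2)) => //.
      by move=> u; rewrite normrM -[leRHS]mul1r; apply: ler_pM => //; exact: norm_ind_le.
    move=> u hu; rewrite /chi; case: (leP u t) => ut; case: (leP u s) => us; rewrite ?subrr ?mul0r//.
      exfalso; move: hu; apply/negP; rewrite -leNgt.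
      by rewrite ger0_norm; [have := ler_norm t; have := normr_ge0 s; lra|lra].
    by exfalso; lra.
  rewrite -e /int1 /Rintegral fineK; last by apply: integrable_fin_num => //; exact: bounded_finite_integrable bI.
  by apply: eq_integral => u _; exact: inner.
have cvg3 : (fun n => (\int[m3]_p (f n p)%:E)%E) @ \oo --> (0 : \bar R).
  have [N N0 HN] := CE.
  pose g := (fun p => (M * (2 * a) * (3 * L) * \1_D p)%:E) : R * (R * R) -> \bar R.
  have ML0 : 0 <= M * (2 * a) * (3 * L) by rewrite mulr_ge0// mulr_ge0// mulr_ge0.
  have ig : m3.-integrable setT g.
    apply: (@bounded_integrable _ _ R m3 D (M * (2 * a) * (3 * L)) (fun p => M * (2 * a) * (3 * L) * \1_D p) mD Dfin).
    - by apply: measurable_funM => //; exact: measurable_cst.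
    - move=> p; rewrite normrM ger0_norm// ler_piMr// indicE.
      by case: (p \in D); rewrite ?normr1 ?normr0.
    - by move=> p nD; rewrite indicE memNset// mulr0.
  have := @dominated_convergence _ _ R m3 setT measurableT (fun n => EFin \o f n) (cst 0%E) g.
  case.
  - by move=> n; have /measurable_EFinP := mf n; exact.
  - exact: measurable_cst.
  - have N0' : m3.-negligible N := N0.
    apply: (negligibleS _ N0') => -[u q] /= H.
    apply: contrapT => nN; apply: H => _.
    apply: cvg_EFin; first by near=> n.
    rewrite /comp /=.
    have [hu|/negP hu] := boolP (s < u <= t); last first.
      rewrite (_ : (fun _ => _) = cst 0); first exact: cvg_cst.
      apply/funext => n; rewrite /f /= /chi; case: (leP u t) => ut; case: (leP u s) => us; rewrite ?subrr ?mul0r//.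
        by exfalso; apply: hu; rewrite us ut.
      by exfalso; lra.
    have [hq|hq] := leP a `|q|.
      by rewrite (_ : (fun _ => _) = cst 0); [exact: cvg_cst|apply/funext => n; rewrite /f /= G0// mul0r mulr0].
    rewrite -[X in _ --> X](mulr0 (chi s t u)); apply: cvgM; first exact: cvg_cst.
    rewrite -[X in _ --> X](mulr0 (G q)); apply: cvgM; first exact: cvg_cst.
    have /andP[su ut] := hu.
    apply: (dbal_cvg HN) => //; [exact: le_lt_trans su|exact: le_lt_trans tT|exact: lt_trans ab].
  - exact: ig.
  - apply: aeW => -[u q] n _ /=; rewrite /g lee_fin indicE.
    have [hD|hD] := boolP ((u, q) \in D); first by rewrite mulr1; exact: fB.
    by rewrite f0 ?normr0 ?mulr0//; move=> /mem_set h; rewrite h in hD.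
  move=> _ _; rewrite integral_cst// mul0e; exact.
move: cvg3; under eq_fun do rewrite fub.
by move=> /fine_cvg.
Unshelve. all: by end_near. Qed.

(** The width [k] depends on [eta], and convergence of [flux k] as [k] tends to zero is not claimed:
    [planar_step] contains the same flux, and the two copies will cancel. *)
Lemma weak_continuity s h eta : 0 <= s -> 0 < h -> s + h < T -> 0 < eta ->
  exists k, [/\ 0 < k, k <= 1, k <= eta &
   `|mass (s + h) - mass s - h * flux k s| <= 2 * (M * L * (2 * (a + 1)) ^+ 2) * h ^+ 2 + eta].
Proof.
move=> s0 h0 shT eta0.
have ssh : s <= s + h by rewrite lerDl ltW.
have /cvgrPdist_lt /(_ (eta / 2)) [|N1 _ HN1] := balance_cvg s0 ssh shT; first by rewrite divr_gt0.
have Km0 : 0 <= Km by rewrite /Km !mulr_ge0// exprn_ge0// mulr_ge0.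
(* The second bound makes the two window averages cost [2 * Km * k <= eta / 2]; the other half of
   [eta] pays for the space-time integral. *)
have c0 : 0 < Num.min eta (eta / (4 * Km + 1)).
  by rewrite lt_min eta0 divr_gt0// ltr_wpDl// mulr_ge0.
have /cvgrPdist_lt /(_ _ c0) [N2 _ HN2] := @cvg_harmonic R.
pose n := maxn N1 N2; pose k : R := harmonic n.
have k0 : 0 < k by rewrite invr_gt0.
have k1 : k <= 1 by rewrite invf_le1// ler1n.
have kc : k < Num.min eta (eta / (4 * Km + 1)).
  by have := HN2 n (leq_maxr _ _); rewrite /= sub0r normrN gtr0_norm.
move: kc; rewrite lt_min => /andP[keta kKm].
have I0 := HN1 n (leq_maxl _ _); rewrite sub0r normrN in I0.
exists k; split => //; first exact: ltW.
have mm : measurable_fun setT mass by exact: (@lipschitz_line_measurable R Km mass).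
have mfl : measurable_fun setT (flux k).
  by apply: (@lipschitz_line_measurable R _ (flux k)) => u u'; exact: flux_lip.
have bc u v : u <= v -> bf1 (chi u v) by exact: step_ge_bf1.
have mk : measurable_fun setT (fun u : R => mass (u + k)) by exact: measurable_translate.
have b1 : bf1 (fun u => chi s (s + h) u * mass (u + k)).
  by apply: (bf1M (bc _ _ ssh) mk) => u; exact: mass_bounded.
have b2 : bf1 (fun u => chi s (s + h) u * mass u).
  by apply: (bf1M (bc _ _ ssh) mm) => u; exact: mass_bounded.
have b3 : bf1 (fun u => chi s (s + h) u * flux k u).
  by apply: (bf1M (bc _ _ ssh) mfl) => u; exact: flux_bounded.
have e : int1 (fun u => chi s (s + h) u * int2 (fun q => G q * dbal (harmonic n) u q)) =
  k^-1 * (int1 (fun u => chi s (s + h) u * mass (u + k)) - int1 (fun u => chi s (s + h) u * mass u))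
  - int1 (fun u => chi s (s + h) u * flux k u).
  rewrite -(int1B b1 b2) -(int1Z _ (bf1B b1 b2)) -(int1B (bf1Z _ (bf1B b1 b2)) b3).
  by apply: eq_int1 => u; rewrite int2_dbal// -/k; ring.
have e1 : int1 (fun u => chi s (s + h) u * mass (u + k)) =
    int1 (fun u => chi (s + k) (s + h + k) u * mass u).
  rewrite -[RHS](@int1_shift _ _ k).
    by apply: eq_int1 => u; rewrite /chi !lerD2r.
  by apply: measurable_funM => //; exact: measurable_chi.
have kk (u : R) : u <= u + k by rewrite lerDl ltW.
have skh : s + k <= s + h + k by rewrite lerD2r.
have b4 : bf1 (fun u => chi (s + k) (s + h + k) u * mass u).
  by apply: (bf1M (bc _ _ skh) mm) => u; exact: mass_bounded.
have b5 : bf1 (fun u => chi (s + h) (s + h + k) u * mass u).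
  by apply: (bf1M (bc _ _ (kk _)) mm) => u; exact: mass_bounded.
have b6 : bf1 (fun u => chi s (s + k) u * mass u).
  by apply: (bf1M (bc _ _ (kk _)) mm) => u; exact: mass_bounded.
(* After shifting time by [k], the windows []s, s + h]] and []s + k, s + h + k]] overlap, and only
   two windows of length [k] at the ends survive. *)
have e2 : int1 (fun u => chi s (s + h) u * mass (u + k)) - int1 (fun u => chi s (s + h) u * mass u)
  = int1 (fun u => chi (s + h) (s + h + k) u * mass u) - int1 (fun u => chi s (s + k) u * mass u).
  rewrite e1 -(int1B b4 b2) -(int1B b5 b6).
  by apply: eq_int1 => u; rewrite /chi; ring.
have mB : exists B', forall x, `|mass x| <= B' by eexists => u; exact: mass_bounded.
have /norm_le_bounds[a1 a2] := average_close (s + h) k0 Km0 mass_lip mB.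
have /norm_le_bounds[a3 a4] := average_close s k0 Km0 mass_lip mB.
have Fl0 : 0 <= 2 * (M * L * (2 * (a + 1)) ^+ 2).
  by apply: mulr_ge0 => //; apply: mulr_ge0; [exact: mulr_ge0|exact: sqr_ge0].
have fB : exists B', forall x, `|flux k x| <= B' by eexists => u; exact: flux_bounded.
have /norm_le_bounds[a5 a6] := average_close s h0 Fl0 (fun x y => flux_lip x y k0 k1) fB.
move: I0; rewrite e e2 => /ltW/norm_le_bounds[i1 i2].
exact: (quotient_balance k0 h0 Km0 (ltW kKm) a1 a2 a3 a4 a5 a6 i1 i2).
Qed.

End TestFunction.

End WeakContinuity.

(** * Transport along Euler's scheme *)

Section EulerTransport.
Context {R : realType}.
Variables (w : R -> R * R -> R * R) (sg : R -> R * R -> R) (L La C B T b : R).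
Hypotheses (L0 : 0 <= L) (La0 : 0 <= La) (C0 : 0 <= C)
  (wL : forall s s' q q', `|w s q - w s' q'| <= La * (`|s - s'| + `|q - q'|))
  (wC : forall s q, `|w s q| <= C)
  (sg0 : forall s q, 0 <= sg s q) (sgB : forall s q, sg s q <= B) (sgL : lipschitz3 L sg)
  (j1L : lipschitz3 L (fun s q => (w s q).1 * sg s q))
  (j2L : lipschitz3 L (fun s q => (w s q).2 * sg s q))
  (CE : continuity_on sg (fun s q => (w s q).1 * sg s q) (fun s q => (w s q).2 * sg s q) T b).

Let estep h s (q : R * R) := (q.1 + h * (w s q).1, q.2 + h * (w s q).2).

Lemma estep_lipschitz h s p q : 0 <= h -> `|estep h s p - estep h s q| <= (1 + h * La) * `|p - q|.
Proof.
move=> h0.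
have := wL s s p q; rewrite subrr normr0 add0r => hw.
apply: pair_norm_le => /=.
- have d := le_trans (fst_norm_le (w s p - w s q)) hw.
  rewrite [X in `|X|](_ : _ = (p.1 - q.1) + h * ((w s p).1 - (w s q).1)); last by ring.
  apply: le_trans (ler_normD _ _) _; rewrite mulrDl mul1r; apply: lerD; first exact: fst_norm_le (p - q).
  by rewrite normrM ger0_norm// -mulrA; apply: ler_wpM2l.
- have d := le_trans (snd_norm_le (w s p - w s q)) hw.
  rewrite [X in `|X|](_ : _ = (p.2 - q.2) + h * ((w s p).2 - (w s q).2)); last by ring.
  apply: le_trans (ler_normD _ _) _; rewrite mulrDl mul1r; apply: lerD; first exact: snd_norm_le (p - q).
  by rewrite normrM ger0_norm// -mulrA; apply: ler_wpM2l.
Qed.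

Lemma estep_near h s q : 0 <= h -> `|q| <= `|estep h s q| + h * C.
Proof.
move=> h0.
apply: pair_norm_le => /=.
- have d := le_trans (fst_norm_le (w s q)) (wC s q).
  have -> : q.1 = (q.1 + h * (w s q).1) - h * (w s q).1 by ring.
  apply: le_trans (ler_normB _ _) _; apply: lerD; first exact: fst_norm_le (estep h s q).
  by rewrite normrM ger0_norm//; apply: ler_wpM2l.
- have d := le_trans (snd_norm_le (w s q)) (wC s q).
  have -> : q.2 = (q.2 + h * (w s q).2) - h * (w s q).2 by ring.
  apply: le_trans (ler_normB _ _) _; apply: lerD; first exact: snd_norm_le (estep h s q).
  by rewrite normrM ger0_norm//; apply: ler_wpM2l.
Qed.

(** The fluxes of [planar_step] and [weak_continuity] cancel; the terms in [k] and [eta] are as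
    small as desired, and order [h ^+ 2] remains. That [K] does not depend on [G], [s] or [h] is
    what the iteration needs. *)
Lemma estep_transport a : 0 <= a -> a < b -> exists2 K : R, 0 <= K & forall G M s h,
  0 <= M -> lipschitz2 M G -> (forall q, a <= `|q| -> G q = 0) ->
  0 <= s -> 0 < h -> s + h < T -> h * La <= 1 / 2 -> h * C <= 1 ->
  `|int2 (fun q => G (estep h s q) * sg s q) - int2 (fun q => G q * sg (s + h) q)| <= M * K * h ^+ 2.
Proof.
move=> a0 ab; have B0 : 0 <= B by exact: le_trans (sg0 0 (0, 0)) (sgB _ _).
have [K K0 HK] := planar_step B0 L0 La0 C0 L0 a0.
have K1 : 0 <= 2 * (L * (2 * (a + 1)) ^+ 2) by rewrite !mulr_ge0// addr_ge0.
exists (K + 2 * (L * (2 * (a + 1)) ^+ 2)); first exact: addr_ge0.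
move=> G M s h M0 GM G0 s0 h0 shT hLa hC.
apply/ler_addgt0Pr => e e0.
(* With [k <= eta] this choice gives [M * K * k + eta <= e]. *)
have eta0 : 0 < e / (M * K + 1) by rewrite divr_gt0// ltr_wpDl// mulr_ge0.
have B1 : B <= (1 + C) * B by rewrite mulrDl mul1r lerDl mulr_ge0.
have sgB1 s1 q : `|sg s1 q| <= (1 + C) * B.
  by rewrite ger0_norm//; exact: le_trans (sgB _ _) B1.
have jB (f : R) s1 q : `|f| <= C -> `|f * sg s1 q| <= (1 + C) * B.
  move=> fC; rewrite normrM (@ger0_norm _ (sg s1 q))//; apply: ler_pM => //.
  by apply: le_trans fC _; rewrite lerDr.
have j1B s1 q : `|(w s1 q).1 * sg s1 q| <= (1 + C) * B.
  by apply: jB; exact: le_trans (fst_norm_le _) (wC _ _).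
have j2B s1 q : `|(w s1 q).2 * sg s1 q| <= (1 + C) * B.
  by apply: jB; exact: le_trans (snd_norm_le _) (wC _ _).
have [k [k0 k1 keta W]] := weak_continuity L0 sgL j1L j2L CE M0 a0 ab GM G0 sgB1 j1B j2B s0 h0 shT eta0.
have wL1 : lipschitz2 La (fun q => (w s q).1).
  move=> p q; apply: le_trans (fst_norm_le (w s p - w s q)) _.
  by have := wL s s p q; rewrite subrr normr0 add0r.
have wL2 : lipschitz2 La (fun q => (w s q).2).
  move=> p q; apply: le_trans (snd_norm_le (w s p - w s q)) _.
  by have := wL s s p q; rewrite subrr normr0 add0r.
have w1C q : `|(w s q).1| <= C by exact: le_trans (fst_norm_le _) (wC _ _).
have w2C q : `|(w s q).2| <= C by exact: le_trans (snd_norm_le _) (wC _ _).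
have P := HK (sg s) (fun q => (w s q).1) (fun q => (w s q).2) G M h k M0 h0 k0 k1 hLa hC GM G0
  (sg0 s) (sgB s) (lipschitz3_slice s sgL) wL1 w1C wL2 w2C (lipschitz3_slice s j1L).
have kM : M * K * k + e / (M * K + 1) <= e.
  have MK : 0 <= M * K by rewrite mulr_ge0.
  have : M * K * k <= M * K * (e / (M * K + 1)) by rewrite ler_wpM2l.
  have : (M * K + 1) * (e / (M * K + 1)) = e by rewrite mulrC divfK// gt_eqF// ltr_wpDl.
  by rewrite mulrDl mul1r; set z := _ / _; move=> <-; rewrite lerD2r.
have [p1 p2] := norm_le_bounds P; have [w1 w2] := norm_le_bounds W.
move: p1 p2 w1 w2 kM.
move: (int2 _) => A0; move: (int2 _) => A1; move: (_ + int2 _) => F.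
by move: (int2 _) => A2 p1 p2 w1 w2 kM; apply: bounds_norm_le; lra.
Qed.

Lemma euler_transport a t : 0 <= a -> 0 <= t -> t < T -> a + t * C < b ->
  exists2 K : R, 0 <= K & forall G M h n,
  0 <= M -> lipschitz2 M G -> (forall q, a <= `|q| -> G q = 0) ->
  0 < h -> n%:R * h = t -> h * La <= 1 / 2 -> h * C <= 1 ->
  `|int2 (fun q => G (euler w h n q) * sg 0 q) - int2 (fun q => G q * sg t q)| <= M * K * h.
Proof.
move=> a0 t0 tT atb.
have A0 : 0 <= a + t * C by rewrite addr_ge0// mulr_ge0.
have [K K0 HK] := estep_transport A0 atb.
exists (t * K * expR (t * La)); first by rewrite !mulr_ge0// expR_ge0.
move=> G M h n M0 GM G0 h0 nh hLa hC; have h0' := ltW h0.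
have q0 : 0 <= 1 + h * La by rewrite addr_ge0// mulr_ge0.
have q1 : 1 <= 1 + h * La by rewrite lerDl mulr_ge0.
(* The induction pulls the test function back through the last step: its Lipschitz constant is
   multiplied by [1 + h * La] and its support widens by [h * C]. Hence the radius budget [a + t * C]
   and the exponential in the constant. *)
have main m : (m <= n)%N -> forall a' M' G', 0 <= M' -> a' + m%:R * (h * C) <= a + t * C ->
    lipschitz2 M' G' -> (forall q, a' <= `|q| -> G' q = 0) ->
    `|int2 (fun q => G' (euler w h m q) * sg 0 q) - int2 (fun q => G' q * sg (m%:R * h) q)|
    <= m%:R * (K * h ^+ 2) * (M' * (1 + h * La) ^+ m).
  elim: m => [|m IH] mn a' M' G' M'0 ha' GM' G0'.
    by rewrite /= !mul0r subrr normr0.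
  have GM1 : lipschitz2 (M' * (1 + h * La)) (fun q => G' (estep h (m%:R * h) q)).
    move=> p q; apply: le_trans (GM' _ _) _; rewrite -mulrA; apply: ler_wpM2l => //.
    exact: estep_lipschitz.
  have G01 q : a' + h * C <= `|q| -> G' (estep h (m%:R * h) q) = 0.
    by move=> hq; apply: G0'; have := estep_near (m%:R * h) q h0'; lra.
  have ha1 : a' + h * C + m%:R * (h * C) <= a + t * C.
    by move: ha'; rewrite -natr1 mulrDl mul1r => /(le_trans _); apply; rewrite addrAC addrA.
  have := IH (ltnW mn) _ _ _ (mulr_ge0 M'0 q0) ha1 GM1 G01.
  have mhT : m%:R * h + h < T.
    apply: le_lt_trans tT; rewrite -nh -{2}(mul1r h) -mulrDl natr1.
    by rewrite ler_wpM2r// ler_nat.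
  have G02 q : a + t * C <= `|q| -> G' q = 0.
    move=> hq; apply: G0'; apply: le_trans hq; apply: le_trans ha'.
    by rewrite lerDl mulr_ge0// mulr_ge0.
  have mh0 : 0 <= m%:R * h by rewrite mulr_ge0.
  have := HK G' M' (m%:R * h) h M'0 GM' G02 mh0 h0 mhT hLa hC.
  have -> : m.+1%:R * h = m%:R * h + h by rewrite -natr1 mulrDl mul1r.
  move=> S1 S2.
  have e1 : 1 <= (1 + h * La) ^+ m.+1 by apply: exprn_ege1.
  have : M' * K * h ^+ 2 <= K * h ^+ 2 * (M' * (1 + h * La) ^+ m.+1).
    have -> : M' * K * h ^+ 2 = K * h ^+ 2 * (M' * 1) by ring.
    by apply: ler_wpM2l; [rewrite mulr_ge0// sqr_ge0|exact: ler_wpM2l].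
  move=> S3; rewrite [X in _ <= X](_ : _ = m%:R * (K * h ^+ 2) * (M' * (1 + h * La) * (1 + h * La) ^+ m)
      + K * h ^+ 2 * (M' * (1 + h * La) ^+ m.+1)); last by rewrite (exprS _ m) -(@natr1 _ m); ring.
  rewrite -(subrKA (int2 (fun q => G' (estep h (m%:R * h) q) * sg (m%:R * h) q))).
  apply: le_trans (ler_normD _ _) _; apply: lerD; first exact: S2.
  exact: le_trans S1 S3.
have := main n (leqnn n) a M G M0 _ GM G0; rewrite mulrA nh lexx => /(_ isT) /le_trans; apply.
have -> : M * (t * K * expR (t * La)) * h = (t * K * h) * (M * expR (t * La)) by ring.
have -> : n%:R * (K * h ^+ 2) = t * K * h by rewrite -nh; ring.
apply: ler_wpM2l; first by rewrite !mulr_ge0.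
apply: ler_wpM2l => //; rewrite -nh -mulrA expRM_natl.
by apply: lerXn2r; rewrite ?nnegrE ?expR_ge0//; exact: expR_ge1Dx.
Qed.

End EulerTransport.

(** * Transport along trajectories away from the nodes *)

(** Only the second denominator is bounded below; at the first point the bound on the quotient [v]
    itself is used. Closeness of two velocities thus depends on the density along the reference
    trajectory alone. *)
Lemma quotient_dist (R : realType) (v p' y' dp dy c d : R) : 0 < d -> d <= dy -> 0 <= c ->
  `|v| <= c -> v * dp = p' ->
  `|v - y' / dy| <= (c * `|dy - dp| + `|p' - y'|) / d.
Proof.
move=> d0 dd c0 vc vdp.
have dy0 : 0 < dy by exact: lt_le_trans dd.
have -> : v - y' / dy = (v * (dy - dp) + (p' - y')) / dy.
  by rewrite -vdp; field; rewrite gt_eqF.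
rewrite normrM (@gtr0_norm _ dy^-1) ?invr_gt0//.
apply: ler_pM => //; first by rewrite invr_ge0 ltW.
  apply: le_trans (ler_normD _ _) _; rewrite lerD2r normrM.
  by apply: ler_wpM2r.
by rewrite lef_pV2.
Qed.

Lemma step_bounds (R : realType) (x y m : R) : 2 * x + y <= m -> 0 <= x -> 0 <= y -> 0 < m ->
  x / m <= 1 / 2 /\ y / m <= 1.
Proof. by move=> h x0 y0 m0; split; rewrite ler_pdivrMr//; lra. Qed.

Lemma transport_arith (R : realType) (i x y mk d p z c : R) : i - (x + y) <= mk ->
  d <= p + z -> mk + z <= c -> i + d <= x + (y + p) + c.
Proof. lra. Qed.

Section Velocity.
Context {R : realType}.
Variables (r : R -> R * R -> R) (j : R -> R * R -> R * R) (L C B : R).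
Hypotheses (L0 : 0 <= L) (C0 : 0 <= C) (rL : lipschitz3 L r)
  (jL : forall b, lipschitz3 L (fun s q => cd b (j s q)))
  (r0 : forall s q, 0 <= r s q) (rB : forall s q, r s q <= B)
  (jC : forall b s q, `|cd b (j s q)| <= C * r s q).

Definition velocity (dn : R -> R * R -> R) s q : R * R := ((j s q).1 / dn s q, (j s q).2 / dn s q).

Lemma cd_velocity dn s q b : cd b (velocity dn s q) = cd b (j s q) / dn s q.
Proof. by case: b. Qed.

Section Denominator.
Variables (dn : R -> R * R -> R) (d : R).
Hypotheses (d0 : 0 < d) (dnL : lipschitz3 L dn) (dnd : forall s q, d <= dn s q)
  (rdn : forall s q, r s q <= dn s q).

Let dn0 s q : 0 < dn s q. Proof. exact: lt_le_trans (dnd s q). Qed.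

Lemma cd_velocity_norm b s q : `|cd b (velocity dn s q)| <= C.
Proof.
rewrite cd_velocity normrM (@gtr0_norm _ (_^-1)) ?invr_gt0// ler_pdivrMr//.
by apply: le_trans (jC _ _ _) _; exact: ler_wpM2l.
Qed.

Lemma velocity_norm s q : `|velocity dn s q| <= C.
Proof. by apply: pair_norm_le; [exact: (cd_velocity_norm true)|exact: (cd_velocity_norm false)]. Qed.

Lemma velocity_lipschitz s s' q q' :
  `|velocity dn s q - velocity dn s' q'| <= (1 + C) * L / d * (`|s - s'| + `|q - q'|).
Proof.
apply: cd_pair_norm_le => b; rewrite (cd_velocity _ s' q').
have e : cd b (velocity dn s q) * dn s q = cd b (j s q) by rewrite cd_velocity divfK// gt_eqF.
have h1 := cd_velocity_norm b s q.
have h2 := quotient_dist (cd b (j s' q')) d0 (dnd s' q') C0 h1 e.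
apply: le_trans h2 _.
have -> : (1 + C) * L / d * (`|s - s'| + `|q - q'|) =
  (C * (L * (`|s - s'| + `|q - q'|)) + L * (`|s - s'| + `|q - q'|)) / d by ring.
rewrite ler_pM2r ?invr_gt0//; apply: lerD; last exact: jL.
by apply: ler_wpM2l => //; rewrite distrC; exact: dnL.
Qed.

End Denominator.

(** [shifted] adds a constant, so it obeys the same continuity equation with the same current.
    [capped] does not, but its velocity is exactly [j / r] wherever [r >= dl]. *)
Definition shifted (eps : R) s q := r s q + eps.
Definition capped (dl : R) s q := Num.max dl (r s q).

Lemma shifted_lipschitz eps : lipschitz3 L (shifted eps).
Proof. by move=> s s' q q'; rewrite /shifted opprD addrACA subrr addr0; exact: rL. Qed.

Lemma capped_lipschitz dl : lipschitz3 L (capped dl).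
Proof. by move=> s s' q q'; apply: le_trans (maxr_dist _ _ _) _; exact: rL. Qed.

(** A solution that keeps [r >= dl], encoded by a Taylor bound: flow lines of regularised fields and
    differentiable solutions both fit, and the bound is the local error of Euler's scheme. *)
Definition trajectory (dl K t : R) (x : R -> R * R) :=
  (forall s, 0 <= s -> s <= t -> dl <= r s (x s)) /\
  (forall s s' b, 0 <= s -> s <= s' -> s' <= t ->
    `|cd b (x s') - cd b (x s) - (s' - s) * (cd b (j s (x s)) / r s (x s))| <= K * (s' - s) ^+ 2).

(* The regularisation error enters only through the Lipschitz constant of
   the velocity along the trajectory, which does not depend on [eps]. *)
Lemma euler_trajectory (eps dl K t h : R) n x : 0 < eps -> 0 < dl -> 0 <= K -> 0 < h -> n%:R * h = t ->
  trajectory dl K t x ->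
  `|euler (velocity (shifted eps)) h n (x 0) - x t| <=
    expR (t * ((1 + C) * L / dl)) * (t * (C * eps / dl + K * h)).
Proof.
move=> e0 dl0 K0 h0 nh [xd xK].
set w := velocity (shifted eps).
pose La := (1 + C) * L / dl.
have La0 : 0 <= La by rewrite /La divr_ge0 ?mulr_ge0 ?addr_ge0// ltW.
have hL : 0 <= h * La by rewrite mulr_ge0// ltW.
have hb : 0 <= h * (C * eps / dl + K * h).
  by apply: mulr_ge0; [|apply: addr_ge0; [apply: divr_ge0|]]; rewrite ?mulr_ge0// ltW.
have := @discrete_gronwall R (fun k => `|euler w h k (x 0) - x (k%:R * h)|) _ _ n hL hb.
cbv beta; rewrite mul0r /= subrr normr0 add0r (mulrA _ h La) (mulrA _ h (_ + _)) nh -/La; apply => // k kn.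
have s0 : 0 <= k%:R * h by rewrite mulr_ge0// ltW.
have ss : k%:R * h <= k.+1%:R * h by rewrite ler_wpM2r ?ler_nat// ltW.
have st : k.+1%:R * h <= t by rewrite -nh ler_wpM2r ?ler_nat// ltW.
apply: cd_pair_norm_le => b; rewrite eulerS.
have := xK _ _ b s0 ss st.
have -> : k.+1%:R * h - k%:R * h = h by rewrite -natr1; ring.
set s := k%:R * h in s0 *; set p := euler w h k (x 0); set y := x s.
have dy : dl <= r s y by apply: xd => //; exact: le_trans st.
have vC : `|cd b (w s p)| <= C.
  apply: (@cd_velocity_norm (shifted eps) eps) => // [s1 q1|s1 q1]; rewrite /shifted ?lerDr// lerDl.
  exact: ltW.
have sp0 : 0 < shifted eps s p by rewrite ltr_wpDl.
have vp : cd b (w s p) * shifted eps s p = cd b (j s p).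
  by rewrite /w cd_velocity divfK// gt_eqF.
have hv := quotient_dist (cd b (j s y)) dl0 dy C0 vC vp; move=> hx.
have hv2 : `|cd b (w s p) - cd b (j s y) / r s y| <= La * `|p - y| + C * eps / dl.
  apply: le_trans hv _.
  have -> : La * `|p - y| + C * eps / dl = (C * (L * `|p - y| + eps) + L * `|p - y|) / dl.
    by rewrite /La; ring.
  rewrite ler_pM2r ?invr_gt0//; apply: lerD.
    apply: ler_wpM2l => //; rewrite /shifted opprD addrA.
    apply: le_trans (ler_normB _ _) _; rewrite (gtr0_norm e0) lerD2r distrC.
    by have := rL s s p y; rewrite subrr normr0 add0r.
  by have := jL b s s p y; rewrite subrr normr0 add0r.
have [d1 d2] := norm_le_bounds (cdB_norm_le b p y).
have [d3 d4] := norm_le_bounds hv2; have [d5 d6] := norm_le_bounds hx.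
have d7 := ler_wpM2l (ltW h0) d3; have d8 := ler_wpM2l (ltW h0) d4.
move: d1 d2 d5 d6 d7 d8; clear.
move: (cd b p) (cd b y) (cd b (w s p)) (_ / r s y) (cd b (x _)) (C * eps / dl) `|p - y| => P Y V U Z W N.
by move=> d1 d2 d5 d6 d7 d8; apply: bounds_norm_le; lra.
Qed.

(** Both trajectories are limits of the same Euler polygons, those of [shifted eps] with
    [eps = 1 / (n + 1)] and [h = t / (n + 1)]. *)
Lemma trajectory_unique (dl K K' t : R) x x' : 0 < dl -> 0 <= K -> 0 <= K' -> 0 < t ->
  trajectory dl K t x -> trajectory dl K' t x' -> x 0 = x' 0 -> x t = x' t.
Proof.
move=> dl0 K0 K'0 t0 tx tx' x00.
apply/eqP; rewrite -subr_eq0 -normr_le0.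
pose E := expR (t * ((1 + C) * L / dl)).
apply: (@le_of_le_add_harmonic R _ _ (E * (t * (2 * (C / dl) + (K + K') * t)))) => n.
rewrite add0r.
have e0 : 0 < n.+1%:R^-1 :> R by rewrite invr_gt0.
have h0 : 0 < t / n.+1%:R by rewrite divr_gt0.
have nh : n.+1%:R * (t / n.+1%:R) = t by rewrite mulrC divfK.
have A1 := euler_trajectory e0 dl0 K0 h0 nh tx.
have A2 := euler_trajectory e0 dl0 K'0 h0 nh tx'.
move: A1 A2; rewrite x00 -/E; set p := euler _ _ _ _ => A1 A2.
rewrite -(subrKA p) addrC; apply: le_trans (ler_normD _ _) _.
rewrite (distrC (x t)); apply: le_trans (lerD A2 A1) _.
by rewrite le_eqVlt; apply/orP; left; apply/eqP; ring.
Qed.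

Lemma shifted_continuity eps T b : 0 < eps ->
  continuity_on r (fun s q => (j s q).1) (fun s q => (j s q).2) T b ->
  continuity_on (shifted eps) (fun s q => (velocity (shifted eps) s q).1 * shifted eps s q)
    (fun s q => (velocity (shifted eps) s q).2 * shifted eps s q) T b.
Proof.
move=> e0.
have ne s q : shifted eps s q != 0 by rewrite gt_eqF// ltr_wpDl.
have -> : (fun s q => (velocity (shifted eps) s q).1 * shifted eps s q) = (fun s q => (j s q).1).
  by apply/funext => s; apply/funext => q; rewrite /= divfK.
have -> : (fun s q => (velocity (shifted eps) s q).2 * shifted eps s q) = (fun s q => (j s q).2).
  by apply/funext => s; apply/funext => q; rewrite /= divfK.
move=> [N N0 HN]; exists N => // t q t0 tT qb /(HN _ _ t0 tT qb)[d1 d2 d3 e].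
have dc : derivable (fun=> eps : R) t 1 by exact: derivable_cst.
split; [exact: derivableD|exact: d2|exact: d3|].
by rewrite -e; congr (_ + _ + _); rewrite !derive1E (deriveD d1 dc) derive_cst addr0.
Qed.

(** * Mass carried by trajectories against the density at time [t] *)

Section Transport.
Variables (dl K t a c M T b : R) (D : set (R * R)) (X : R -> R * R -> R * R) (g : R * R -> R).
Hypotheses (dl0 : 0 < dl) (K0 : 0 <= K) (t0 : 0 < t) (tT : t < T) (a0 : 0 <= a) (c0 : 0 <= c)
  (M0 : 0 <= M) (atb : a + t * C < b)
  (CE : continuity_on r (fun s q => (j s q).1) (fun s q => (j s q).2) T b)
  (mD : measurable D) (Dc : D `<=` square c) (X0 : forall q, D q -> X 0 q = q)
  (XD : forall q, D q -> trajectory dl K t (X^~ q))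
  (mg : measurable_fun setT (fun q : R * R => g (X t q)))
  (gM : lipschitz2 M g) (g0 : forall q, 0 <= g q) (ga : forall q, a <= `|q| -> g q = 0).

Let gB q : `|g q| <= M * (2 * a). Proof. exact: (lipschitz2_cpt_bounded M0 a0 gM ga). Qed.

Let bD : bf2 (\1_D : R * R -> R).
Proof.
apply: (@bf2_supp _ _ c 1) => //.
- by move=> q; rewrite indicE; case: (q \in D); rewrite ?normr1 ?normr0.
- move=> q; rewrite indicE; case: (boolP (q \in D)) => // /set_mem /Dc.
  by rewrite /square /= leNgt => /negP.
Qed.

Let B0 : 0 <= B. Proof. exact: le_trans (r0 0 (0, 0)) (rB _ _). Qed.

Let mr s : measurable_fun setT (r s).
Proof. exact: lipschitz2_measurable (lipschitz3_slice s rL). Qed.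

Let rN s q : `|r s q| <= B. Proof. by rewrite ger0_norm. Qed.

(** With [eps] fixed, [h] tends to zero: the Lipschitz constant of order [1 / eps] enters only terms
    that vanish with [h]. What survives is linear in [eps]: the added mass [eps * int2 g] at the
    final time, and a Gronwall error whose constant depends on [dl] alone among the two
    regularisations. *)
Let transport_eps eps : 0 < eps -> eps <= 1 ->
  int2 (fun q => \1_D q * g (X t q) * r 0 q) <= int2 (fun q => g q * r t q) +
    eps * (int2 g + M * (B + 1) * (2 * c) ^+ 2 * (expR (t * ((1 + C) * L / dl)) * (t * (C / dl)))).
Proof.
move=> e0 e1; pose La := (1 + C) * L / eps.
have La0 : 0 <= La by rewrite /La divr_ge0 ?mulr_ge0 ?addr_ge0// ltW.
pose w := velocity (shifted eps).
have dnd s q : eps <= shifted eps s q by rewrite lerDr.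
have rdn s q : r s q <= shifted eps s q by rewrite lerDl ltW.
have sL := shifted_lipschitz eps.
have wL := velocity_lipschitz e0 sL dnd rdn.
have wC := velocity_norm e0 dnd rdn.
have sg0 s q : 0 <= shifted eps s q by rewrite addr_ge0// ltW.
have sgB s q : shifted eps s q <= B + 1 by rewrite lerD.
have wj1 : (fun s q => (w s q).1 * shifted eps s q) = (fun s q => (j s q).1).
  by apply/funext => s; apply/funext => q; rewrite /= divfK// gt_eqF// (lt_le_trans e0).
have wj2 : (fun s q => (w s q).2 * shifted eps s q) = (fun s q => (j s q).2).
  by apply/funext => s; apply/funext => q; rewrite /= divfK// gt_eqF// (lt_le_trans e0).
have j1L : lipschitz3 L (fun s q => (w s q).1 * shifted eps s q) by rewrite wj1; exact: (jL true).
have j2L : lipschitz3 L (fun s q => (w s q).2 * shifted eps s q) by rewrite wj2; exact: (jL false).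
have [K1 K10 H] := euler_transport L0 La0 C0 wL wC sg0 sgB sL j1L j2L (shifted_continuity e0 CE) a0 (ltW t0) tT atb.
pose E0 := expR (t * ((1 + C) * L / dl)).
(* At least [N] steps ensure both [h * La <= 1 / 2] and [h * C <= 1]. *)
have [N hN] : exists N : nat, 2 * (t * La) + t * C <= N%:R.
  by exists (Num.truncn (2 * (t * La) + t * C)).+1; exact/ltW/truncnS_gt.
pose c1 := M * K1 + M * (B + 1) * (2 * c) ^+ 2 * (E0 * (t * K)).
have c10 : 0 <= c1 by rewrite addr_ge0// !mulr_ge0 ?addr_ge0 ?expR_ge0// ltW.
apply: (@le_of_le_add_harmonic R _ _ (c1 * t)) => n.
pose m := (n + N)%N.+1; pose h := t / m%:R.
have h0 : 0 < h by rewrite divr_gt0.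
have mh : m%:R * h = t by rewrite /h mulrC divfK// pnatr_eq0.
have hn : h <= t / n.+1%:R by rewrite ler_pM2l// lef_pV2 ?posrE// ler_nat ltnS leq_addr.
have Nm : N%:R <= m%:R :> R by rewrite ler_nat ltnW// ltnS leq_addl.
have tLa : 0 <= t * La by rewrite mulr_ge0// ltW.
have tC : 0 <= t * C by rewrite mulr_ge0// ltW.
have m0 : 0 < m%:R :> R by rewrite ltr0n.
have [hLa hC] := step_bounds (le_trans hN Nm) tLa tC m0.
rewrite mulrAC -/h in hLa; rewrite mulrAC -/h in hC.
have {}H := H g M h m M0 gM ga h0 mh hLa hC.
pose E q := euler w h m q.
have EL q q' : `|E q - E q'| <= expR (m%:R * (h * La)) * `|q - q'|.
  exact: (euler_lipschitz La0 wL m q q' (ltW h0)).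
have gEL : lipschitz2 (M * expR (m%:R * (h * La))) (fun q => g (E q)).
  by move=> q q'; apply: le_trans (gM _ _) _; rewrite -mulrA; apply: ler_wpM2l.
have mgE := lipschitz2_measurable gEL.
have ms s : measurable_fun setT (shifted eps s).
  exact: lipschitz2_measurable (lipschitz3_slice s sL).
have gE0 q : a + t * C < `|q| -> g (E q) = 0.
  move=> hq; apply: ga.
  have := euler_speed wC 0 m q (ltW h0); rewrite add0n mh -/(E q) => hs.
  have := ler_normB (E q) (E q - q); rewrite subKr => hs'.
  by rewrite -(lerD2r (t * C)); apply: le_trans (ltW hq) _; apply: le_trans hs' _; rewrite lerD2l.
have bgE : bf2 (fun q => g (E q) * shifted eps 0 q).
  apply: (bf2M (B := B + 1)) => //; last by move=> q; rewrite ger0_norm.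
  by apply: (@bf2_supp _ _ (a + t * C) (M * (2 * a))).
pose e := E0 * (t * (C * eps / dl + K * h)).
have ee0 : 0 <= e.
  rewrite mulr_ge0 ?expR_ge0//; apply: mulr_ge0; [exact: ltW|apply: addr_ge0; last by rewrite mulr_ge0// ltW].
  by apply: divr_ge0; [rewrite mulr_ge0// ltW|exact: ltW].
have bF0 : bf2 (fun q => \1_D q * g (X t q) * r 0 q).
  by apply: (bf2M (B := B)) => //; apply: (bf2M (B := M * (2 * a))) => //; exact: gB.
have bF1 : bf2 (fun q => (M * e * (B + 1)) * \1_D q) by exact: bf2Z.
(* On [D] the polygon ends within [e] of [X t q]. Off [D] the right-hand side is merely nonnegative,
   which is why an inequality is obtained. *)
have le1 : int2 (fun q => \1_D q * g (X t q) * r 0 q) <=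
    int2 (fun q => g (E q) * shifted eps 0 q) + M * e * (B + 1) * int2 \1_D.
  rewrite -(int2Z _ bD) -(int2D bgE bF1); apply: int2_le => //; first exact: bf2D.
  move=> q; rewrite indicE; have [/set_mem Dq|_] := boolP (q \in D); last first.
    by rewrite !mul0r mulr0 addr0 mulr_ge0.
  rewrite mul1r mulr1.
  have := euler_trajectory e0 dl0 K0 h0 mh (XD Dq); rewrite (X0 Dq) -/w -/(E q) -/E0 -/e => d1.
  have d2 := le_trans (gM (X t q) (E q)) (ler_wpM2l M0 _).
  have {}d2 : g (X t q) <= g (E q) + M * e.
    by rewrite -lerBlDl; apply: le_trans (ler_norm _) _; apply: d2; rewrite distrC.
  have sb := sgB 0 q; have rs := rdn 0 q; have s1 := sg0 0 q.
  apply: le_trans (ler_wpM2r (r0 0 q) d2) _; rewrite mulrDl; apply: lerD.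
    exact: ler_wpM2l.
  by apply: ler_wpM2l; [exact: mulr_ge0|exact: le_trans sb].
have i1 : int2 \1_D <= (2 * c) ^+ 2.
  apply: le_trans (ler_norm _) _; rewrite -[leRHS]mul1r; apply: int2_norm_le => //.
  - by move=> q; rewrite indicE; case: (q \in D); rewrite ?normr1 ?normr0.
  - move=> q; rewrite indicE; case: (boolP (q \in D)) => // /set_mem /Dc.
    by rewrite /square /= leNgt => /negP.
have bg : bf2 g.
  by apply: (@bf2_supp _ _ a (M * (2 * a))) => // [|q hq]; [exact: lipschitz2_measurable gM|rewrite ga// ltW].
have bgr : bf2 (fun q => g q * r t q) by apply: (bf2M (B := B)).
have e2 : int2 (fun q => g q * shifted eps t q) = int2 (fun q => g q * r t q) + eps * int2 g.
  rewrite -(int2Z _ bg) -(int2D bgr (bf2Z _ bg)); apply: eq_int2 => q; rewrite /shifted; ring.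
have [_ H1] := norm_le_bounds H.
rewrite e2 in H1; apply: le_trans le1 _.
have i2 := ler_wpM2l (mulr_ge0 (mulr_ge0 M0 ee0) (addr_ge0 B0 (@ler01 R))) i1.
have i3 := ler_wpM2l c10 hn; move: i3.
have -> : c1 * (t / n.+1%:R) = c1 * t / n.+1%:R by ring.
have -> : c1 * h = M * K1 * h + M * (B + 1) * (2 * c) ^+ 2 * (E0 * (t * (K * h))) by rewrite /c1; ring.
move: H1 i2; have -> : M * e * (B + 1) * (2 * c) ^+ 2 = eps * (M * (B + 1) * (2 * c) ^+ 2 * (E0 * (t * (C / dl)))) +
   M * (B + 1) * (2 * c) ^+ 2 * (E0 * (t * (K * h))) by rewrite /e; ring.
rewrite (mulrDr eps) -/E0.
exact: transport_arith.
Qed.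

Lemma transport_le : int2 (fun q => \1_D q * g (X t q) * r 0 q) <= int2 (fun q => g q * r t q).
Proof.
apply: (@le_of_le_add_harmonic R _ _ (int2 g + M * (B + 1) * (2 * c) ^+ 2 * (expR (t * ((1 + C) * L / dl)) * (t * (C / dl))))) => n.
rewrite [_ / n.+1%:R]mulrC; apply: transport_eps; first by rewrite invr_gt0.
by rewrite invf_le1// ler1n.
Qed.

End Transport.

End Velocity.

(** * Trajectories approaching a node *)

Section Levels.
Context d (T : measurableType d) (R : realType).
Implicit Types F : T -> R.

Lemma measurable_superlevel F c : measurable_fun setT F -> measurable [set x | c < F x].
Proof.
move=> mF; have := mF measurableT _ (measurable_itv `]c, +oo[%R).
by rewrite setTI; congr measurable; apply/seteqP; split => x; rewrite /= in_itv /= andbT.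
Qed.

Lemma measurable_superlevel_ge F c : measurable_fun setT F -> measurable [set x | c <= F x].
Proof.
move=> mF; have := mF measurableT _ (measurable_itv `[c, +oo[%R).
by rewrite setTI; congr measurable; apply/seteqP; split => x; rewrite /= in_itv /= andbT.
Qed.

Lemma measurable_sublevel F c : measurable_fun setT F -> measurable [set x | F x < c].
Proof.
move=> mF; have := mF measurableT _ (measurable_itv `]-oo, c[%R).
by rewrite setTI; congr measurable; apply/seteqP; split => x; rewrite /= in_itv.
Qed.

Lemma integral_indic_setT (m : {measure set T -> \bar R}) (A : set T) : measurable A ->
  (\int[m]_x (\1_A x)%:E = m A)%E.
Proof. by move=> mA; rewrite integral_indic// setIT. Qed.

End Levels.

Section Passage.
Context {R : realType}.

Lemma first_passage (f : R -> R) (T c Lf : R) : 0 <= T -> 0 < Lf ->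
  (forall s s', 0 <= s -> s <= T -> 0 <= s' -> s' <= T -> `|f s - f s'| <= Lf * `|s - s'|) ->
  c <= f 0 -> (exists tau, [/\ 0 <= tau, tau <= T & f tau < c]) ->
  exists u0, [/\ 0 <= u0, u0 <= T, f u0 = c & forall s, 0 <= s -> s <= u0 -> c <= f s].
Proof.
move=> T0 Lf0 fL f0 [tau [tau0 tauT ftau]].
pose E := [set s | [/\ 0 <= s, s <= T & f s <= c]].
have Etau : E tau by split => //; exact: ltW.
have Elb : has_lbound E by exists 0 => s [].
have Einf : has_inf E by split => //; exists tau.
have u0 : 0 <= inf E by apply: lb_le_inf; [exists tau|move=> s []].
have uT : inf E <= T by apply: le_trans tauT; exact: ge_inf.
have below s : 0 <= s -> s < inf E -> c < f s.
  move=> s0 su; rewrite ltNge; apply/negP => fs.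
  have : inf E <= s by apply: ge_inf => //; split => //; exact: le_trans (ltW su) uT.
  by rewrite leNgt su.
have cE : c <= f (inf E).
  have [->//|une] := eqVneq (inf E) 0.
  have up : 0 < inf E by rewrite lt_neqAle eq_sym une.
  apply/ler_addgt0Pr => e e0.
  pose s := Num.max 0 (inf E - e / Lf).
  have s0 : 0 <= s by rewrite le_max lexx.
  have su : s < inf E by rewrite gt_max up ltrBlDr ltrDl divr_gt0.
  have /norm_le_bounds[_ h1] := fL s (inf E) s0 (le_trans (ltW su) uT) u0 uT.
  have h2 := below s s0 su.
  have h3 : Lf * `|s - inf E| <= e.
    rewrite -ler_pdivlMl// mulrC distrC ger0_norm; last by rewrite subr_ge0 ltW.
    have : inf E - e / Lf <= s by rewrite le_max lexx orbT.
    by lra.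
  by lra.
have Ec : f (inf E) <= c.
  apply/ler_addgt0Pr => e e0.
  have [s Es se] := inf_adherent (divr_gt0 e0 Lf0) Einf.
  have us : inf E <= s by exact: ge_inf.
  have [s0 sT fs] := Es.
  have /norm_le_bounds[_ h1] := fL (inf E) s u0 uT s0 sT.
  have h3 : Lf * `|inf E - s| <= e.
    rewrite -ler_pdivlMl// mulrC distrC ger0_norm ?subr_ge0//.
    by move: se; lra.
  by lra.
exists (inf E); split => //; first by apply/eqP; rewrite eq_le Ec cE.
move=> s s0; rewrite le_eqVlt => /orP[/eqP ->//|su]; exact/ltW/below.
Qed.

(** The running infimum over [[0, u]], parametrised by [[0, 1]] so that the index set does not move
    with [u]; Lipschitz continuity in [u] is then inherited from [f]. *)
Definition lowest (f : R -> R * R -> R) u q : R := inf [set f (th * u) q | th in `[0, 1]%classic].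

Lemma lowest_ge f c u q : (forall s q, 0 <= f s q) -> 0 <= u ->
  c <= lowest f u q <-> (forall s, 0 <= s -> s <= u -> c <= f s q).
Proof.
move=> f0 u0; split.
  move=> cl s s0 su; apply: le_trans cl _; apply: ge_inf.
    by exists 0 => _ [th _ <-].
  have [u00|une] := eqVneq u 0.
    have -> : s = 0 by lra.
    rewrite u00.
    by exists 0; [rewrite /= in_itv /= lexx ler01|rewrite mulr0].
  have up : 0 < u by rewrite lt_neqAle eq_sym une.
  exists (s / u); last by rewrite divfK.
  by rewrite /= in_itv /= divr_ge0// ler_pdivrMr// mul1r.
move=> H; apply: lb_le_inf.
  by exists (f (0 * u) q); exists 0 => //; rewrite /= in_itv /= lexx ler01.
move=> _ [th /= + <-]; rewrite in_itv /= => /andP[th0 th1].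
by apply: H; [exact: mulr_ge0|exact: ler_piMl].
Qed.

Lemma lowest_lipschitz f Lf : 0 <= Lf -> (forall s q, 0 <= f s q) -> lipschitz3 Lf f -> lipschitz3 Lf (lowest f).
Proof.
move=> Lf0 f0 fL.
have half s s' q q' : lowest f s q - lowest f s' q' <= Lf * (`|s - s'| + `|q - q'|).
  rewrite lerBlDr -lerBlDl; apply: lb_le_inf.
    by exists (f (0 * s') q'); exists 0 => //; rewrite /= in_itv /= lexx ler01.
  move=> _ [th /= thI <-]; have := thI; rewrite in_itv /= => /andP[th0 th1].
  have h1 : lowest f s q <= f (th * s) q.
    by apply: ge_inf; [exists 0 => _ [? _ <-]|exists th].
  rewrite lerBlDl; apply: le_trans h1 _; rewrite -lerBlDr.
  apply: le_trans (ler_norm _) _; apply: le_trans (fL _ _ _ _) _.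
  apply: ler_wpM2l => //; rewrite lerD2r -mulrBr normrM ger0_norm//.
  by rewrite ler_piMl.
move=> s s' q q'; rewrite ler_norml; apply/andP; split; last exact: half.
by rewrite lerNl opprB distrC (distrC q); exact: half.
Qed.

(** A Lipschitz bump on density values: zero outside []dl, 2 * dl[] and at least [1 / 2] on the
    middle half of that interval. *)
Definition tent (dl x : R) : R := Num.max 0 (1 - `|x - 3 / 2 * dl| * (2 / dl)).

Lemma tent_ge0 dl x : 0 <= tent dl x.
Proof. by rewrite /tent le_max lexx. Qed.

Lemma tent_le1 dl x : 0 < dl -> tent dl x <= 1.
Proof.
by move=> d0; rewrite /tent ge_max ler01 /= lerBlDr lerDl mulr_ge0// divr_ge0// ltW.
Qed.

Lemma tent_lipschitz dl x y : 0 < dl -> `|tent dl x - tent dl y| <= 2 / dl * `|x - y|.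
Proof.
move=> d0; apply: le_trans (maxr_dist _ _ _) _.
have -> : 1 - `|x - 3 / 2 * dl| * (2 / dl) - (1 - `|y - 3 / 2 * dl| * (2 / dl)) =
  (`|y - 3 / 2 * dl| - `|x - 3 / 2 * dl|) * (2 / dl) by ring.
rewrite normrM mulrC.
rewrite (@ger0_norm _ (2 / dl)); last by rewrite divr_ge0// ltW.
apply: ler_wpM2l; first by rewrite divr_ge0// ltW.
apply: le_trans (ler_dist_dist _ _) _; rewrite distrC.
by have -> : x - 3 / 2 * dl - (y - 3 / 2 * dl) = x - y by ring.
Qed.

Lemma tent_supp dl x : 0 < dl -> 2 * dl <= x -> tent dl x = 0.
Proof.
move=> d0 hx; apply/max_idPl; rewrite subr_le0.
have h : dl / 2 <= `|x - 3 / 2 * dl| by apply: le_trans (ler_norm _); lra.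
have e : 1 = dl / 2 * (2 / dl) :> R by field; rewrite gt_eqF.
by rewrite [leLHS]e; apply: ler_wpM2r => //; rewrite divr_ge0// ltW.
Qed.

Lemma tent_supp_low dl x : 0 < dl -> x <= 0 -> tent dl x = 0.
Proof.
move=> d0 hx; apply/max_idPl; rewrite subr_le0.
have h : dl / 2 <= `|x - 3 / 2 * dl| by rewrite distrC; apply: le_trans (ler_norm _); lra.
have e : 1 = dl / 2 * (2 / dl) :> R by field; rewrite gt_eqF.
by rewrite [leLHS]e; apply: ler_wpM2r => //; rewrite divr_ge0// ltW.
Qed.

Lemma tent_half dl x : 0 < dl -> `|x - 3 / 2 * dl| <= dl / 4 -> 1 / 2 <= tent dl x.
Proof.
move=> d0 h; rewrite /tent le_max; apply/orP; right.
have : `|x - 3 / 2 * dl| * (2 / dl) <= dl / 4 * (2 / dl).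
  by apply: ler_wpM2r => //; rewrite divr_ge0// ltW.
have -> : dl / 4 * (2 / dl) = 1 / 2 :> R by field; rewrite gt_eqF.
by lra.
Qed.

Definition cutoff (c : R) (q : R * R) : R := Num.max 0 (Num.min 1 (c - `|q|)).

Lemma cutoff_ge0 c q : 0 <= cutoff c q.
Proof. by rewrite /cutoff le_max lexx. Qed.

Lemma cutoff_le1 c q : cutoff c q <= 1.
Proof. by rewrite /cutoff ge_max ler01 ge_min lexx. Qed.

Lemma cutoff_supp c q : c <= `|q| -> cutoff c q = 0.
Proof. by move=> h; apply/max_idPl; rewrite ge_min subr_le0 h orbT. Qed.

Lemma cutoff1 c q : `|q| <= c - 1 -> cutoff c q = 1.
Proof.
move=> h; have h1 : 1 <= c - `|q| by lra.
by rewrite /cutoff (min_idPl h1); apply/max_idPr.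
Qed.

Lemma cutoff_lipschitz c : lipschitz2 1 (cutoff c).
Proof.
move=> p q; apply: le_trans (maxr_dist _ _ _) _; rewrite mul1r.
apply: le_trans (minr_dist _ _ _) _; rewrite opprB addrCA addrAC subrr add0r distrC.
by apply: le_trans (ler_dist_dist _ _) _.
Qed.

End Passage.

(** * The flow of the capped velocity and the time spent near the nodes *)

Section CappedFlow.
Context {R : realType}.
Variables (r : R -> R * R -> R) (j : R -> R * R -> R * R) (L C B : R).
Hypotheses (L0 : 0 <= L) (C0 : 0 <= C) (rL : lipschitz3 L r)
  (jL : forall b, lipschitz3 L (fun s q => cd b (j s q)))
  (r0 : forall s q, 0 <= r s q) (rB : forall s q, r s q <= B)
  (jC : forall b s q, `|cd b (j s q)| <= C * r s q).

Definition capped_flow (dl : R) (X : R -> R * R -> R * R) :=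
  [/\ forall q, X 0 q = q,
      forall s s' q, 0 <= s -> 0 <= s' -> `|X s' q - X s q| <= C * `|s' - s|,
      forall s s' q b, 0 <= s -> 0 <= s' ->
        `|cd b (X s' q) - cd b (X s q) - (s' - s) * (cd b (j s (X s q)) / capped r dl s (X s q))|
        <= 2 * ((1 + C) * L / dl * (1 + C)) * (s' - s) ^+ 2,
      forall s q q', 0 <= s -> `|X s q - X s q'| <= expR (s * ((1 + C) * L / dl)) * `|q - q'|
    & (forall s x, (j s (x, x)).1 = (j s (x, x)).2) ->
      forall s q, 0 <= s -> q.1 < q.2 -> (X s q).1 < (X s q).2].

Lemma capped_flow_exists dl : 0 < dl -> exists X, capped_flow dl X.
Proof.
move=> dl0.
have dnd s q : dl <= capped r dl s q by rewrite /capped le_max lexx.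
have rdn s q : r s q <= capped r dl s q by rewrite /capped le_max lexx orbT.
have La0 : 0 <= (1 + C) * L / dl by rewrite divr_ge0 ?mulr_ge0 ?addr_ge0// ltW.
have [X [X0 XC XK XL Xd]] := cauchy_lipschitz La0 C0
  (velocity_lipschitz C0 jL jC dl0 (capped_lipschitz rL dl) dnd rdn) (velocity_norm C0 jC dl0 dnd rdn).
exists X; split => //.
- by move=> s s' q b s0 s'0; have := XK s s' q b s0 s'0; rewrite cd_velocity.
- by move=> jd; apply: Xd => s x; rewrite /velocity /= jd.
Qed.

Variables (dl : R) (X : R -> R * R -> R * R) (T : R).
Hypotheses (dl0 : 0 < dl) (FX : capped_flow dl X) (T0 : 0 <= T).

Definition clampt (u : R) : R := Num.max 0 (Num.min u T).

Lemma clampt_id u : 0 <= u -> u <= T -> clampt u = u.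
Proof. by move=> u0 uT; rewrite /clampt (min_idPl uT); apply/max_idPr. Qed.

Lemma clampt_ge0 u : 0 <= clampt u.
Proof. by rewrite /clampt le_max lexx. Qed.

Lemma clampt_le u : clampt u <= T.
Proof. by rewrite /clampt ge_max T0 ge_min lexx orbT. Qed.

Lemma clampt_dist u u' : `|clampt u - clampt u'| <= `|u - u'|.
Proof.
apply: le_trans (maxr_dist _ _ _) _; have T0' := T0.
have := ler_norm (u - u'); have := ler_norm (u' - u); rewrite (distrC u' u).
case: (leP u T) => ?; case: (leP u' T) => ? ? ?; apply: bounds_norm_le; lra.
Qed.

Definition density u q := r (clampt u) (X (clampt u) q).

Definition density_const := L * (1 + C) + L * (expR (T * ((1 + C) * L / dl))) + 1.

Let La0 : 0 <= (1 + C) * L / dl. Proof. by rewrite divr_ge0 ?mulr_ge0 ?addr_ge0// ltW. Qed.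

Lemma density_const_ge0 : 0 <= density_const.
Proof. by rewrite /density_const !addr_ge0// ?mulr_ge0// ?addr_ge0// expR_ge0. Qed.

(** This constant comes from the speed bound [C] and is free of [dl], contrary to [density_const].
    It governs the time spent near a node, while [density_const] serves measurability. *)
Lemma density_time s s' q : `|density s q - density s' q| <= L * (1 + C) * `|s - s'|.
Proof.
have [_ XC _ _ _] := FX.
apply: le_trans (rL _ _ _ _) _; rewrite -mulrA; apply: ler_wpM2l => //.
have h := XC _ _ q (clampt_ge0 s') (clampt_ge0 s).
have h2 := clampt_dist s s'.
rewrite mulrDl mul1r; apply: lerD => //; apply: le_trans h _.
exact: ler_wpM2l.
Qed.

Lemma density_lipschitz : lipschitz3 density_const density.
Proof.
have [_ _ _ XL _] := FX.
move=> s s' q q'.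
rewrite -(subrKA (density s' q)); apply: le_trans (ler_normD _ _) _.
rewrite mulrDr; apply: lerD.
  apply: le_trans (density_time _ _ _) _; apply: ler_wpM2r => //.
  by rewrite /density_const -addrA lerDl addr_ge0// mulr_ge0// expR_ge0.
apply: le_trans (rL _ _ _ _) _; rewrite subrr normr0 add0r.
apply: le_trans (ler_wpM2l L0 (XL _ _ _ (clampt_ge0 _))) _; rewrite mulrA.
apply: ler_wpM2r => //.
rewrite /density_const (addrC (L * (1 + C))) -addrA.
apply: (@le_trans _ _ (L * expR (T * ((1 + C) * L / dl)))).
  apply: ler_wpM2l => //; rewrite ler_expR; apply: ler_wpM2r => //; exact: clampt_le.
by rewrite lerDl addr_ge0// mulr_ge0// addr_ge0.
Qed.

Lemma density_ge0 u q : 0 <= density u q. Proof. exact: r0. Qed.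

Lemma densityE u q : 0 <= u -> u <= T -> density u q = r u (X u q).
Proof. by move=> u0 uT; rewrite /density clampt_id. Qed.

Lemma flow_trajectory u q : u <= T -> (forall s, 0 <= s -> s <= u -> dl <= r s (X s q)) ->
  trajectory r j dl (2 * ((1 + C) * L / dl * (1 + C))) u (X^~ q).
Proof.
move=> uT H; split => // s s' b s0 ss' s'u.
have [_ _ XK _ _] := FX.
have := XK s s' q b s0 (le_trans s0 ss').
by rewrite /capped (max_idPr _)//; apply: H => //; exact: le_trans s'u.
Qed.

Lemma flow_norm s q : 0 <= s -> `|X s q| <= `|q| + s * C.
Proof.
move=> s0; have [X0 XC _ _ _] := FX.
rewrite -{1}(subrK q (X s q)) addrC; apply: le_trans (ler_normD _ _) _; rewrite lerD2l.
by have := XC 0 s q (lexx 0) s0; rewrite X0 subr0 (ger0_norm s0) mulrC.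
Qed.

(** [u0] is the first time at which the density equals [3 / 2 * dl]. Varying at rate at most
    [L * (1 + C) + 1], the density then stays within [dl / 4] of this value for the stated time, and
    up to then it has not gone below [dl]: the passage is visible while the path is still a genuine
    trajectory. *)
Lemma passage_time q : 2 * dl <= r 0 q ->
  (exists tau, [/\ 0 <= tau, tau <= T & density tau q < dl]) ->
  exists u0, [/\ 0 <= u0, u0 + dl / (4 * (L * (1 + C) + 1)) <= T &
    forall u, u0 <= u -> u <= u0 + dl / (4 * (L * (1 + C) + 1)) ->
     dl <= lowest density u q /\ 1 / 2 <= tent dl (density u q)].
Proof.
move=> rq [tau [tau0 tauT ftau]]; have dl0' := dl0.
have [X0 _ _ _ _] := FX.
set L' := L * (1 + C) + 1; set l := dl / (4 * L').
have L'0 : 0 < L' by rewrite ltr_wpDl// mulr_ge0// addr_ge0.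
have fL s s' : 0 <= s -> s <= T -> 0 <= s' -> s' <= T -> `|density s q - density s' q| <= L' * `|s - s'|.
  by move=> _ _ _ _; apply: le_trans (density_time _ _ _) _; apply: ler_wpM2r => //; rewrite lerDl.
have f0 : 3 / 2 * dl <= density 0 q by rewrite densityE// X0; lra.
have ftau' : exists tau, [/\ 0 <= tau, tau <= T & density tau q < 3 / 2 * dl].
  by exists tau; split => //; lra.
have [u0 [u00 u0T fu0 below]] := first_passage T0 L'0 fL f0 ftau'.
have l0 : 0 < l by rewrite divr_gt0// mulr_gt0.
have Ll : L' * l = dl / 4 by rewrite /l; field; rewrite gt_eqF.
have utau : u0 < tau.
  by rewrite ltNge; apply/negP => h; have := below _ tau0 h; lra.
have lT : u0 + l <= T.
  apply: (le_trans _ tauT); rewrite -lerBrDl.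
  have /norm_le_bounds[_] := fL u0 tau u00 u0T tau0 tauT.
  rewrite fu0 distrC ger0_norm ?subr_ge0 ?(ltW utau)// => h.
  by rewrite -(ler_pM2l L'0) Ll; lra.
have near u : u0 <= u -> u <= u0 + l -> `|density u q - 3 / 2 * dl| <= dl / 4.
  move=> h1 h2; rewrite -fu0; apply: le_trans (fL _ _ _ _ u00 u0T) _.
  - exact: le_trans h1.
  - exact: le_trans lT.
  by rewrite ger0_norm ?subr_ge0// -Ll; apply: ler_wpM2l; [exact: ltW|rewrite lerBlDl].
exists u0; split => // u h1 h2; split; last by apply: tent_half => //; exact: near.
apply/lowest_ge; [exact: density_ge0|exact: le_trans h1|] => s s0 su.
have [h|h] := leP s u0; first by have := below s s0 h; lra.
have /norm_le_bounds[] := near s (ltW h) (le_trans su h2).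
by lra.
Qed.

Lemma measurable_density : measurable_fun setT (fun p : R * (R * R) => density p.1 p.2).
Proof. exact: lipschitz3_measurable density_lipschitz. Qed.

Lemma measurable_lowest : measurable_fun setT (fun p : R * (R * R) => lowest density p.1 p.2).
Proof.
by apply: lipschitz3_measurable; exact: (lowest_lipschitz density_const_ge0 density_ge0 density_lipschitz).
Qed.

Lemma int2E (F : R * R -> R) : bf2 F -> (\int[@leb2 R]_q (F q)%:E)%E = (int2 F)%:E.
Proof.
move=> bF; rewrite /int2 /Rintegral fineK//; apply: integrable_fin_num => //.
exact: bounded_finite_integrable.
Qed.

Lemma space_fubini (F : R * (R * R) -> R) : measurable_fun setT F -> (forall p, 0 <= F p) ->
  (\int[@space_measure R]_p (F p)%:E = \int[@lebesgue_measure R]_u \int[@leb2 R]_q (F (u, q))%:E)%E.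
Proof.
move=> mF F0.
have mF' : measurable_fun setT (EFin \o F) by exact/measurable_EFinP.
by apply: (@fubini_tonelli1 _ _ _ _ R (@lebesgue_measure R) (@plane_measure R) (EFin \o F) mF') => p; rewrite lee_fin.
Qed.

Lemma space_exchange (F : R * (R * R) -> R) : measurable_fun setT F -> (forall p, 0 <= F p) ->
  (\int[@lebesgue_measure R]_u \int[@leb2 R]_q (F (u, q))%:E
   = \int[@leb2 R]_q \int[@lebesgue_measure R]_u (F (u, q))%:E)%E.
Proof.
move=> mF F0.
have mF' : measurable_fun setT (EFin \o F) by exact/measurable_EFinP.
by apply: (@fubini_tonelli _ _ _ _ R (@lebesgue_measure R) (@plane_measure R) (EFin \o F) mF') => p; rewrite lee_fin.
Qed.

Lemma space_inner_measurable (F : R * (R * R) -> R) : measurable_fun setT F -> (forall p, 0 <= F p) ->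
  measurable_fun setT (fun u : R => \int[@leb2 R]_q (F (u, q))%:E)%E.
Proof.
move=> mF F0.
have mF' : measurable_fun setT (EFin \o F) by exact/measurable_EFinP.
by apply: (@measurable_fun_fubini_tonelli_F _ _ _ _ R (@plane_measure R) (EFin \o F) mF') => p; rewrite lee_fin.
Qed.

Lemma space_inner_measurable2 (F : R * (R * R) -> R) : measurable_fun setT F -> (forall p, 0 <= F p) ->
  measurable_fun setT (fun q : R * R => \int[@lebesgue_measure R]_u (F (u, q))%:E)%E.
Proof.
move=> mF F0.
have mF' : measurable_fun setT (EFin \o F) by exact/measurable_EFinP.
by apply: (@measurable_fun_fubini_tonelli_G _ _ _ _ R (@lebesgue_measure R) (EFin \o F) mF') => p; rewrite lee_fin.
Qed.

Section NodeEstimate.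
Variables (a T' b : R).
Hypotheses (a0 : 0 <= a) (TT' : T < T') (atb : a + 2 * (T * C) + 1 < b)
  (CE : continuity_on r (fun s q => (j s q).1) (fun s q => (j s q).2) T' b).

Definition low_region (a2 : R) : set (R * (R * R)) :=
  `]0, T]%classic `*` square a2 `&` [set p | 0 < r p.1 p.2] `&` [set p | r p.1 p.2 < 2 * dl].

Definition reaches_low : set (R * R) :=
  square a `&` [set q | 2 * dl <= r 0 q] `&` [set q | lowest density T q < dl].

Let a2 := a + T * C + 1.
Let a20 : 0 <= a2. Proof. by rewrite /a2 !addr_ge0// mulr_ge0. Qed.

Let mr3 : measurable_fun setT (fun p : R * (R * R) => r p.1 p.2).
Proof. exact: lipschitz3_measurable rL. Qed.

Let mr s : measurable_fun setT (r s).
Proof. exact: lipschitz2_measurable (lipschitz3_slice s rL). Qed.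

Lemma measurable_low_region c : measurable (low_region c).
Proof.
apply: measurableI; first apply: measurableI.
- by apply: measurableX => //; exact: measurable_square.
- exact: measurable_superlevel.
- exact: measurable_sublevel.
Qed.

Lemma low_region_fin c : (@space_measure R (low_region c) < +oo)%E.
Proof.
pose P := (`[0, T]%classic `*` square c) : set (R * (R * R)).
have mP : measurable P by apply: measurableX => //; exact: measurable_square.
have Pfin : (@space_measure R P < +oo)%E.
  have -> : @space_measure R P = (@lebesgue_measure R `[0%R, T]%classic * @plane_measure R (square c))%E.
    exact: (@product_measure1E _ _ _ _ R (@lebesgue_measure R) (@plane_measure R) _ _ (measurable_itv _) (@measurable_square R c)).
  apply: lte_mul_pinfty => //; last exact: leb2_square_fin.
  by rewrite ge0_fin_numE//; exact: lebesgue_segment_fin.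
apply: le_lt_trans Pfin; apply: le_measure; rewrite ?inE//; first exact: measurable_low_region.
move=> [u q] /= [[[/= + hq] _] _]; rewrite !in_itv /= => /andP[u0 uT]; split => //=.
by rewrite in_itv /= (ltW u0).
Qed.

Lemma measurable_reaches_low : measurable reaches_low.
Proof.
apply: measurableI; first apply: measurableI.
- exact: measurable_square.
- exact: measurable_superlevel_ge.
- apply: measurable_sublevel; exact: measurableT_comp measurable_lowest (pair1_measurable T).
Qed.

Let S := square a `&` [set q | 2 * dl <= r 0 q].
Let A : set (R * (R * R)) := (`]0, T]%classic `*` S) `&` [set p | dl <= lowest density p.1 p.2].
(** Initial mass whose path has kept its density above [dl] up to the current time, weighted by
    [tent] of the current density. Integrating in space first gives the upper bound [slab], in time
    first the lower bound [dwell]. *)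
Let W (p : R * (R * R)) : R := \1_A p * (tent dl (density p.1 p.2) * r 0 p.2).

Let mA : measurable A.
Proof.
apply: measurableI; first apply: measurableX => //.
  by apply: measurableI; [exact: measurable_square|exact: measurable_superlevel_ge].
exact: measurable_superlevel_ge measurable_lowest.
Qed.

Let mtent : measurable_fun setT (tent dl).
Proof. by apply: (@lipschitz_line_measurable R (2 / dl)) => x y; exact: tent_lipschitz. Qed.

Let mW : measurable_fun setT W.
Proof.
apply: measurable_funM; first exact: measurable_indic.
apply: measurable_funM; first exact: measurableT_comp mtent measurable_density.
by apply: (measurableT_comp (f := r 0)) => //; exact: measurable_snd.
Qed.

Let W0 p : 0 <= W p.
Proof. by rewrite /W !mulr_ge0// ?tent_ge0// indicE. Qed.

(** The paths concerned are trajectories up to time [u], so [transport_le] bounds the integral by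
    that of [tent dl (r u q) * r u q], which is supported where [0 < r < 2 * dl] and is at most
    [2 * dl]. The cutoff equals one at every point reached from [square a] and makes the test
    function compactly supported. *)
Let slab u : 0 < u -> u <= T ->
  (\int[@leb2 R]_q (W (u, q))%:E <= \int[@leb2 R]_q (2 * dl * \1_(low_region a2) (u, q))%:E)%E.
Proof.
move=> u0 uT; have [X0 XC XK XL _] := FX; have dl0' := dl0.
pose D := S `&` [set q | dl <= lowest density u q].
have mS : measurable S by apply: measurableI; [exact: measurable_square|exact: measurable_superlevel_ge].
have mlow : measurable_fun setT (lowest density u) by exact: measurableT_comp measurable_lowest (pair1_measurable u).
have mD : measurable D by apply: measurableI => //; exact: measurable_superlevel_ge.
have Da : D `<=` square a by move=> q [[]].
pose g q := tent dl (r u q) * cutoff a2 q.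
pose M := 2 / dl * L + 1.
have dd0 : 0 <= 2 / dl by rewrite divr_ge0// ltW.
have M0 : 0 <= M by rewrite addr_ge0// mulr_ge0.
have gM : lipschitz2 M g.
  move=> p q; rewrite /g.
  have -> : tent dl (r u p) * cutoff a2 p - tent dl (r u q) * cutoff a2 q =
    (tent dl (r u p) - tent dl (r u q)) * cutoff a2 p + tent dl (r u q) * (cutoff a2 p - cutoff a2 q) by ring.
  apply: le_trans (ler_normD _ _) _; rewrite [leRHS](mulrDl (2 / dl * L)); apply: lerD.
    rewrite normrM (ger0_norm (cutoff_ge0 _ _)).
    apply: le_trans (ler_piMr (normr_ge0 _) (cutoff_le1 _ _)) _.
    apply: le_trans (tent_lipschitz _ _ dl0) _; rewrite -(mulrA _ L); apply: ler_wpM2l => //.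
    by have := rL u u p q; rewrite subrr normr0 add0r.
  rewrite normrM (ger0_norm (tent_ge0 _ _)); apply: le_trans (ler_piMl (normr_ge0 _) (tent_le1 _ dl0)) _.
  exact: cutoff_lipschitz.
have g0 q : 0 <= g q by rewrite mulr_ge0 ?tent_ge0 ?cutoff_ge0.
have ga q : a2 <= `|q| -> g q = 0 by move=> hq; rewrite /g cutoff_supp// mulr0.
have uC : u * C <= T * C by apply: ler_wpM2r.
have abu : a2 + u * C < b by rewrite /a2; move: atb uC; rewrite mulrDl mul1r; set x := T * C; set y := u * C; lra.
have mg : measurable_fun setT (fun q : R * R => g (X u q)).
  apply: (@lipschitz2_measurable R (M * expR (u * ((1 + C) * L / dl)))) => p q.
  by apply: le_trans (gM _ _) _; rewrite -(mulrA M); apply: ler_wpM2l => //; exact/XL/ltW.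
have XD q : D q -> trajectory r j dl (2 * ((1 + C) * L / dl * (1 + C))) u (X^~ q).
  move=> [_ /= /(@lowest_ge _ _ dl u q density_ge0 (ltW u0)) h]; apply: flow_trajectory => // s s0 su.
  by have := h s s0 su; rewrite densityE//; exact: le_trans uT.
have K0 : 0 <= 2 * ((1 + C) * L / dl * (1 + C)) by rewrite mulr_ge0// mulr_ge0// addr_ge0.
have := transport_le L0 C0 rL jL r0 rB jC dl0 K0 u0 (le_lt_trans uT TT') a20 a0 M0 abu CE mD Da (fun q _ => X0 q) XD mg gM g0 ga.
have gB : forall q, `|g q| <= M * (2 * a2) by exact: lipschitz2_cpt_bounded.
have rN s q : `|r s q| <= B by rewrite ger0_norm.
have bD : bf2 (\1_D : R * R -> R).
  apply: (@bf2_supp _ _ a 1) => //.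
  - by move=> q; rewrite indicE; case: (q \in D); rewrite ?normr1 ?normr0.
  - move=> q; rewrite indicE; case: (boolP (q \in D)) => // /set_mem /Da.
    by rewrite /square /= leNgt => /negP.
have b1 : bf2 (fun q => \1_D q * g (X u q) * r 0 q).
  by apply: (bf2M (B := B)) => //; apply: (bf2M (B := M * (2 * a2))).
have b2 : bf2 (fun q => g q * r u q).
  apply: (bf2M (B := B)) => //; apply: (@bf2_supp _ _ a2 (M * (2 * a2))) => // [|q hq].
    exact: lipschitz2_measurable gM.
  by rewrite ga// ltW.
rewrite -lee_fin -!int2E// => h.
rewrite (_ : (fun q => (W (u, q))%:E) = (fun q => (\1_D q * g (X u q) * r 0 q)%:E)); last first.
  apply/funext => q; congr (_%:E); rewrite /W /= mulrA; congr (_ * _).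
  rewrite !indicE; have [/set_mem Dq|nD] := boolP (q \in D); last first.
    rewrite !mul0r memNset ?mul0r//; move=> [[_ h1] h2]; move/negP: nD; apply; apply/mem_set; split => //.
  rewrite mem_set; last by case: Dq => h1 h2; split => //; split => //=; rewrite in_itv /= u0.
  rewrite !mul1r /g cutoff1 ?mulr1.
    by rewrite densityE// ltW.
  rewrite /a2 addrK; apply: le_trans (flow_norm _ (ltW u0)) _; apply: lerD => //; exact: Da.
apply: le_trans h _; apply: ge0_le_integral => //.
- by move=> q _; rewrite lee_fin mulr_ge0.
- by apply/measurable_EFinP; exact: bf2_measurable b2.
- apply/measurable_EFinP; apply: measurable_funM; first exact: measurable_cst.
  have := @measurable_indic _ _ R setT _ (measurable_low_region a2) => mi.
  exact: measurableT_comp mi (pair1_measurable u).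
move=> q _; rewrite lee_fin.
have [h|/negP h] := boolP ((u, q) \in low_region a2).
  rewrite indicE h mulr1; move/set_mem : h => [[_ /= _] /= h].
  rewrite -[leRHS]mul1r; apply: ler_pM => //; last exact: ltW.
  by rewrite /g -[leRHS]mul1r; apply: ler_pM; rewrite ?tent_ge0 ?cutoff_ge0 ?tent_le1 ?cutoff_le1.
rewrite indicE (negbTE (introN idP h)) mulr0.
have [hq|hq] := leP a2 `|q|; first by rewrite ga// mul0r.
have [h1|h1] := leP (r u q) 0; first by rewrite /g tent_supp_low// !mul0r.
have [h2|h2] := leP (2 * dl) (r u q); first by rewrite /g tent_supp// !mul0r.
exfalso; apply: h; apply/mem_set; split => //; split => //; split => //=; last exact: ltW.
by rewrite in_itv /= u0.
Qed.

(** The constant is [1 / 2], the lower bound of [tent] during the passage, times the duration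
    granted by [passage_time]. *)
Let dwell q : (( \1_reaches_low q * r 0 q * (dl / (8 * (L * (1 + C) + 1))))%:E <=
  \int[@lebesgue_measure R]_u (W (u, q))%:E)%E.
Proof.
rewrite indicE; have [/set_mem [[qa rq] low]|_] := boolP (q \in reaches_low); last first.
  by rewrite !mul0r; apply: integral_ge0 => u _; rewrite lee_fin.
have dl0' := dl0.
have [tau [tau0 tauT ltau]] : exists tau, [/\ 0 <= tau, tau <= T & density tau q < dl].
  apply: contrapT => H; move: low; rewrite /= ltNge => /negP; apply.
  apply/lowest_ge => //; first exact: density_ge0.
  by move=> s s0 sT; rewrite leNgt; apply/negP => h; apply: H; exists s.
have [u0 [u00 u0T H]] := passage_time rq (ex_intro _ tau (And3 tau0 tauT ltau)).
set l := dl / (4 * (L * (1 + C) + 1)) in u0T H.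
have L'0 : 0 < L * (1 + C) + 1 by rewrite ltr_wpDl// mulr_ge0// addr_ge0.
have l0 : 0 < l by rewrite divr_gt0// mulr_gt0.
have -> : 1%:R * r 0 q * (dl / (8 * (L * (1 + C) + 1))) = (1 / 2 * r 0 q) * (u0 + l - u0).
  by rewrite /l; field; rewrite gt_eqF.
have m1 : @lebesgue_measure R `]u0, (u0 + l)]%classic = (u0 + l - u0)%:E.
  by rewrite lebesgue_measure_itv /= lte_fin ltrDl l0 -EFinB.
have -> : ((1 / 2 * r 0 q) * (u0 + l - u0))%:E =
    (\int[@lebesgue_measure R]_u (1 / 2 * r 0 q * \1_(`]u0, (u0 + l)]%classic : set R) u)%:E)%E.
  under [RHS]eq_integral do rewrite EFinM.
  rewrite ge0_integralZl_EFin//.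
  - by rewrite integral_indic// setIT [X in (_ * X)%E]m1 EFinM.
  - by apply/measurable_EFinP; exact: measurable_indic.
  - by rewrite mulr_ge0// divr_ge0.
apply: ge0_le_integral => //.
- by move=> u _; rewrite lee_fin mulr_ge0// mulr_ge0// divr_ge0.
- apply/measurable_EFinP; apply: measurable_funM; first exact: measurable_cst.
  exact: measurable_indic.
- apply/measurable_EFinP; exact: measurableT_comp mW (pair2_measurable q).
move=> u _; rewrite lee_fin [\1_ _ u]indicE.
have [|] := boolP (u \in (`]u0, (u0 + l)]%classic : set R)); last by rewrite mulr0.
move=> /set_mem; rewrite /= in_itv /= => /andP[u1 u2].
have [h1 h2] := H u (ltW u1) u2.
rewrite mulr1 /W indicE mem_set; last first.
  split => //; split => //=; rewrite in_itv /= (le_lt_trans u00 u1)/=.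
  exact: le_trans u0T.
by rewrite [leRHS]mul1r /=; apply: ler_wpM2r.
Qed.

(** The factor [2 * dl] of [slab] is cancelled by the factor [dl] of the dwell time. What is left is
    the volume of [low_region], with a constant free of [dl]. *)
Lemma node_estimate : int2 (fun q => \1_reaches_low q * r 0 q) <=
  16 * (L * (1 + C) + 1) * fine (@space_measure R (low_region (a + T * C + 1))).
Proof.
have dl0' := dl0.
have L'0 : 0 < L * (1 + C) + 1 by rewrite ltr_wpDl// mulr_ge0// addr_ge0.
have ml := measurable_reaches_low.
have brl : bf2 (fun q => \1_reaches_low q * r 0 q).
  apply: (bf2M (B := B)) => //; last by move=> q; rewrite ger0_norm.
  apply: (@bf2_supp _ _ a 1) => //.
  - by move=> q; rewrite indicE; case: (q \in reaches_low); rewrite ?normr1 ?normr0.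
  - move=> q; rewrite indicE; case: (boolP (q \in reaches_low)) => // /set_mem [[]].
    by rewrite /square /= leNgt => /negP.
have lo : ((int2 (fun q => \1_reaches_low q * r 0 q * (dl / (8 * (L * (1 + C) + 1)))))%:E <=
    \int[@leb2 R]_q \int[@lebesgue_measure R]_u (W (u, q))%:E)%E.
  rewrite -int2E; last first.
    rewrite (_ : (fun _ => _) = fun q => dl / (8 * (L * (1 + C) + 1)) * (\1_reaches_low q * r 0 q)); first exact: bf2Z.
    by apply/funext => q; rewrite mulrC.
  apply: ge0_le_integral => //.
  - move=> q _; rewrite lee_fin; apply: mulr_ge0; first by rewrite mulr_ge0 ?indicE.
    by apply: divr_ge0; [exact: ltW|rewrite mulr_ge0// ltW].
  - apply/measurable_EFinP; apply: measurable_funM; last exact: measurable_cst.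
    exact: bf2_measurable brl.
  - exact: space_inner_measurable2.
have hi : (\int[@lebesgue_measure R]_u \int[@leb2 R]_q (W (u, q))%:E <=
    (2 * dl)%:E * @space_measure R (low_region a2))%E.
  have mlr := measurable_low_region a2.
  have mE : measurable_fun setT (fun p : R * (R * R) => 2 * dl * \1_(low_region a2) p).
    by apply: measurable_funM; [exact: measurable_cst|exact: measurable_indic].
  have E0 p : 0 <= 2 * dl * \1_(low_region a2) p by rewrite mulr_ge0 ?indicE// mulr_ge0// ltW.
  have -> : ((2 * dl)%:E * @space_measure R (low_region a2) =
     \int[@space_measure R]_p (2 * dl * \1_(low_region a2) p)%:E)%E.
    under [RHS]eq_integral do rewrite EFinM.
    rewrite ge0_integralZl_EFin//.
    - by congr (_ * _)%E; apply: esym; exact: (@integral_indic_setT _ _ R (@space_measure R)).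
    - by apply/measurable_EFinP; exact: measurable_indic.
    - by rewrite mulr_ge0// ltW.
  rewrite (space_fubini mE E0); apply: ge0_le_integral => //.
  - by move=> u _; apply: integral_ge0 => q _; rewrite lee_fin.
  - exact: (space_inner_measurable mW W0).
  - exact: (space_inner_measurable mE E0).
  move=> u _; have [u0|u0] := ltP 0 u; last first.
    rewrite integral0_eq; first by apply: integral_ge0 => q _; rewrite lee_fin.
    move=> q _; rewrite /W indicE memNset ?mul0r// => -[[/= + _] _].
    by rewrite in_itv /= ltNge u0.
  have [uT|uT] := leP u T; first exact: slab.
  rewrite integral0_eq; first by apply: integral_ge0 => q _; rewrite lee_fin.
  move=> q _; rewrite /W indicE memNset ?mul0r// => -[[/= + _] _].
  by rewrite in_itv /= [X in _ && X]leNgt uT andbF.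
have := le_trans lo _; rewrite -(space_exchange mW W0) => /(_ _ hi).
have ff : @space_measure R (low_region a2) \is a fin_num by rewrite ge0_fin_numE// low_region_fin.
rewrite -/a2 -(fineK ff) -EFinM lee_fin fineK//.
set v := fine _.
rewrite (_ : (fun _ => _) = fun q => dl / (8 * (L * (1 + C) + 1)) * (\1_reaches_low q * r 0 q)); last first.
  by apply/funext => q; rewrite mulrC.
rewrite int2Z// => h.
have e : 2 * dl * v = dl / (8 * (L * (1 + C) + 1)) * (16 * (L * (1 + C) + 1) * v).
  by field; rewrite gt_eqF.
rewrite e in h; move: h; rewrite ler_pM2l// divr_gt0// mulr_gt0//.
Qed.

End NodeEstimate.

End CappedFlow.

(** * Almost no trajectory reaches a node *)

Section NodeNull.
Context {R : realType}.
Variables (r : R -> R * R -> R) (j : R -> R * R -> R * R) (L C B : R).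
Hypotheses (L0 : 0 <= L) (C0 : 0 <= C) (rL : lipschitz3 L r)
  (jL : forall b, lipschitz3 L (fun s q => cd b (j s q)))
  (r0 : forall s q, 0 <= r s q) (rB : forall s q, r s q <= B)
  (jC : forall b s q, `|cd b (j s q)| <= C * r s q).
Variables (X : R -> R -> R * R -> R * R) (T a T' b : R).
Hypotheses (FX : forall dl, 0 < dl -> capped_flow r j L C dl (X dl))
  (T0 : 0 <= T) (a0 : 0 <= a) (TT' : T < T') (atb : a + 2 * (T * C) + 1 < b)
  (CE : continuity_on r (fun s q => (j s q).1) (fun s q => (j s q).2) T' b).

Definition safe (dl : R) : set (R * R) :=
  [set q | 2 * dl <= r 0 q] `&` [set q | dl <= lowest (density r (X dl) T) T q].

Definition unsafe : set (R * R) :=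
  square a `&` [set q | 0 < r 0 q] `&` \bigcap_n ~` safe (harmonic n).

Let mr s : measurable_fun setT (r s).
Proof. exact: lipschitz2_measurable (lipschitz3_slice s rL). Qed.

Let h0 n : 0 < harmonic n :> R. Proof. by rewrite invr_gt0. Qed.

Lemma measurable_safe dl : 0 < dl -> measurable (safe dl).
Proof.
move=> dl0; apply: measurableI; first exact: measurable_superlevel_ge.
apply: measurable_superlevel_ge.
have m := measurable_lowest L0 C0 rL r0 dl0 (FX dl0) T0.
exact: measurableT_comp m (pair1_measurable T).
Qed.

Lemma measurable_unsafe : measurable unsafe.
Proof.
apply: measurableI; first apply: measurableI.
- exact: measurable_square.
- exact: measurable_superlevel.
- by apply: bigcapT_measurable => n; apply: measurableC; exact: measurable_safe.
Qed.

Let c := a + T * C + 1.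
Let F n := low_region r (harmonic n) T c.

(** The regions decrease to the empty set because [low_region] demands [0 < r]; the zero set of [r]
    itself may have positive volume. Finite volume then allows continuity from above. *)
Let low_cvg : (fun n => fine (@space_measure R (F n))) @ \oo --> (0 : R).
Proof.
have mF n : measurable (F n) by exact: measurable_low_region.
have F0 : \bigcap_n F n = set0.
  rewrite -subset0 => p Fp.
  have rp : 0 < r p.1 p.2 by have [[_]] := Fp 0%N I.
  have /cvgrPdist_lt /(_ (r p.1 p.2 / 2)) [|N _ HN] := @cvg_harmonic R; first by rewrite divr_gt0.
  have := HN N (leqnn N); rewrite /= sub0r normrN gtr0_norm//.
  by have [_ /=] := Fp N I; set x := r _ _; set y := N.+1%:R^-1; lra.
have mi : {homo F : n m / (n <= m)%N >-> (m <= n)%O}.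
  move=> n m nm; apply/subsetPset => p [[h1 h2] /= h3]; split => //=.
  apply: lt_le_trans h3 _; rewrite ler_pM2l// lef_pV2 ?posrE// ler_nat; exact: nm.
have := @nonincreasing_cvg_mu _ _ _ (@space_measure R) F.
rewrite F0 measure0 => /(_ _ mF measurable0 mi) h.
by move: (h (low_region_fin rL (harmonic 0) T c)) => /fine_cvg.
Qed.

(** At level [dl = harmonic n] an unsafe point either has initial density below [2 * dl], and such
    points carry at most [2 * dl] times the area of the square, or falls under [node_estimate]. *)
Lemma unsafe_null : int2 (fun q => \1_unsafe q * r 0 q) <= 0.
Proof.
have L'0 : 0 < L * (1 + C) + 1 by rewrite ltr_wpDl// mulr_ge0// addr_ge0.
have ind_bf2 (D : set (R * R)) : measurable D -> D `<=` square a -> bf2 (\1_D : R * R -> R).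
  move=> mD Da; apply: (@bf2_supp _ _ a 1) => //.
  - by move=> q; rewrite indicE; case: (q \in D); rewrite ?normr1 ?normr0.
  - move=> q; rewrite indicE; case: (boolP (q \in D)) => // /set_mem /Da.
    by rewrite /square /= leNgt => /negP.
have rN q : `|r 0 q| <= B by rewrite ger0_norm.
have bu : bf2 (fun q => \1_unsafe q * r 0 q).
  by apply: (bf2M (B := B)) => //; apply: ind_bf2; [exact: measurable_unsafe|move=> q [[]]].
have bs : bf2 (\1_(square a) : R * R -> R) by apply: ind_bf2 => //; exact: measurable_square.
have bound n : int2 (fun q => \1_unsafe q * r 0 q) <=
    2 * (2 * a) ^+ 2 * harmonic n + 16 * (L * (1 + C) + 1) * fine (@space_measure R (F n)).
  have est := node_estimate L0 C0 rL jL r0 rB jC (h0 n) (FX (h0 n)) T0 a0 TT' atb CE.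
  have ml : measurable (reaches_low r (harmonic n) (X (harmonic n)) T a).
    exact: measurable_reaches_low (FX (h0 n)) T0 a.
  have bl : bf2 (fun q => \1_(reaches_low r (harmonic n) (X (harmonic n)) T a) q * r 0 q).
    by apply: (bf2M (B := B)) => //; apply: ind_bf2 => // q [[]].
  apply: (@le_trans _ _ (int2 (fun q => 2 * harmonic n * \1_(square a) q
     + \1_(reaches_low r (harmonic n) (X (harmonic n)) T a) q * r 0 q))).
    apply: int2_le => //; first by apply: bf2D => //; exact: bf2Z.
    move=> q; have r0q := r0 0 q; rewrite [\1_unsafe q]indicE.
    have [/set_mem [[qa rq] un]|_] := boolP (q \in unsafe); last first.
      by rewrite mul0r addr_ge0// ?mulr_ge0 ?indicE// ltW.
    rewrite mul1r [\1_(square a) q]indicE mem_set// mulr1.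
    have [h|h] := ltP (r 0 q) (2 * harmonic n).
      by apply: le_trans (ltW h) _; rewrite lerDl mulr_ge0// indicE.
    rewrite indicE mem_set ?mul1r ?lerDr ?mulr_ge0// ?(ltW (h0 n))//.
    split => //=; rewrite ltNge; apply/negP => hl.
    by have := un n I; apply.
  rewrite int2D//; last exact: bf2Z.
  rewrite int2Z//; apply: lerD => //.
  have -> : 2 * (2 * a) ^+ 2 * harmonic n = 2 * harmonic n * (2 * a) ^+ 2 by ring.
  apply: ler_wpM2l; first by rewrite mulr_ge0// ltW.
  apply: le_trans (ler_norm _) _; rewrite -[leRHS]mul1r; apply: int2_norm_le => //.
  - exact: bf2_measurable bs.
  - by move=> q; rewrite indicE; case: (_ \in _); rewrite ?normr1 ?normr0.
  - by move=> q hq; rewrite indicE memNset// /square /= leNgt hq.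
have cv : (fun n => 2 * (2 * a) ^+ 2 * harmonic n + 16 * (L * (1 + C) + 1) * fine (@space_measure R (F n))) @ \oo --> (0 : R).
  rewrite -[X in _ --> X](addr0 0); apply: cvgD.
    by rewrite -[X in _ --> X](mulr0 (2 * (2 * a) ^+ 2)); apply: cvgM; [exact: cvg_cst|exact: cvg_harmonic].
  by rewrite -[X in _ --> X](mulr0 (16 * (L * (1 + C) + 1))); apply: cvgM; [exact: cvg_cst|exact: low_cvg].
rewrite -[leRHS](cvg_lim _ cv)//; apply: limr_ge; first by apply/cvg_ex; exists 0.
by near=> n; exact: bound.
Unshelve. all: by end_near. Qed.

End NodeNull.

(** * Folding the fields across the diagonal *)

Section Reflection.
Context {R : realType}.
Implicit Types (q : R * R).

Lemma dist3E (x y : R * (R * R)) : dist3 x y = `|x - y|.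
Proof. by rewrite /dist3 !prod_normE. Qed.

Lemma nbhs_dist (x0 : R * (R * R)) e : 0 < e -> nbhs x0 [set x | `|x0 - x| < e].
Proof.
case: x0 => x [y z] e0.
have n1 (u : R) : nbhs u [set v | `|u - v| < e] by exact: nbhsx_ballx.
exists ([set v | `|x - v| < e], [set q : R * R | `|y - q.1| < e /\ `|z - q.2| < e]) => /=.
  split => //; exists ([set v | `|y - v| < e], [set v | `|z - v| < e]) => //=; split; exact: n1.
by move=> [u [v w]] /= [h1 [h2 h3]]; rewrite !prod_normE /= !gt_max h1 h2.
Qed.

(** A near-covering argument on the closed box turns the local constants into one [M]. Pairs at
    distance at least [M^-1] are settled by the bound [M] on [f], whence the constant
    [2 * M * M]. *)
Lemma compact_lipschitz (f : R * (R * R) -> R) (b : R) : loc_lipschitz_on dom f ->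
  exists2 M, 0 < M & forall x y, dom x -> dom y -> x.1 <= b -> y.1 <= b -> `|x.2| <= b -> `|y.2| <= b ->
    `|f x - f y| <= M * `|x - y|.
Proof.
move=> fL.
pose A := (`[0, b]%classic `*` (`[- b, b]%classic `*` `[- b, b]%classic)) : set (R * (R * R)).
have cA : compact A by do 2! [apply: compact_setX; first exact: segment_compact]; exact: segment_compact.
pose P (M : R) (x : R * (R * R)) := dom x -> 0 < M /\ `|f x| <= M /\
  (forall y, dom y -> `|x - y| < M^-1 -> `|f x - f y| <= M * `|x - y|).
have : \forall M \near +oo, A `<=` P M.
  apply: (compact_near_coveringP A).1 => // x0 [/= + _]; rewrite in_itv /= => /andP[x00 _].
  have [dx|ndx] := pselect (dom x0); last first.
    (* The box also contains points outside [dom], below the diagonal; each has a neighbourhood that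
       misses [dom], where [P] holds vacuously. *)
    have lt : x0.2.2 < x0.2.1 by rewrite ltNge; apply/negP => h; apply: ndx.
    pose e := (x0.2.1 - x0.2.2) / 2.
    have e0 : 0 < e by rewrite divr_gt0// subr_gt0.
    exists ([set x | `|x0 - x| < e], setT) => /=.
      split; last exact: filterT.
      exact: nbhs_dist.
    move=> [x M] /= [xe _] [_ /= dx]; exfalso.
    move: xe; rewrite !prod_normE !gt_max /= => /and3P[_ h1 h2].
    have h3 := ler_norm (x0.2.1 - x.2.1); have h4 := ler_norm (- (x0.2.2 - x.2.2)).
    by rewrite normrN in h4; move: h1 h2 h3 h4 dx; rewrite /QQbar /e /=; lra.
  have [r [r0 [L HL]]] := fL x0 dx.
  (* The three terms bound [f] near [x0], force [M^-1 < r / 2] so that [y] stays within the range of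
     the local estimate, and dominate its constant. *)
  pose c := Num.max (`|f x0| + `|L| * r) (Num.max (2 / r) `|L|).
  exists ([set x | `|x0 - x| < r / 2], [set M | c < M]) => /=.
    split; last by apply: nbhs_pinfty_gt; exact: num_real.
    by apply: nbhs_dist; rewrite divr_gt0.
  move=> [x M] /= [xr cM] Dx; rewrite distrC in xr.
  move: cM; rewrite !gt_max => /and3P[M1 M2 M3].
  have M0 : 0 < M by exact: le_lt_trans M3.
  have xr' : dist3 x x0 < r by rewrite dist3E; lra.
  have x00' : dist3 x0 x0 < r by rewrite dist3E subrr normr0.
  split => //; split.
    have := HL x x0 Dx dx xr' x00'; rewrite dist3E => h.
    rewrite -(subrK (f x0) (f x)); apply: le_trans (ler_normD _ _) _.
    apply: le_trans (ltW M1); rewrite addrC lerD2l; apply: le_trans h _.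
    apply: (@le_trans _ _ (`|L| * `|x - x0|)); first exact: ler_wpM2r (ler_norm _).
    by apply: ler_wpM2l => //; move: xr; lra.
  move=> y Dy xy.
  have y2 : M^-1 < r / 2.
    rewrite -[r / 2]invrK ltf_pV2 ?posrE ?invr_gt0 ?divr_gt0// invf_div.
    exact: M2.
  have yr : dist3 y x0 < r.
    rewrite dist3E -(subrKA x); apply: le_lt_trans (ler_normD _ _) _.
    by rewrite (distrC y); lra.
  have := HL x y Dx Dy xr' yr; rewrite dist3E => /le_trans; apply.
  by apply: ler_wpM2r => //; apply: le_trans (ler_norm _) (ltW M3).
move=> [M0 [_ HM]]; pose M := Num.max 1 (M0 + 1).
have AP : A `<=` P M by apply: HM; rewrite /M lt_max ltrDl ltr01 orbT.
have M1 : 0 < M by rewrite lt_max ltr01.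
have inA x : dom x -> x.1 <= b -> `|x.2| <= b -> A x.
  move=> [x0 _] xb; rewrite prod_normE ge_max => /andP[]; rewrite !ler_norml => h1 h2.
  by split => /=; [rewrite in_itv /= x0|split; rewrite /= in_itv].
exists (2 * M * M); first by rewrite !mulr_gt0.
move=> x y Dx Dy xb yb xb2 yb2.
have [_ [fx Hx]] := AP x (inA x Dx xb xb2) Dx.
have [_ [fy _]] := AP y (inA y Dy yb yb2) Dy.
have M11 : 1 <= M by rewrite /M le_max lexx.
have [h|h] := ltP `|x - y| M^-1.
  apply: le_trans (Hx y Dy h) _; apply: ler_wpM2r => //.
  by rewrite ler_peMl ?(ltW M1)//; lra.
apply: (@le_trans _ _ (2 * M)).
  by apply: le_trans (ler_normB _ _) _; lra.
rewrite -(mulrA (2 * M)); apply: ler_peMr; first by rewrite mulr_ge0// ltW.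
by rewrite -ler_pdivrMl// mulr1.
Qed.

(** Reflection in the diagonal exchanges the coordinates. A density is therefore glued to itself,
    but the first component of a current to the second, and conversely. *)
Definition glue (f1 f2 : R -> R * R -> R) t q := if q.1 <= q.2 then f1 t q else f2 t (swap q).
Definition clampb (b x : R) : R := Num.max (- b) (Num.min x b).
Definition boxed (b : R) q := (clampb b q.1, clampb b q.2).
(** Clamping time and both coordinates makes the folded fields bounded and Lipschitz on the whole
    space; the continuity equation is retained inside the open box. *)
Definition extended (f1 f2 : R -> R * R -> R) (T b t : R) q := glue f1 f2 (clampt T t) (boxed b q).

Lemma clampb_dist b x y : `|clampb b x - clampb b y| <= `|x - y|.
Proof.
apply: le_trans (maxr_dist _ _ _) _.
have := ler_norm (x - y); have := ler_norm (y - x); rewrite (distrC y x).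
case: (leP x b) => ?; case: (leP y b) => ? ? ?; apply: bounds_norm_le; lra.
Qed.

Lemma clampb_norm b x : 0 <= b -> `|clampb b x| <= b.
Proof.
move=> b0; rewrite /clampb; apply: bounds_norm_le; first by rewrite le_max lexx.
by rewrite ge_max ge_min lexx orbT andbT; lra.
Qed.

Lemma clampb_id b x : `|x| <= b -> clampb b x = x.
Proof.
by move=> /norm_le_bounds[h1 h2]; rewrite /clampb (min_idPl h2); apply/max_idPr.
Qed.

Lemma boxed_dist b p q : `|boxed b p - boxed b q| <= `|p - q|.
Proof.
apply: pair_norm_le; apply: le_trans (clampb_dist _ _ _) _; first exact: fst_norm_le (p - q).
exact: snd_norm_le (p - q).
Qed.

Lemma boxed_norm b q : 0 <= b -> `|boxed b q| <= b.
Proof. by move=> b0; apply: pair_norm_le; exact: clampb_norm. Qed.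

Lemma boxed_id b q : `|q| <= b -> boxed b q = q.
Proof.
by move=> h; rewrite /boxed !clampb_id -?surjective_pairing//; apply: le_trans h; [exact: snd_norm_le|exact: fst_norm_le].
Qed.

Lemma near_derive1 (f g : R -> R) t : (\forall s \near t, g s = f s) -> derivable f t 1 ->
  derivable g t 1 /\ derive1 g t = derive1 f t.
Proof.
move=> fg df; split; last by rewrite !derive1E; exact: near_eq_derive.
by apply: near_eq_derivable df; near do apply: esym.
Unshelve. all: by end_near. Qed.

Section Extension.
Variables (T b M : R).
Hypotheses (T0 : 0 <= T) (b0 : 0 <= b) (M0 : 0 <= M).

Definition boxlip (f : R -> R * R -> R) := forall s s' p q, 0 <= s -> s <= T -> 0 <= s' -> s' <= T ->
  QQbar p -> QQbar q -> `|p| <= b -> `|q| <= b -> `|f s p - f s' q| <= M * (`|s - s'| + `|p - q|).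

(** Points at distance [d] on opposite sides are joined through the diagonal point [(p1.1, p1.1)],
    where the pieces agree: the first leg is at most [2 * d] and the second, after reflection, at
    most [d]. This is the factor 3. *)
Lemma glue_lipschitz f1 f2 s s' p q : boxlip f1 -> boxlip f2 ->
  (forall s x, 0 <= s -> f1 s (x, x) = f2 s (x, x)) ->
  0 <= s -> s <= T -> 0 <= s' -> s' <= T -> `|p| <= b -> `|q| <= b ->
  `|glue f1 f2 s p - glue f1 f2 s' q| <= 3 * M * (`|s - s'| + `|p - q|).
Proof.
move=> L1 L2 f12 s0 sT s'0 s'T pb qb.
have same (f : R -> R * R -> R) s1 s2 p1 q1 : boxlip f -> 0 <= s1 -> s1 <= T -> 0 <= s2 -> s2 <= T ->
   QQbar p1 -> QQbar q1 -> `|p1| <= b -> `|q1| <= b -> `|f s1 p1 - f s2 q1| <= 3 * M * (`|s1 - s2| + `|p1 - q1|).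
  move=> fL *; apply: le_trans (fL _ _ _ _ _ _ _ _ _ _ _ _) _ => //.
  by apply: ler_wpM2r; [rewrite addr_ge0|have := M0; lra].
have cross g1 g2 s1 s2 p1 q1 : boxlip g1 -> boxlip g2 ->
   (forall s x, 0 <= s -> g1 s (x, x) = g2 s (x, x)) -> 0 <= s1 -> s1 <= T -> 0 <= s2 -> s2 <= T ->
   p1.1 <= p1.2 -> q1.2 < q1.1 -> `|p1| <= b -> `|q1| <= b ->
   `|g1 s1 p1 - g2 s2 (swap q1)| <= 3 * M * (`|s1 - s2| + `|p1 - q1|).
  move=> G1 G2 g12 s10 s1T s20 s2T hp hq p1b q1b.
  set d := `|p1 - q1|; have d1 : `|p1.1 - q1.1| <= d by exact: fst_norm_le (p1 - q1).
  have d2 : `|p1.2 - q1.2| <= d by exact: snd_norm_le (p1 - q1).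
  have [a1 a2] := norm_le_bounds d1; have [a3 a4] := norm_le_bounds d2.
  have zb : `|(p1.1, p1.1)| <= b by apply: pair_norm_le; exact: le_trans (fst_norm_le _) p1b.
  have e1 : `|p1 - (p1.1, p1.1)| <= 2 * d.
    by apply: pair_norm_le => /=; rewrite ?subrr ?normr0 ?ger0_norm ?subr_ge0//; lra.
  have e2 : `|(p1.1, p1.1) - swap q1| <= d by apply: pair_norm_le => /=; apply: bounds_norm_le; lra.
  rewrite -(subrKA (g1 s1 (p1.1, p1.1))); apply: le_trans (ler_normD _ _) _.
  rewrite {2}g12//.
  have h1 := G1 s1 s1 p1 (p1.1, p1.1) s10 s1T s10 s1T hp (lexx _) p1b zb.
  have qs : QQbar (swap q1) by exact: ltW.
  have h2 := G2 s1 s2 (p1.1, p1.1) (swap q1) s10 s1T s20 s2T (lexx _) qs zb.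
  rewrite norm_swap in h2; have {}h2 := h2 q1b.
  rewrite subrr normr0 add0r in h1.
  have k1 := ler_wpM2l M0 e1; have k2 := ler_wpM2l M0 e2.
  have n0 := mulr_ge0 M0 (normr_ge0 (s1 - s2)).
  rewrite mulrDr in h2; rewrite (mulrDr (3 * M)).
  have -> : 3 * M * `|s1 - s2| = 3 * (M * `|s1 - s2|) by ring.
  have -> : 3 * M * d = M * (2 * d) + M * d by ring.
  apply: le_trans (lerD (le_trans h1 k1) h2) _.
  by move: k2 n0; set x := M * `|s1 - s2|; set y := M * d; set z := M * `|_|; set u := M * (2 * d); lra.
rewrite /glue; case: (leP p.1 p.2) => hp; case: (leP q.1 q.2) => hq.
- exact: same.
- exact: cross.
- rewrite distrC [X in _ <= X](_ : _ = 3 * M * (`|s' - s| + `|q - p|)); last by rewrite distrC (distrC p).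
  exact: cross.
- by rewrite -(swap_dist p); apply: same; rewrite ?norm_swap//; exact: ltW.
Qed.

Lemma extended_lipschitz f1 f2 : boxlip f1 -> boxlip f2 ->
  (forall s x, 0 <= s -> f1 s (x, x) = f2 s (x, x)) -> lipschitz3 (3 * M) (extended f1 f2 T b).
Proof.
move=> L1 L2 f12 s s' p q; apply: le_trans (glue_lipschitz L1 L2 f12 _ _ _ _ _ _) _;
  rewrite ?clampt_ge0 ?clampt_le ?boxed_norm//.
apply: ler_wpM2l; first by rewrite mulr_ge0.
by apply: lerD; [exact: clampt_dist|exact: boxed_dist].
Qed.

Lemma extended_id f1 f2 t q : 0 <= t -> t <= T -> QQbar q -> `|q| <= b -> extended f1 f2 T b t q = f1 t q.
Proof. by move=> t0 tT qq qb; rewrite /extended clampt_id// boxed_id// /glue qq. Qed.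

Lemma extended_below f1 f2 t q : 0 <= t -> t <= T -> q.2 < q.1 -> `|q| <= b ->
  extended f1 f2 T b t q = f2 t (swap q).
Proof. by move=> t0 tT qq qb; rewrite /extended clampt_id// boxed_id// /glue leNgt qq. Qed.

Lemma extended_ind (P : R -> Prop) f1 f2 t q :
  (forall t p, 0 <= t -> t <= T -> QQbar p -> `|p| <= b -> P (f1 t p) /\ P (f2 t p)) -> P (extended f1 f2 T b t q).
Proof.
move=> H; rewrite /extended /glue; case: leP => h.
  by apply: (H _ _ _ _ _ _).1; rewrite ?clampt_ge0 ?clampt_le ?boxed_norm.
by apply: (H _ _ _ _ _ _).2; rewrite ?clampt_ge0 ?clampt_le ?norm_swap ?boxed_norm//; exact: ltW.
Qed.

End Extension.

Lemma plane_integral_swap (F : R * R -> R) : measurable_fun setT F -> (forall q, 0 <= F q) ->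
  (\int[@leb2 R]_q (F (swap q))%:E = \int[@leb2 R]_q (F q)%:E)%E.
Proof.
move=> mF F0.
have mF' : measurable_fun setT (EFin \o F) by exact/measurable_EFinP.
have mS : measurable_fun setT (fun q => F (swap q)) by exact: (@measurable_pairmap R snd fst F).
have mS' : measurable_fun setT (EFin \o (fun q => F (swap q))) by exact/measurable_EFinP.
have e1 := @fubini_tonelli1 _ _ _ _ R (@lebesgue_measure R) (@lebesgue_measure R) _ mS'.
have e2 := @fubini_tonelli2 _ _ _ _ R (@lebesgue_measure R) (@lebesgue_measure R) _ mF'.
transitivity (\int[@lebesgue_measure R]_x \int[@lebesgue_measure R]_y (F (y, x))%:E)%E.
  by apply: e1 => q; rewrite lee_fin.
by apply: esym; apply: e2 => q; rewrite lee_fin.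
Qed.

Lemma space_measureE (A : set (R * (R * R))) : measurable A ->
  (@space_measure R A = \int[@lebesgue_measure R]_u \int[@leb2 R]_q (\1_A (u, q))%:E)%E.
Proof.
move=> mA; rewrite -(@integral_indic_setT _ _ R (@space_measure R))//.
by apply: space_fubini => //; exact: measurable_indic.
Qed.

Lemma negligible_swap (N : set (R * (R * R))) : (@space_measure R).-negligible N ->
  (@space_measure R).-negligible [set p | N (p.1, swap p.2)].
Proof.
move=> [A [mA A0 NA]]; exists [set p | A (p.1, swap p.2)]; split; last by move=> p; exact: NA.
  have ms : measurable_fun setT (fun p : R * (R * R) => (p.1, swap p.2)).
    apply: measurable_fun_pair; first exact: measurable_fst.
    apply: measurable_fun_pair.
      by apply: measurableT_comp measurable_snd measurable_snd.
    by apply: measurableT_comp measurable_fst measurable_snd.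
  by have := ms measurableT _ mA; rewrite setTI.
have mB : measurable [set p | A (p.1, swap p.2)].
  have ms : measurable_fun setT (fun p : R * (R * R) => (p.1, swap p.2)).
    apply: measurable_fun_pair; first exact: measurable_fst.
    apply: measurable_fun_pair.
      by apply: measurableT_comp measurable_snd measurable_snd.
    by apply: measurableT_comp measurable_fst measurable_snd.
  by have := ms measurableT _ mA; rewrite setTI.
rewrite space_measureE// -[RHS]A0 (space_measureE mA).
apply: eq_integral => u _.
rewrite -(@plane_integral_swap (fun q => \1_A (u, q))).
- by apply: eq_integral => q _; rewrite !indicE.
- have mi : measurable_fun setT (\1_A : R * (R * R) -> R) by exact: measurable_indic.
  exact: measurableT_comp mi (pair1_measurable u).
- by move=> q; rewrite indicE.
Qed.

Lemma diagonal_negligible : (@space_measure R).-negligible [set p | p.2.1 = p.2.2].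
Proof.
have m21 : measurable_fun setT (fun p : R * (R * R) => p.2.1).
  by apply: measurableT_comp measurable_fst measurable_snd.
have m22 : measurable_fun setT (fun p : R * (R * R) => p.2.2).
  by apply: measurableT_comp measurable_snd measurable_snd.
pose D := [set p : R * (R * R) | 0 <= p.2.2 - p.2.1] `&` [set p | 0 <= p.2.1 - p.2.2].
have mD : measurable D.
  by apply: measurableI; apply: measurable_superlevel_ge; exact: measurable_funB.
exists D; split => //; last by move=> p /= e; rewrite /D /= e subrr.
rewrite space_measureE//; apply: integral0_eq => u _.
have mi : measurable_fun setT (\1_D : R * (R * R) -> R) by exact: measurable_indic.
have mu1 := measurableT_comp mi (pair1_measurable u).
have mu' : measurable_fun setT (EFin \o (fun q => \1_D (u, q) : R)) by exact/measurable_EFinP.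
have e1 := @fubini_tonelli1 _ _ _ _ R (@lebesgue_measure R) (@lebesgue_measure R) _ mu'.
transitivity (\int[@lebesgue_measure R]_x \int[@lebesgue_measure R]_y (\1_D (u, (x, y)))%:E)%E.
  by apply: e1 => q; rewrite lee_fin.
apply: integral0_eq => x _.
rewrite -(lebesgue_measure_set1 x) -(@integral_indic_setT _ _ R (@lebesgue_measure R))//.
apply: eq_integral => y _; rewrite !indicE; congr ((nat_of_bool _)%:R%:E).
apply/idP/idP => /set_mem h; apply/mem_set.
  by move: h; rewrite /D /= => -[h1 h2]; apply/eqP; rewrite eq_le; apply/andP; split; lra.
by rewrite h /D /= subrr.
Qed.

(** * The folded density and current *)

Section Fields.
Variables (rho : R -> R * R -> R) (J : R -> R * R -> R * R) (C : R).
Let J1 t q := (J t q).1.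
Let J2 t q := (J t q).2.
Hypotheses (Hlip_rho : loc_lipschitz_on dom (fun p => rho p.1 p.2))
  (Hlip_J1 : loc_lipschitz_on dom (fun p => (J p.1 p.2).1))
  (Hlip_J2 : loc_lipschitz_on dom (fun p => (J p.1 p.2).2))
  (Hnonneg : forall t q, 0 <= t -> QQbar q -> 0 <= rho t q)
  (H1 : exists N : set (R * (R * R)), leb3.-negligible N /\
     forall t q, 0 < t -> QQ q -> ~ N (t, q) ->
       [/\ derivable (fun s => rho s q) t 1,
           derivable (fun x => (J t (x, q.2)).1) q.1 1,
           derivable (fun y => (J t (q.1, y)).2) q.2 1
         & derive1 (fun s => rho s q) t
           + derive1 (fun x => (J t (x, q.2)).1) q.1
           + derive1 (fun y => (J t (q.1, y)).2) q.2 = 0])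
  (C0 : 0 < C) (H4 : forall t q, 0 <= t -> QQbar q ->
     Num.sqrt ((J t q).1 ^+ 2 + (J t q).2 ^+ 2) <= C * rho t q)
  (H6 : forall t q, 0 <= t -> q.1 = q.2 -> `|(J t q).1 - (J t q).2| = 0).

(** Below the diagonal each partial derivative at [q] is one of the other component at [swap q], so
    the two divergence terms change places. The exceptional set is enlarged by its mirror image and
    by the diagonal, where the folded fields may have a kink. *)
Lemma reflected_continuity T b :
  continuity_on (extended rho rho T b) (extended J1 J2 T b) (extended J2 J1 T b) T b.
Proof.
have [N [N0 HN]] := H1.
have N0' : (@space_measure R).-negligible N := N0.
pose N' := N `|` [set p | N (p.1, swap p.2)] `|` [set p | p.2.1 = p.2.2].
have N'0 : (@space_measure R).-negligible N'.
  by apply: negligibleU; [apply: negligibleU => //; exact: negligible_swap|exact: diagonal_negligible].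
exists N' => // t q t0 tT qb nN.
have T0 : 0 <= T by lra.
have qb1 : `|q.1| < b by exact: le_lt_trans (fst_norm_le q) qb.
have qb2 : `|q.2| < b by exact: le_lt_trans (snd_norm_le q) qb.
have nt : \forall s \near t, s \in `]0, T[%R by apply: near_in_itvoo; rewrite in_itv /= t0.
have pb (x y : R) : `|x| < b -> `|y| < b -> `|(x, y)| <= b.
  by move=> hx hy; apply: pair_norm_le; exact: ltW.
have qne : q.1 != q.2 by apply/eqP => e; apply: nN; right.
have nb (x : R) : - b < x < b -> `|x| < b by rewrite ltr_norml.
have /orP[lt|gt] : (q.1 < q.2) || (q.2 < q.1) by rewrite -neq_lt.
- have nN1 : ~ N (t, q) by move=> h; apply: nN; left; left.
  have [d1 d2 d3 e] := HN t q t0 lt nN1.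
  have n1 : \forall x \near q.1, x \in `](- b), (Num.min b q.2)[%R.
    by apply: near_in_itvoo; move: qb1; rewrite in_itv /= lt_min ltr_norml => /andP[-> ->].
  have n2 : \forall y \near q.2, y \in `](Num.max (- b) q.1), b[%R.
    by apply: near_in_itvoo; move: qb2; rewrite in_itv /= gt_max ltr_norml => /andP[-> ->]; rewrite lt.
  have [d1' e1] : derivable (fun s => extended rho rho T b s q) t 1 /\
      derive1 (fun s => extended rho rho T b s q) t = derive1 (fun s => rho s q) t.
    apply: near_derive1 _ d1; apply: filterS nt => s.
    rewrite in_itv /= => /andP[s0 sT].
    by apply: extended_id => //; exact: ltW.
  have [d2' e2] : derivable (fun x => extended J1 J2 T b t (x, q.2)) q.1 1 /\
      derive1 (fun x => extended J1 J2 T b t (x, q.2)) q.1 = derive1 (fun x => (J t (x, q.2)).1) q.1.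
    apply: near_derive1 _ d2; apply: filterS n1 => x.
    rewrite in_itv /= lt_min => /and3P[x1 x2 x3].
    by apply: extended_id => //; try exact: ltW; apply: pb => //; apply: nb; rewrite x1.
  have [d3' e3] : derivable (fun y => extended J2 J1 T b t (q.1, y)) q.2 1 /\
      derive1 (fun y => extended J2 J1 T b t (q.1, y)) q.2 = derive1 (fun y => (J t (q.1, y)).2) q.2.
    apply: near_derive1 _ d3; apply: filterS n2 => y.
    rewrite in_itv /= gt_max => /andP[/andP[y1 y2] y3].
    by apply: extended_id => //; try exact: ltW; apply: pb => //; apply: nb; rewrite y1.
  by split => //; rewrite e1 e2 e3.
- have nN1 : ~ N (t, swap q) by move=> h; apply: nN; left; right.
  have [d1 d2 d3 e] := HN t (swap q) t0 gt nN1.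
  rewrite /swap /= in d1 d2 d3 e.
  have n1 : \forall x \near q.1, x \in `](Num.max (- b) q.2), b[%R.
    by apply: near_in_itvoo; move: qb1; rewrite in_itv /= gt_max ltr_norml => /andP[-> ->]; rewrite gt.
  have n2 : \forall y \near q.2, y \in `](- b), (Num.min b q.1)[%R.
    by apply: near_in_itvoo; move: qb2; rewrite in_itv /= lt_min ltr_norml => /andP[-> ->].
  have [d1' e1] : derivable (fun s => extended rho rho T b s q) t 1 /\
      derive1 (fun s => extended rho rho T b s q) t = derive1 (fun s => rho s (q.2, q.1)) t.
    apply: near_derive1 _ d1; apply: filterS nt => s.
    rewrite in_itv /= => /andP[s0 sT].
    by apply: extended_below => //; exact: ltW.
  have [d2' e2] : derivable (fun x => extended J1 J2 T b t (x, q.2)) q.1 1 /\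
      derive1 (fun x => extended J1 J2 T b t (x, q.2)) q.1 = derive1 (fun x => (J t (q.2, x)).2) q.1.
    apply: near_derive1 _ d3; apply: filterS n1 => x.
    rewrite in_itv /= gt_max => /andP[/andP[x1 x2] x3].
    by apply: extended_below => //; try exact: ltW; apply: pb => //; apply: nb; rewrite x1.
  have [d3' e3] : derivable (fun y => extended J2 J1 T b t (q.1, y)) q.2 1 /\
      derive1 (fun y => extended J2 J1 T b t (q.1, y)) q.2 = derive1 (fun y => (J t (y, q.1)).1) q.2.
    apply: near_derive1 _ d2; apply: filterS n2 => y.
    rewrite in_itv /= lt_min => /and3P[y1 y2 y3].
    by apply: extended_below => //; try exact: ltW; apply: pb => //; apply: nb; rewrite y1.
  by split => //; rewrite e1 e2 e3 -e addrAC.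
Qed.

Definition field_r T b := extended rho rho T b.
Definition field_j T b t q := (extended J1 J2 T b t q, extended J2 J1 T b t q).

Lemma J_norm t q i : 0 <= t -> QQbar q -> `|cd i (J t q)| <= C * rho t q.
Proof.
move=> t0 qq; apply: le_trans (H4 t0 qq).
rewrite -sqrtr_sqr; apply: ler_wsqrtr; case: i; rewrite /= ?lerDl ?lerDr sqr_ge0//.
Qed.

Lemma reflected_fields T b : 0 <= T -> 0 <= b -> exists L B : R,
  [/\ 0 <= L, lipschitz3 L (field_r T b) & forall i, lipschitz3 L (fun s q => cd i (field_j T b s q))] /\
  [/\ forall s q, 0 <= field_r T b s q, forall s q, field_r T b s q <= B,
      forall i s q, `|cd i (field_j T b s q)| <= C * field_r T b s q
    & forall s x, (field_j T b s (x, x)).1 = (field_j T b s (x, x)).2].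
Proof.
move=> T0 b0.
(* The vanishing flux through the boundary enters here: it makes the glued components match on the
   diagonal, and it makes the folded current tangent to it. *)
have Jd s x : 0 <= s -> J1 s (x, x) = J2 s (x, x).
  by move=> s0; apply/eqP; rewrite -subr_eq0 -normr_eq0; apply/eqP; exact: H6.
have [M1 M10 HM1] := compact_lipschitz (Num.max T b) Hlip_rho.
have [M2 M20 HM2] := compact_lipschitz (Num.max T b) Hlip_J1.
have [M3 M30 HM3] := compact_lipschitz (Num.max T b) Hlip_J2.
pose M := M1 + M2 + M3.
have M0 : 0 <= M by rewrite !addr_ge0// ltW.
have bl f (K : R) : 0 < K -> K <= M -> (forall x y, dom x -> dom y -> x.1 <= Num.max T b -> y.1 <= Num.max T b ->
    `|x.2| <= Num.max T b -> `|y.2| <= Num.max T b -> `|f x.1 x.2 - f y.1 y.2| <= K * `|x - y|) -> boxlip T b M f.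
  move=> K0 KM H s s' p q s0 sT s'0 s'T pp qq pb qb.
  have := H (s, p) (s', q) (conj s0 pp) (conj s'0 qq); rewrite /= !le_max sT s'T pb qb !orbT => /(_ isT isT isT isT).
  move=> /le_trans; apply; apply: (@le_trans _ _ (M * `|(s, p) - (s', q)|)); first exact: ler_wpM2r.
  by apply: ler_wpM2l => //; rewrite prod_normE /= ge_max lerDl lerDr !normr_ge0.
have br : boxlip T b M rho by apply: (bl rho M1) => //; rewrite /M -addrA lerDl addr_ge0// ltW.
have b1 : boxlip T b M J1 by apply: (bl J1 M2) => //; rewrite /M addrAC lerDr addr_ge0// ltW.
have b2 : boxlip T b M J2 by apply: (bl J2 M3) => //; rewrite /M lerDr addr_ge0// ltW.
exists (3 * M), (rho 0 (0, 0) + M * (T + b)); split; split.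
- by rewrite mulr_ge0.
- exact: extended_lipschitz.
- case; first exact: extended_lipschitz.
  by apply: extended_lipschitz => // s x s0; rewrite Jd.
- by move=> s q; apply: (@extended_ind T b T0 b0 (fun v => 0 <= v)) => t p *; split; exact: Hnonneg.
- move=> s q; apply: (@extended_ind T b T0 b0 (fun v => v <= _)) => t p t0 tT pp pb.
  suff h : rho t p <= rho 0 (0, 0) + M * (T + b) by split.
  rewrite -lerBlDl; apply: le_trans (ler_norm _) _.
  have n0 : `|(0, 0) : R * R| <= b by rewrite prod_normE /= normr0 maxxx.
  apply: le_trans (br t 0 p (0, 0) t0 tT (lexx _) T0 pp (lexx _) pb n0) _.
  apply: ler_wpM2l => //; rewrite subr0 (ger0_norm t0); apply: lerD => //.
  by rewrite [p - _](subr0 p).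
- move=> i s q; rewrite /field_j /field_r /extended /glue.
  have c0 := clampt_ge0 T s.
  case: (leP (boxed b q).1 (boxed b q).2) => h; first by have := J_norm i c0 h; case: i.
  by have := @J_norm (clampt T s) (swap (boxed b q)) (~~ i) c0 (ltW h); case: i.
- by move=> s x; rewrite /field_j /= /extended /glue /boxed /= lexx Jd// clampt_ge0.
Qed.

Lemma field_r_id T b t q : 0 <= T -> 0 <= t -> t <= T -> QQbar q -> `|q| <= b -> field_r T b t q = rho t q.
Proof. by move=> *; exact: extended_id. Qed.

Lemma field_j_id T b t q : 0 <= T -> 0 <= t -> t <= T -> QQbar q -> `|q| <= b -> field_j T b t q = J t q.
Proof. by move=> *; rewrite /field_j !extended_id// /J1 /J2 -surjective_pairing. Qed.

End Fields.
End Reflection.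

(** * Solutions and regularised flows *)

Section Solutions.
Context {R : realType}.

Lemma is_derive_quadratic (f : R -> R) (s v K : R) : 0 < s ->
  (forall s', 0 <= s' -> `|f s' - f s - (s' - s) * v| <= K * (s' - s) ^+ 2) -> is_derive s 1 f v.
Proof.
move=> s0 H.
have cv : (fun h : R => h^-1 *: ((f \o shift s) (h *: 1) - f s)) @ 0^' --> v.
  apply/cvgrPdist_le => e e0.
  (* The first bound keeps [h + s] nonnegative, where the hypothesis applies; the second makes
     [|K| * |h|] at most [e]. *)
  have d0 : 0 < Num.min s (e / (`|K| + 1)) by rewrite lt_min s0 divr_gt0// ltr_wpDl.
  exists (Num.min s (e / (`|K| + 1))) => // h /= hd hn0.
  have : `|h| < Num.min s (e / (`|K| + 1)) by rewrite -normrN -sub0r.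
  rewrite lt_min => /andP[hs he].
  have [h1 h2] := norm_le_bounds (ltW hs).
  have hs0 : 0 <= h + s by lra.
  have := H (h + s) hs0; rewrite addrK [_%:A]mulr1 => Hh.
  rewrite distrC [X in `|X|](_ : _ = h^-1 * (f (h + s) - f s - h * v)); last first.
    by rewrite mulrBr mulKf.
  rewrite normrM normfV ler_pdivrMl ?normr_gt0//.
  apply: le_trans Hh _; rewrite -real_normK ?num_real// expr2 mulrA mulrC.
  apply: ler_wpM2l => //.
  apply: (@le_trans _ _ ((`|K| + 1) * `|h|)).
    by apply: ler_wpM2r => //; have := ler_norm K; lra.
  by rewrite mulrC -ler_pdivlMr ?ltW// ltr_wpDl.
apply: DeriveDef; first by apply/cvg_ex; exists v.
exact: cvg_lim cv.
Qed.

Variables (rho : R -> R * R -> R) (J : R -> R * R -> R * R)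
  (r : R -> R * R -> R) (j : R -> R * R -> R * R) (L C T b : R).
Hypotheses (L0 : 0 <= L) (C0 : 0 <= C) (rL : lipschitz3 L r)
  (jL : forall i, lipschitz3 L (fun s q => cd i (j s q)))
  (r0 : forall s q, 0 <= r s q)
  (jC : forall i s q, `|cd i (j s q)| <= C * r s q)
  (jd : forall s x, (j s (x, x)).1 = (j s (x, x)).2)
  (JC : forall i s q, 0 <= s -> QQbar q -> `|cd i (J s q)| <= C * rho s q)
  (rho0 : forall s q, 0 <= s -> QQbar q -> 0 <= rho s q)
  (T0 : 0 <= T)
  (agree : forall s q, 0 <= s -> s <= T -> QQbar q -> `|q| <= b -> r s q = rho s q /\ j s q = J s q).

Let vel i (X : R -> R * R) s := cd i (J s (X s)) / rho s (X s).

Lemma sol_derive q be X s i : is_sol rho J q be X -> 0 < s -> s < be ->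
  is_derive s 1 (fun u => cd i (X u)) (vel i X s).
Proof.
move=> [_ _ D _] s0 sb; have [|d1 d2 e1 e2] := D s; first by rewrite s0.
by case: i; [apply: (DeriveDef d1)|apply: (DeriveDef d2)]; rewrite -derive1E.
Qed.

Lemma sol_pos q be X s : is_sol rho J q be X -> 0 <= s -> s < be -> QQ (X s) /\ 0 < rho s (X s).
Proof.
move=> [_ P _ _] s0 sb; have [|QX ne] := P s; first by rewrite s0.
by split => //; rewrite lt_neqAle eq_sym ne rho0//; exact: ltW.
Qed.

Lemma sol_vel q be X s i : is_sol rho J q be X -> 0 <= s -> s < be -> `|vel i X s| <= C.
Proof.
move=> S s0 sb; have [QX p] := sol_pos S s0 sb.
by rewrite /vel normrM (@gtr0_norm _ (_^-1)) ?invr_gt0// ler_pdivrMr//; apply: JC => //; exact: ltW.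
Qed.

(** The mean value theorem on the closed interval. At [s = 0] continuity from the right is all that
    [is_sol] grants, and it is all that the theorem asks for. *)
Lemma sol_mean q be X s s' i : is_sol rho J q be X -> 0 <= s -> s < s' -> s' < be ->
  exists2 u, s < u < s' & cd i (X s') - cd i (X s) = vel i X u * (s' - s).
Proof.
move=> S s0 ss' s'b.
have dv u : u \in `]s, s'[%R -> is_derive u 1 (fun u => cd i (X u)) (vel i X u).
  rewrite in_itv /= => /andP[h1 h2]; apply: (sol_derive i S); first exact: le_lt_trans h1.
  exact: lt_trans s'b.
have ct u : 0 < u -> u < be -> {for u, continuous (fun u => cd i (X u))}.
  move=> h1 h2; have [d _] := sol_derive i S h1 h2.
  exact/differentiable_continuous/derivable1_diffP.
have wc : {within `[s, s'], continuous (fun u => cd i (X u))}.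
  apply/continuous_within_itvP => //; split.
  - by move=> u; rewrite in_itv /= => /andP[h1 h2]; apply: ct; [exact: le_lt_trans h1|exact: lt_trans s'b].
  - have [->|sn] := eqVneq s 0.
      have [X0 _ _ Xc] := S; rewrite X0.
      move/cvgrPdist_lt : Xc => Xc; apply/cvgrPdist_lt => e /Xc; apply: filterS => u.
      exact: le_lt_trans (cdB_norm_le i _ _).
    apply: cvg_at_right_filter; apply: ct; last exact: lt_trans s'b.
    by rewrite lt_neqAle eq_sym sn.
  - by apply: cvg_at_left_filter; apply: ct => //; exact: le_lt_trans ss'.
have [u ui e] := MVT ss' dv wc.
by exists u => //; move: ui; rewrite in_itv.
Qed.

Lemma sol_speed q be X s s' : is_sol rho J q be X -> 0 <= s -> s <= s' -> s' < be ->
  `|X s' - X s| <= C * (s' - s).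
Proof.
move=> S s0; rewrite le_eqVlt => /orP[/eqP -> _|ss' s'b]; first by rewrite !subrr normr0 mulr0.
apply: cd_pair_norm_le => i; have [u /andP[h1 h2] ->] := sol_mean i S s0 ss' s'b.
rewrite normrM (@gtr0_norm _ (s' - s)) ?subr_gt0//.
apply: ler_wpM2r; first by rewrite subr_ge0 ltW.
apply: (sol_vel i S); first exact/ltW/(le_lt_trans s0).
exact: lt_trans s'b.
Qed.

Lemma sol_norm q be X s : is_sol rho J q be X -> 0 <= s -> s < be -> `|X s| <= `|q| + s * C.
Proof.
move=> S s0 sb; have [X0 _ _ _] := S.
have := sol_speed S (lexx 0) s0 sb; rewrite X0 subr0 mulrC => h.
by rewrite -(subrK q (X s)) addrC; apply: le_trans (ler_normD _ _) _; rewrite lerD2l.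
Qed.

Section Horizon.
Variables (q : R * R) (be t : R).
Hypotheses (tb : t < be) (tT : t <= T) (qb : `|q| + t * C <= b).

Lemma sol_agree X s : is_sol rho J q be X -> 0 <= s -> s <= t ->
  r s (X s) = rho s (X s) /\ j s (X s) = J s (X s).
Proof.
move=> S s0 st; have sb := le_lt_trans st tb; have [QX _] := sol_pos S s0 sb.
apply: agree => //; [exact: le_trans tT|exact: ltW|].
apply: le_trans (sol_norm S s0 sb) _; apply: le_trans qb; rewrite lerD2l.
exact: ler_wpM2r.
Qed.

(** The mean velocity over [[s, s']] is the velocity at an intermediate time. Up to then time and
    position have moved by at most [(1 + C) * (s' - s)], and the velocity of the solution is that of
    the capped field, which is Lipschitz. *)
Lemma sol_trajectory dl X : 0 < dl -> is_sol rho J q be X ->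
  (forall s, 0 <= s -> s <= t -> dl <= rho s (X s)) ->
  trajectory r j dl ((1 + C) * L / dl * (1 + C)) t X.
Proof.
move=> dl0 S Xd; split => [s s0 st|s s' i s0].
  by rewrite (sol_agree S s0 st).1; exact: Xd.
rewrite le_eqVlt => /orP[/eqP -> _|ss' s't].
  by rewrite !subrr mul0r subr0 normr0 expr0n mulr0.
have st : s <= t by exact: le_trans (ltW ss') s't.
have [u /andP[h1 h2] ->] := sol_mean i S s0 ss' (le_lt_trans s't tb).
have u0 : 0 <= u by exact/ltW/(le_lt_trans s0).
have ut : u <= t by exact: le_trans (ltW h2) s't.
have cv s1 : 0 <= s1 -> s1 <= t -> vel i X s1 = cd i (velocity j (capped r dl) s1 (X s1)).
  move=> s10 s1t; have [e1 e2] := sol_agree S s10 s1t.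
  rewrite cd_velocity /capped e1 e2 (max_idPr _)//; exact: Xd.
have -> : cd i (j s (X s)) / r s (X s) = vel i X s.
  by have [-> ->] := sol_agree S s0 st.
have -> : vel i X u * (s' - s) - (s' - s) * vel i X s = (vel i X u - vel i X s) * (s' - s) by ring.
rewrite normrM (@gtr0_norm _ (s' - s)) ?subr_gt0// expr2 mulrA.
apply: ler_wpM2r; first by rewrite subr_ge0 ltW.
rewrite !cv//.
have dnd s1 q1 : dl <= capped r dl s1 q1 by rewrite /capped le_max lexx.
have rdn s1 q1 : r s1 q1 <= capped r dl s1 q1 by rewrite /capped le_max lexx orbT.
apply: le_trans (cdB_norm_le i _ _) _.
apply: le_trans (velocity_lipschitz C0 jL jC dl0 (capped_lipschitz rL dl) dnd rdn _ _ _ _) _.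
rewrite -(mulrA ((1 + C) * L / dl) (1 + C)); apply: ler_wpM2l.
  by rewrite divr_ge0 ?mulr_ge0 ?addr_ge0// ltW.
rewrite mulrDl mul1r (@gtr0_norm _ (u - s)) ?subr_gt0//; apply: lerD.
  by rewrite lerD2r ltW.
apply: le_trans (sol_speed S s0 (ltW h1) (le_lt_trans ut tb)) _.
by apply: ler_wpM2l => //; rewrite lerD2r ltW.
Qed.

(** The density is continuous and positive along the solution on the compact [[0, t]], because the
    solution exists strictly beyond [t]; its minimum is the witness. *)
Lemma sol_positive X : 0 <= t -> is_sol rho J q be X ->
  exists2 dl, 0 < dl & forall s, 0 <= s -> s <= t -> dl <= rho s (X s).
Proof.
move=> t0 S.
pose g (s : R) := r (clampt t s) (X (clampt t s)).
have gL x y : `|g x - g y| <= L * (1 + C) * `|x - y|.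
  apply: le_trans (rL _ _ _ _) _; rewrite -mulrA; apply: ler_wpM2l => //.
  have cd := clampt_dist t0 x y.
  rewrite mulrDl mul1r; apply: lerD => //.
  apply: (@le_trans _ _ (C * `|clampt t x - clampt t y|)); last exact: ler_wpM2l.
  wlog le : x y cd / clampt t x <= clampt t y.
    move=> H; have [h|/ltW h] := leP (clampt t x) (clampt t y); first exact: H.
    by rewrite distrC (distrC (clampt t x)); apply: H => //; rewrite distrC (distrC y).
  rewrite distrC (distrC (clampt t x)) (@ger0_norm _ (clampt t y - _)) ?subr_ge0//.
  apply: (sol_speed S); rewrite ?clampt_ge0//.
  by apply: le_lt_trans tb; exact: clampt_le.
have gc : continuous g by exact: lipschitz_continuous gL.
have [c ct cm] := @EVT_min R g 0 t t0 (continuous_subspaceT gc).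
move: ct; rewrite in_itv /= => /andP[c0 ct].
exists (g c).
  rewrite /g clampt_id//; have [-> _] := sol_agree S c0 ct.
  by apply: (sol_pos S c0 _).2; exact: le_lt_trans tb.
move=> s s0 st; have := cm s; rewrite in_itv /= s0 st => /(_ isT); rewrite {2}/g clampt_id//.
by have [-> _] := sol_agree S s0 st.
Qed.

Lemma capped_trajectory dl K t' X : trajectory r j dl K t' X -> 
  trajectory (capped r dl) j dl K t' X.
Proof.
move=> [h1 h2]; split => [s s0 st|s s' i s0 ss' s't]; first by rewrite /capped le_max lexx.
rewrite /capped (max_idPr _); first exact: h2.
by apply: h1 => //; exact: le_trans s't.
Qed.

Lemma trajectory_weaken dl dl' K t' X : dl' <= dl -> trajectory r j dl K t' X -> trajectory r j dl' K t' X.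
Proof. by move=> dd [h1 h2]; split => // s s0 st; apply: le_trans dd _; exact: h1. Qed.

Lemma capped_flow_trajectory dl X p t' : capped_flow r j L C dl X ->
  trajectory (capped r dl) j dl (2 * ((1 + C) * L / dl * (1 + C))) t' (X^~ p).
Proof.
move=> [_ _ XK _ _]; split => [s s0 st|s s' i s0 ss' _]; first by rewrite /capped le_max lexx.
by apply: XK => //; exact: le_trans ss'.
Qed.

(** Uniqueness is applied with [capped r dl] as the density. It is at least [dl] everywhere, so the
    flow line is a trajectory for it unconditionally, and only [Y] has to stay off the nodes. *)
Lemma trajectory_flow dl K t' X Y p : 0 < dl -> 0 <= K -> 0 <= t' -> capped_flow r j L C dl X ->
  trajectory r j dl K t' Y -> Y 0 = p -> X t' p = Y t'.
Proof.
move=> dl0 K0 t'0 FX tY Y0; have [X0 _ _ _ _] := FX.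
move: t'0 tY; rewrite le_eqVlt => /orP[/eqP <- _|t'0 tY]; first by rewrite X0 Y0.
have rc s1 q1 : r s1 q1 <= capped r dl s1 q1 by rewrite /capped le_max lexx orbT.
have r0c s1 q1 : 0 <= capped r dl s1 q1 by exact: le_trans (rc _ _).
have jCc i s1 q1 : `|cd i (j s1 q1)| <= C * capped r dl s1 q1.
  by apply: le_trans (jC _ _ _) _; exact: ler_wpM2l.
have K'0 : 0 <= 2 * ((1 + C) * L / dl * (1 + C)).
  by rewrite mulr_ge0// mulr_ge0 ?addr_ge0// divr_ge0 ?mulr_ge0 ?addr_ge0// ltW.
apply: (@trajectory_unique _ _ _ _ _ L0 C0 (capped_lipschitz rL dl) jL r0c jCc _ _ _ _ (X^~ p) Y dl0 K'0 K0 t'0).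
- exact: capped_flow_trajectory.
- exact: capped_trajectory.
- by rewrite X0 Y0.
Qed.

Lemma trajectory_shorten dl K t' t'' X : t'' <= t' -> trajectory r j dl K t' X -> trajectory r j dl K t'' X.
Proof.
move=> tt [h1 h2]; split => [s s0 st|s s' i s0 ss' st]; first by apply: h1 => //; exact: le_trans tt.
by apply: h2 => //; exact: le_trans tt.
Qed.

Lemma sol_flow dl X Y s : 0 < dl -> capped_flow r j L C dl X -> is_sol rho J q be Y ->
  (forall s, 0 <= s -> s <= t -> dl <= rho s (Y s)) -> 0 <= s -> s <= t -> X s q = Y s.
Proof.
move=> dl0 FX S Yd s0 st; have [Y0 _ _ _] := S.
apply: (@trajectory_flow dl ((1 + C) * L / dl * (1 + C)) s X Y q dl0 _ s0 FX _ Y0).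
  by rewrite mulr_ge0 ?addr_ge0// divr_ge0 ?mulr_ge0 ?addr_ge0// ltW.
exact: trajectory_shorten st (sol_trajectory dl0 S Yd).
Qed.

End Horizon.

Lemma flow_sol dl X q be : 0 < dl -> capped_flow r j L C dl X -> QQ q -> be <= T -> `|q| + T * C <= b ->
  (forall s, 0 <= s -> s < be -> dl <= r s (X s q)) -> is_sol rho J q be (X^~ q).
Proof.
move=> dl0 FX Qq bT qb Xd; have [X0 XC XK XL Xdi] := FX.
have XQ s : 0 <= s -> QQ (X s q) by move=> s0; exact: Xdi.
have Xb s : 0 <= s -> s < be -> `|X s q| <= b.
  move=> s0 sb; apply: le_trans (flow_norm FX q s0) _; apply: le_trans qb; rewrite lerD2l.
  by apply: ler_wpM2r => //; exact: le_trans (ltW sb) bT.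
have ag s : 0 <= s -> s < be -> r s (X s q) = rho s (X s q) /\ j s (X s q) = J s (X s q).
  move=> s0 sb; apply: agree => //; [exact: le_trans (ltW sb) bT|exact/ltW/XQ|exact: Xb].
split => //.
- move=> s /andP[s0 sb]; split; first exact: XQ.
  by rewrite -(ag s s0 sb).1 gt_eqF//; apply: lt_le_trans (Xd s s0 sb).
- move=> s /andP[s0 sb].
  have d i : is_derive s 1 (fun u => cd i (X u q)) (cd i (J s (X s q)) / rho s (X s q)).
    apply: (@is_derive_quadratic _ _ _ (2 * ((1 + C) * L / dl * (1 + C)))) => // s' s'0.
    have := XK s s' q i (ltW s0) s'0; rewrite /capped (max_idPr _); last exact: Xd (ltW s0) sb.
    by have [-> ->] := ag s (ltW s0) sb.
  have [d1 e1] := d true; have [d2 e2] := d false.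
  by split; [exact: d1|exact: d2|rewrite derive1E; exact: e1|rewrite derive1E; exact: e2].
- apply/cvgrPdist_le => e e0; near=> u.
  have u0 : 0 <= u by near: u; apply: nbhs_right_ge.
  have ue : u <= e / (C + 1) by near: u; apply: nbhs_right_le; rewrite divr_gt0// ltr_wpDl.
  have := XC 0 u q (lexx 0) u0; rewrite X0 subr0 (ger0_norm u0) distrC => /le_trans; apply.
  apply: (@le_trans _ _ ((C + 1) * u)); first by apply: ler_wpM2r => //; rewrite lerDl.
  by rewrite mulrC -ler_pdivlMr// ltr_wpDl.
Unshelve. all: by end_near. Qed.

Hypothesis flows : forall dl, 0 < dl -> exists X, capped_flow r j L C dl X.

(** [flow_rel] asks for a solution that lasts beyond [t]. The flow capped at the lower level
    [dl / 2] agrees with [X] up to [t], and afterwards [r] needs some time to fall from [dl] to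
    [dl / 2]. *)
Lemma safe_flow_rel dl X q t : 0 < dl -> capped_flow r j L C dl X -> QQ q -> 0 <= t -> t < T -> `|q| + T * C <= b ->
  (forall s, 0 <= s -> s <= t -> dl <= r s (X s q)) ->
  exists be Y, [/\ t < be, is_sol rho J q be Y, Y t = X t q &
     forall s, 0 <= s -> s <= t -> dl <= rho s (Y s)].
Proof.
move=> dl0 FX Qq t0 tT qb Xd.
have hd0 : 0 < dl / 2 by rewrite divr_gt0.
have [Y FY] := flows hd0.
have tX : trajectory r j dl (2 * ((1 + C) * L / dl * (1 + C))) t (X^~ q).
  exact: (flow_trajectory FX (lexx t) Xd).
have K0 : 0 <= 2 * ((1 + C) * L / dl * (1 + C)).
  by rewrite mulr_ge0// mulr_ge0 ?addr_ge0// divr_ge0 ?mulr_ge0 ?addr_ge0// ltW.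
have [X0 _ _ _ _] := FX.
have YX s : 0 <= s -> s <= t -> Y s q = X s q.
  move=> s0 st; apply: (@trajectory_flow (dl / 2) _ s Y (X^~ q) q hd0 K0 s0 FY _ (X0 q)).
  by apply: trajectory_weaken (trajectory_shorten st tX); rewrite ler_pdivrMr// ler_peMr// ?ler1n// ltW.
have [Y0 YC _ _ Ydi] := FY.
(* The second term is [dl / 2] over a bound for the rate of change of [r] along the flow; the first
   keeps the solution within the horizon [T]. *)
pose eta := Num.min (T - t) (dl / (2 * (L * (1 + C) + 1))).
have LC : 0 < L * (1 + C) + 1 by rewrite ltr_wpDl// mulr_ge0// addr_ge0.
have eta0 : 0 < eta by rewrite lt_min subr_gt0 tT divr_gt0// mulr_gt0.
have Yd s : 0 <= s -> s < t + eta -> dl / 2 <= r s (Y s q).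
  move=> s0 se; have dl0' := dl0; have [st|st] := leP s t; first by rewrite YX//; have := Xd s s0 st; lra.
  have h1 := Xd t t0 (lexx t); rewrite -YX// in h1.
  have /norm_le_bounds[h2 _] := rL s t (Y s q) (Y t q).
  have h3 := YC t s q t0 s0; rewrite (@gtr0_norm _ (s - t)) ?subr_gt0// in h3 h2.
  have h4 : L * (s - t + `|Y s q - Y t q|) <= dl / 2.
    apply: (@le_trans _ _ ((L * (1 + C) + 1) * eta)).
      apply: (@le_trans _ _ ((L * (1 + C)) * (s - t))).
        by rewrite -mulrA; apply: ler_wpM2l => //; rewrite mulrDl mul1r lerD2l.
      apply: ler_pM; [by rewrite mulr_ge0// addr_ge0|by rewrite subr_ge0 ltW|by rewrite lerDl|].
      by rewrite lerBlDl ltW.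
    rewrite -ler_pdivlMl//; apply: (@le_trans _ _ (dl / (2 * (L * (1 + C) + 1)))); first by rewrite ge_min lexx orbT.
    by rewrite invfM mulrA mulrC.
  by lra.
exists (t + eta), (Y^~ q); split.
- by rewrite ltrDl.
- apply: (flow_sol hd0 FY) => //.
  have : eta <= T - t by rewrite ge_min lexx.
  lra.
- by rewrite YX.
- move=> s s0 st; rewrite YX//; apply: le_trans (Xd s s0 st) _.
  have QX : QQ (X s q) by have [_ _ _ _ Xdi] := FX; exact: Xdi.
  rewrite (agree s0 _ _ _).1//; [exact/ltW/(le_lt_trans st)|exact: ltW|].
  apply: le_trans (flow_norm FX q s0) _; apply: le_trans qb; rewrite lerD2l.
  by apply: ler_wpM2r => //; exact/ltW/(le_lt_trans st).
Qed.

(** Both solutions follow the flow capped at the smaller of their two minimal densities. *)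
Lemma sol_unique q t be be' X Y : 0 <= t -> t <= T -> `|q| + t * C <= b -> t < be -> t < be' ->
  is_sol rho J q be X -> is_sol rho J q be' Y -> X t = Y t.
Proof.
move=> t0 tT qb tb tb' SX SY.
have [d1 d10 h1] := sol_positive tb tT qb t0 SX.
have [d2 d20 h2] := sol_positive tb' tT qb t0 SY.
have d0 : 0 < Num.min d1 d2 by rewrite lt_min d10.
have [Z FZ] := flows d0.
rewrite -(sol_flow tb tT qb d0 FZ SX _ t0 (lexx t)) ?(sol_flow tb' tT qb d0 FZ SY _ t0 (lexx t))//.
- by move=> s s0 st; rewrite ge_min h2// orbT.
- by move=> s s0 st; rewrite ge_min h1.
Qed.

End Solutions.

(** * Measures determined by Lipschitz test functions *)

Section Determination.
Context {R : realType}.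

Lemma plane_monotone_cvg (h : nat -> R * R -> R) (f : R * R -> R) :
  (forall n, measurable_fun setT (h n)) -> (forall n q, 0 <= h n q) ->
  (forall q n m, (n <= m)%N -> h n q <= h m q) -> (forall q, (fun n => h n q) @ \oo --> f q) ->
  (fun n => \int[@leb2 R]_q (h n q)%:E)%E @ \oo --> (\int[@leb2 R]_q (f q)%:E)%E.
Proof.
move=> mh h0 hm hf.
have mh' n : measurable_fun setT (fun q => (h n q)%:E) by exact/measurable_EFinP.
have := @cvg_monotone_convergence _ _ R (@leb2 R) setT measurableT (fun n q => (h n q)%:E) mh'.
have h0' : forall n x, setT x -> (0 <= (h n x)%:E)%E by move=> n x _; rewrite lee_fin.
have hm' : forall x, setT x -> {homo (fun n => (h n x)%:E) : n m / (n <= m)%N >-> (n <= m)%E}.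
  by move=> x _ n m nm; rewrite lee_fin; exact: hm.
move=> /(_ h0' hm').
rewrite (_ : (\int[_]_(x in _) _)%E = (\int[@leb2 R]_q (f q)%:E)%E)//.
apply: eq_integral => q _; apply: cvg_lim => //; apply: cvg_EFin; first by near=> n.
exact: hf.
Unshelve. all: by end_near. Qed.

(** The integral of [h] against the image under [Phi] of the measure with density [v], kept as a
    functional so that no image measure has to be formed. *)
Definition average (Phi : R * R -> R * R) (v h : R * R -> R) : \bar R :=
  (\int[@leb2 R]_q (h (Phi q) * v q)%:E)%E.

Section Average.
Variables (Phi : R * R -> R * R) (v : R * R -> R).
Hypotheses (mPhi : measurable_fun setT Phi) (mv : measurable_fun setT v) (v0 : forall q, 0 <= v q)
  (v1 : (\int[@leb2 R]_q (v q)%:E = 1)%E).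
Local Notation E := (average Phi v).

Let mh (h : R * R -> R) : measurable_fun setT h -> measurable_fun setT (fun q => h (Phi q) * v q).
Proof. by move=> m; apply: measurable_funM => //; exact: measurableT_comp m mPhi. Qed.

Lemma average_ge0 (h : R * R -> R) : (forall q, 0 <= h q) -> (0 <= E h)%E.
Proof. by move=> h0; apply: integral_ge0 => q _; rewrite lee_fin mulr_ge0. Qed.

Lemma averageD (h k : R * R -> R) : measurable_fun setT h -> measurable_fun setT k ->
  (forall q, 0 <= h q) -> (forall q, 0 <= k q) -> E (fun q => h q + k q) = (E h + E k)%E.
Proof.
move=> mh1 mk1 h0 k0; rewrite /average -ge0_integralD//.
- by apply: eq_integral => q _; rewrite mulrDl EFinD.
- by move=> q _; rewrite lee_fin mulr_ge0.
- by apply/measurable_EFinP; exact: (mh mh1).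
- by move=> q _; rewrite lee_fin mulr_ge0.
- by apply/measurable_EFinP; exact: (mh mk1).
Qed.

Lemma average1 : E (cst 1) = 1%E.
Proof. by rewrite -v1; apply: eq_integral => q _; rewrite mul1r. Qed.

Lemma average_compl (h : R * R -> R) : measurable_fun setT h -> (forall q, 0 <= h q) -> (forall q, h q <= 1) ->
  (E h + E (fun q => (1 - h q)%R) = 1)%E.
Proof.
move=> m h0 h1; rewrite -averageD//.
- by rewrite -average1; apply: eq_integral => q _; rewrite /= addrC subrK.
- by apply: measurable_funB => //; exact: measurable_cst.
- by move=> q; rewrite subr_ge0.
Qed.

Lemma average_fin (h : R * R -> R) : measurable_fun setT h -> (forall q, 0 <= h q) -> (forall q, h q <= 1) ->
  E h \is a fin_num.
Proof.
move=> m h0 h1; rewrite ge0_fin_numE ?average_ge0//.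
apply: (@le_lt_trans _ _ 1%E); last exact: ltry.
rewrite -(average_compl m h0 h1) leeDl// average_ge0// => q.
by rewrite subr_ge0.
Qed.

Lemma average_cvg (h : nat -> R * R -> R) f : (forall n, measurable_fun setT (h n)) ->
  (forall n q, 0 <= h n q) -> (forall q n m, (n <= m)%N -> h n q <= h m q) ->
  (forall q, (fun n => h n q) @ \oo --> f q) -> (fun n => E (h n)) @ \oo --> E f.
Proof.
move=> m h0 hm hf; apply: plane_monotone_cvg => //.
- by move=> n; exact: mh.
- by move=> n q; rewrite mulr_ge0.
- by move=> q n k nk; apply: ler_wpM2r => //; exact: hm.
- by move=> q; apply: cvgM; [exact: hf|exact: cvg_cst].
Qed.

End Average.

(** Stable under intersection through [Num.min], as a pi-system must be, and each member's indicator
    is an increasing limit of Lipschitz functions. *)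
Definition lipschitz_open : set (set (R * R)) :=
  [set A | exists phi M, [/\ 0 <= M, lipschitz2 M phi & A = [set q | 0 < phi q]]].

(** Preimages of open half-lines under the two projections are members, and they generate the
    product sigma-algebra. *)
Lemma measurable_lipschitz_open (A : set (R * R)) : measurable A -> <<s lipschitz_open >> A.
Proof.
have sG : sigma_algebra setT <<s lipschitz_open >> by exact: smallest_sigma_algebra.
have [s0 sC sU] := sG.
have prj (pr : R * R -> R) : (forall p q, `|pr p - pr q| <= `|p - q|) ->
    preimage_set_system setT pr measurable `<=` <<s lipschitz_open >>.
  move=> prL _ [B mB <-]; rewrite setTI.
  have GB : <<s @RGenOInfty.G R >> B by have := mB; rewrite [X in X B]RGenOInfty.measurableE.
  pose S := [set B : set R | <<s lipschitz_open >> (pr @^-1` B)].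
  suff : <<s @RGenOInfty.G R >> `<=` S by exact.
  apply: smallest_sub.
    split; rewrite /S /=.
    - by rewrite preimage_set0; exact: s0.
    - by move=> C SC; rewrite setTD preimage_setC -setTD; exact: sC.
    - by move=> F SF; rewrite preimage_bigcup; exact: sU.
  move=> _ [x ->]; apply: sub_sigma_algebra; exists (fun q => pr q - x), 1; split => //.
    by move=> p q; rewrite mul1r opprB addrA subrK.
  by apply/seteqP; split => q; rewrite /= in_itv /= andbT subr_gt0.
apply: smallest_sub => //; rewrite subUset; split; apply: prj => p q.
- exact: fst_norm_le (p - q).
- exact: snd_norm_le (p - q).
Qed.

(** The inequality tested on [g] and on [1 - g] is an equality, since both total masses are one.
    Monotone limits carry it to the sets of [lipschitz_open], and the pi-lambda theorem to all
    measurable sets. *)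
Theorem average_determined (Phi : R * R -> R * R) (v w : R * R -> R) :
  measurable_fun setT Phi -> measurable_fun setT v -> measurable_fun setT w ->
  (forall q, 0 <= v q) -> (forall q, 0 <= w q) ->
  (\int[@leb2 R]_q (v q)%:E = 1)%E -> (\int[@leb2 R]_q (w q)%:E = 1)%E ->
  (forall g M, 0 <= M -> lipschitz2 M g -> (forall q, 0 <= g q) -> (forall q, g q <= 1) ->
     (average Phi v g <= average id w g)%E) ->
  forall A, measurable A -> average Phi v \1_A = average id w \1_A.
Proof.
move=> mPhi mv mw v0 w0 v1 w1 H.
have mi : measurable_fun setT (@id (R * R)) by exact: measurable_id.
have eqL g M : 0 <= M -> lipschitz2 M g -> (forall q, 0 <= g q) -> (forall q, g q <= 1) ->
    average Phi v g = average id w g.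
  move=> M0 gM g0 g1; have mg := lipschitz2_measurable gM.
  apply/eqP; rewrite eq_le (H _ _ M0 gM g0 g1) /=.
  have gM' : lipschitz2 M (fun q => 1 - g q).
    move=> p q; have -> : 1 - g p - (1 - g q) = g q - g p by ring.
    by rewrite distrC; exact: gM.
  have g0' q : 0 <= 1 - g q by rewrite subr_ge0.
  have g1' q : 1 - g q <= 1 by rewrite gerBl.
  have h := H _ _ M0 gM' g0' g1'.
  have f1 := average_fin mPhi mv v0 v1 mg g0 g1.
  have f2 := average_fin mi mw w0 w1 mg g0 g1.
  have mg' := lipschitz2_measurable gM'.
  have f3 := average_fin mPhi mv v0 v1 mg' g0' g1'.
  have f4 := average_fin mi mw w0 w1 mg' g0' g1'.
  have c1 := average_compl mPhi mv v0 v1 mg g0 g1.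
  have c2 := average_compl mi mw w0 w1 mg g0 g1.
  move: h c1 c2; rewrite -(fineK f1) -(fineK f2) -(fineK f3) -(fineK f4) -!EFinD !lee_fin.
  by move=> h [c1] [c2]; lra.
have eqO A : lipschitz_open A -> average Phi v \1_A = average id w \1_A.
  move=> [phi [M [M0 phiM ->]]].
  pose h (n : nat) q := Num.min 1 (n%:R * Num.max 0 (phi q)).
  have mphi := lipschitz2_measurable phiM.
  have h0 n q : 0 <= h n q by rewrite le_min ler01 mulr_ge0// le_max lexx.
  have h1 n q : h n q <= 1 by rewrite ge_min lexx.
  have hL n : lipschitz2 (n%:R * M) (h n).
    move=> p q; apply: le_trans (minr_dist _ _ _) _; rewrite -mulrBr normrM normr_nat -mulrA.
    by apply: ler_wpM2l => //; apply: le_trans (maxr_dist _ _ _) _; exact: phiM.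
  have mh n := lipschitz2_measurable (hL n).
  have hm q n m : (n <= m)%N -> h n q <= h m q.
    move=> nm; rewrite /h le_min !ge_min lexx /=; apply/orP; right.
    by apply: ler_wpM2r; rewrite ?le_max ?lexx// ler_nat.
  have hc q : (fun n => h n q) @ \oo --> (\1_[set q | 0 < phi q] q : R).
    rewrite indicE; have [p|p] := ltP 0 (phi q).
      rewrite mem_set//; apply: cvg_near_cst; near=> n.
      rewrite /h (max_idPr (ltW p)); apply/min_idPl; rewrite -ler_pdivrMr// mul1r.
      by near: n; exact: nbhs_infty_ger.
    rewrite memNset; last by apply/negP; rewrite -leNgt.
    apply: cvg_near_cst; apply: nearW => n.
    by rewrite /h (max_idPl p) mulr0; apply/min_idPr.
  have c1 := average_cvg mPhi mv v0 mh h0 hm hc.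
  have c2 := average_cvg mi mw w0 mh h0 hm hc.
  have e n : average Phi v (h n) = average id w (h n) by apply: (eqL _ (n%:R * M)); rewrite ?mulr_ge0.
  rewrite -(cvg_lim _ c1)// -(cvg_lim _ c2)//.
  by congr (limn _); apply/funext.
have ind0 (A : set (R * R)) q : 0 <= \1_A q :> R by rewrite indicE.
have ind1 (A : set (R * R)) q : \1_A q <= 1 :> R by rewrite indicE; case: (q \in A).
have mind (A : set (R * R)) : measurable A -> measurable_fun setT (\1_A : R * R -> R) by exact: measurable_indic.
pose S := [set A : set (R * R) | measurable A /\ average Phi v \1_A = average id w \1_A].
have LO (A : set (R * R)) : lipschitz_open A -> measurable A.
  by move=> [phi [M [M0 phiM ->]]]; apply: measurable_superlevel; exact: lipschitz2_measurable phiM.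
have sS : <<s lipschitz_open >> `<=` S.
  apply: lambda_system_subset => //.
  - move=> _ _ [f [M [M0 fM ->]]] [g [M' [M'0 gM' ->]]].
    exists (fun q => Num.min (f q) (g q)), (M + M'); split; first exact: addr_ge0.
      by move=> p q; rewrite mulrDl; apply: min_dist.
    by apply/seteqP; split => q /=; rewrite lt_min => /andP.
  - split => //.
    + split => //; rewrite (_ : \1_setT = cst 1); last by apply/funext => q; rewrite indicE in_setT.
      by rewrite (average1 Phi v1) (average1 id w1).
    + move=> A B BA [mA eA] [mB eB]; have mAB : measurable (A `\` B) by exact: measurableD.
      split => //.
      have e : \1_A = (fun q => \1_(A `\` B) q + \1_B q) :> (R * R -> R).
        apply/funext => q; rewrite !indicE in_setD.
        case: (boolP (q \in B)) => [/set_mem/BA/mem_set ->|]; first by rewrite andbF add0r.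
        by rewrite andbT addr0.
      move: eA; rewrite e (averageD mPhi mv v0 (mind _ mAB) (mind _ mB))//.
      rewrite (averageD mi mw w0 (mind _ mAB) (mind _ mB))// eB.
      have f := average_fin mi mw w0 w1 (mind _ mB) (ind0 B) (ind1 B).
      by move=> /(congr1 (fun x => x - average id w \1_B)%E); rewrite !addeK.
    + move=> F ndF SF; split; first by apply: bigcup_measurable => n _; exact: (SF n).1.
      have mF n := mind _ (SF n).1.
      have hm q n m : (n <= m)%N -> \1_(F n) q <= \1_(F m) q :> R.
        move=> nm; rewrite !indicE; have /subsetPset s := ndF n m nm.
        by case: (boolP (q \in F n)) => [/set_mem/s/mem_set ->|].
      have hc q : (fun n => \1_(F n) q : R) @ \oo --> (\1_(\bigcup_n F n) q : R).
        have [[N _ FN]|nF] := pselect ((\bigcup_n F n) q).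
          rewrite [X in _ --> X]indicE mem_set; last by exists N.
          apply: cvg_near_cst; exists N => // n /= Nn.
          by rewrite indicE mem_set//; have /subsetPset := ndF N n Nn; apply.
        rewrite [X in _ --> X]indicE memNset//; apply: cvg_near_cst; apply: nearW => n.
        by rewrite indicE memNset// => Fn; apply: nF; exists n.
      have c1 := average_cvg mPhi mv v0 mF (fun n => ind0 (F n)) hm hc.
      have c2 := average_cvg mi mw w0 mF (fun n => ind0 (F n)) hm hc.
      rewrite -(cvg_lim _ c1)// -(cvg_lim _ c2)//.
      by congr (limn _); apply/funext => n; exact: (SF n).2.
  - by move=> A LA; split; [exact: LO|exact: eqO].
by move=> A mA; have [] := sS A (measurable_lipschitz_open mA).
Unshelve. all: by end_near. Qed.

End Determination.

(** * Equivariance *)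

Section Equivariance.
Context {R : realType}.
Variables (rho : R -> R * R -> R) (J : R -> R * R -> R * R) (C : R).
Hypotheses (Hlip_rho : loc_lipschitz_on dom (fun p => rho p.1 p.2))
  (Hlip_J1 : loc_lipschitz_on dom (fun p => (J p.1 p.2).1))
  (Hlip_J2 : loc_lipschitz_on dom (fun p => (J p.1 p.2).2))
  (Hnonneg : forall t q, 0 <= t -> QQbar q -> 0 <= rho t q)
  (H1 : exists N : set (R * (R * R)), leb3.-negligible N /\
     forall t q, 0 < t -> QQ q -> ~ N (t, q) ->
       [/\ derivable (fun s => rho s q) t 1,
           derivable (fun x => (J t (x, q.2)).1) q.1 1,
           derivable (fun y => (J t (q.1, y)).2) q.2 1
         & derive1 (fun s => rho s q) t
           + derive1 (fun x => (J t (x, q.2)).1) q.1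
           + derive1 (fun y => (J t (q.1, y)).2) q.2 = 0])
  (H3 : forall t, 0 <= t -> (\int[leb2]_(q in QQ) (rho t q)%:E = 1%:E)%E)
  (C0 : 0 < C) (H4 : forall t q, 0 <= t -> QQbar q ->
     Num.sqrt ((J t q).1 ^+ 2 + (J t q).2 ^+ 2) <= C * rho t q)
  (H6 : forall t q, 0 <= t -> q.1 = q.2 -> `|(J t q).1 - (J t q).2| = 0).

Let JC i s q : 0 <= s -> QQbar q -> `|cd i (J s q)| <= C * rho s q.
Proof. exact: J_norm. Qed.

Lemma measurable_QQ : measurable (@QQ R).
Proof.
have : measurable [set q : R * R | 0 < q.2 - q.1].
  by apply: measurable_superlevel; apply: measurable_funB; [exact: measurable_snd|exact: measurable_fst].
by congr measurable; apply/seteqP; split => q; rewrite /QQ /= subr_gt0.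
Qed.

Definition weight s q : R := \1_QQ q * rho s q.

Lemma weight_ge0 s q : 0 <= s -> 0 <= weight s q.
Proof.
move=> s0; rewrite /weight indicE; have [/set_mem h|_] := boolP (q \in QQ); last by rewrite mul0r.
by rewrite mul1r Hnonneg//; exact: ltW.
Qed.

Lemma mu_weight s (A : set (R * R)) : mu rho s A = (\int[@leb2 R]_q (\1_A q * weight s q)%:E)%E.
Proof.
rewrite /mu integral_mkcond; apply: eq_integral => q _; rewrite patchE /weight !indicE in_setI.
by case: (q \in A); case: (q \in QQ); rewrite /= ?mul0r ?mulr0 ?mul1r.
Qed.

Lemma weight_total s : 0 <= s -> (\int[@leb2 R]_q (weight s q)%:E = 1)%E.
Proof.
move=> s0; rewrite -(H3 s0) [RHS]integral_mkcond; apply: eq_integral => q _.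
by rewrite patchE /weight indicE; case: (q \in QQ); rewrite ?mul0r ?mul1r.
Qed.

(** * The flow map at a fixed positive time *)

Section Time.
Variable t : R.
Hypothesis t0 : 0 < t.

(** Test functions must cover everything reached from [square n%:R], and pulling them back widens
    their support by [t * C] once more: hence the factor 2. The horizon [t + 1] leaves room for
    solutions to last beyond [t]. *)
Let bx (n : nat) : R := n%:R + 2 * ((t + 1) * C) + 3.
Let r n := field_r rho (t + 1) (bx n).
Let j n := field_j J (t + 1) (bx n).
Let hn n : R := harmonic n.

Let hn0 n : 0 < hn n. Proof. by rewrite invr_gt0. Qed.
Let T10 : 0 <= t + 1. Proof. by have := t0; lra. Qed.
Let tT1 : t < t + 1. Proof. by rewrite ltrDl. Qed.
Let tC0 : 0 <= (t + 1) * C. Proof. by rewrite mulr_ge0// ltW. Qed.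
Let bx0 n : 0 <= bx n. Proof. by rewrite !addr_ge0// mulr_ge0. Qed.
Let bxT n (q : R * R) : `|q| <= n%:R -> `|q| + (t + 1) * C <= bx n.
Proof. by move=> h; have := tC0; rewrite /bx; set x := _ * C; lra. Qed.
Let tCT : t * C <= (t + 1) * C. Proof. by apply: ler_wpM2r; exact: ltW. Qed.
Let bxt n (q : R * R) : `|q| <= n%:R -> `|q| + t * C <= bx n.
Proof. by move=> h; apply: le_trans (bxT h); rewrite lerD2l. Qed.

Definition chart n (L B : R) (X : R -> R -> R * R -> R * R) :=
  [/\ 0 <= L, lipschitz3 L (r n) & forall i, lipschitz3 L (fun s q => cd i (j n s q))] /\
  [/\ forall s q, 0 <= r n s q, forall s q, r n s q <= B,
      forall i s q, `|cd i (j n s q)| <= C * r n s q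
    & forall s x, (j n s (x, x)).1 = (j n s (x, x)).2] /\
  forall dl, 0 < dl -> capped_flow (r n) (j n) L C dl (X dl).

Lemma chart_exists n : exists L B X, chart n L B X.
Proof.
have [L [B [F1 F2]]] := reflected_fields Hlip_rho Hlip_J1 Hlip_J2 Hnonneg H4 H6 T10 (bx0 n).
exists L, B; have [L0 rL jL] := F1; have [r0 rB jC jd] := F2.
have ex (dl : R) : exists X, 0 < dl -> capped_flow (r n) (j n) L C dl X.
  have [d0|d0] := ltP 0 dl; last by exists (fun=> id) => h; exfalso; lra.
  by have [X HX] := capped_flow_exists L0 (ltW C0) rL jL jC d0; exists X.
by have [X HX] := choice ex; exists X.
Qed.

Section Charts.
Variables (L B : nat -> R) (X : nat -> R -> R -> R * R -> R * R).
Hypothesis CH : forall n, chart n (L n) (B n) (X n).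

Let L0 n : 0 <= L n. Proof. by have [[]] := CH n. Qed.
Let rL n : lipschitz3 (L n) (r n). Proof. by have [[]] := CH n. Qed.
Let jL n i : lipschitz3 (L n) (fun s q => cd i (j n s q)). Proof. by have [[_ _ h] _] := CH n; exact: h. Qed.
Let r0 n s q : 0 <= r n s q. Proof. by have [_ [[->]]] := CH n. Qed.
Let rB n s q : r n s q <= B n. Proof. by have [_ [[_ ->]]] := CH n. Qed.
Let jC n i s q : `|cd i (j n s q)| <= C * r n s q. Proof. by have [_ [[_ _ ->]]] := CH n. Qed.
Let jd n s x : (j n s (x, x)).1 = (j n s (x, x)).2. Proof. by have [_ [[_ _ _ ->]]] := CH n. Qed.
Let FX n dl : 0 < dl -> capped_flow (r n) (j n) (L n) C dl (X n dl). Proof. by have [_ [_ +]] := CH n; exact. Qed.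
Let flows n dl : 0 < dl -> exists Y, capped_flow (r n) (j n) (L n) C dl Y.
Proof. by move=> d0; exists (X n dl); exact: FX. Qed.
Let agree n s q : 0 <= s -> s <= t + 1 -> QQbar q -> `|q| <= bx n -> r n s q = rho s q /\ j n s q = J s q.
Proof. by move=> *; split; [exact: field_r_id|exact: field_j_id]. Qed.
Let CE n : continuity_on (r n) (fun s q => (j n s q).1) (fun s q => (j n s q).2) (t + 1) (bx n).
Proof. exact: reflected_continuity. Qed.
Let tT1' : t <= t + 1. Proof. exact: ltW. Qed.
Let C0' : 0 <= C. Proof. exact: ltW. Qed.
Let t0' : 0 <= t. Proof. exact: ltW. Qed.

Definition arrival n q := X n (hn n) t q.
(** One index controls both the square and the density threshold, so that these sets increase with
    [n] and exhaust the points with a solution beyond [t]. *)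
Definition reach n : set (R * R) := QQ `&` square n%:R `&` safe (r n) (X n) t (hn n).

Lemma sq_bx n (q : R * R) : `|q| <= n%:R -> `|q| <= bx n.
Proof. by move=> h; apply: le_trans (bxt h); rewrite lerDl mulr_ge0. Qed.

Lemma safe_sol n (q : R * R) dl : 0 < dl -> QQ q -> `|q| <= n%:R -> safe (r n) (X n) t dl q ->
  exists be Y, [/\ t < be, is_sol rho J q be Y, Y t = X n dl t q &
    forall s, 0 <= s -> s <= t -> dl <= rho s (Y s)].
Proof.
move=> d0 Qq qn [_ /= /(@lowest_ge _ _ dl t q (density_ge0 (@r0 n) _ _) t0') low].
apply: (safe_flow_rel (@L0 n) C0' (@rL n) (@jL n) (@r0 n) (@jC n) (@jd n) (@agree n) (@flows n) d0 (FX n d0) Qq t0' tT1 (bxT qn)).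
by move=> s s0 st; have := low s s0 st; rewrite densityE.
Qed.

Lemma sol_reach n (q : R * R) be Y : `|q| <= n%:R -> t < be -> is_sol rho J q be Y ->
  (forall s, 0 <= s -> s <= t -> hn n <= rho s (Y s)) -> 2 * hn n <= rho 0 q ->
  reach n q /\ arrival n q = Y t.
Proof.
move=> qn tb S Yd q2; have [Y0 _ _ _] := S.
have [Qq _] := sol_pos Hnonneg S (lexx 0) (lt_trans t0 tb); rewrite Y0 in Qq.
have XY s : 0 <= s -> s <= t -> X n (hn n) s q = Y s.
  exact: (sol_flow (@L0 n) C0' (@rL n) (@jL n) (@r0 n) (@jC n) JC Hnonneg (@agree n) tb tT1' (bxt qn) (hn0 n) (FX n (hn0 n)) S Yd).
split; last exact: XY.
split; first by split.
split; rewrite /=.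
  by rewrite (agree _ _ _ _).1//; [exact: ltW|exact: sq_bx].
apply/lowest_ge => //; first by move=> *; exact: density_ge0.
move=> s s0 st; rewrite densityE// XY//.
have sb := le_lt_trans st tb; have [QY _] := sol_pos Hnonneg S s0 sb.
rewrite (agree _ _ _ _).1; first exact: Yd; rewrite //.
- exact: le_trans tT1'.
- exact: ltW.
- apply: le_trans (sol_norm JC Hnonneg S s0 sb) _; apply: le_trans (bxt qn); rewrite lerD2l.
  exact: ler_wpM2r.
Qed.

Lemma reach_sol n q : reach n q -> exists be Y, [/\ t < be, is_sol rho J q be Y, Y t = arrival n q &
    forall s, 0 <= s -> s <= t -> hn n <= rho s (Y s)].
Proof. by move=> [[Qq qn] s]; exact: safe_sol. Qed.

Lemma hn_le n m : (n <= m)%N -> hn m <= hn n.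
Proof. by move=> nm; rewrite /hn lef_pV2 ?posrE// ler_nat. Qed.

Lemma reach_mono n m q : (n <= m)%N -> reach n q -> reach m q /\ arrival m q = arrival n q.
Proof.
move=> nm Rn; have [be [Y [tb S Yt Yd]]] := reach_sol Rn.
have [[Qq qn] [/= q2 _]] := Rn.
rewrite -Yt; apply: (sol_reach _ tb S).
- by apply: le_trans qn _; rewrite ler_nat.
- by move=> s s0 st; apply: le_trans (hn_le nm) _; exact: Yd.
- move: q2; rewrite (agree _ _ _ _).1//; [|exact: ltW|exact: sq_bx].
  by apply: le_trans; rewrite ler_pM2l// hn_le.
Qed.

Lemma flow_rel_reach q p : flow_rel rho J t q p -> exists2 n, reach n q & arrival n q = p.
Proof.
move=> [be [Y [tb [S Yp]]]].
pose k := (Num.truncn `|q|).+1.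
have qk : `|q| <= k%:R by exact/ltW/truncnS_gt.
have [dl dl0 Yd] := sol_positive (@L0 k) C0' (@rL k) JC Hnonneg (@agree k) tb tT1' (bxt qk) t0' S.
have [Y0 _ _ _] := S.
have d2 : 0 < dl / 2 by rewrite divr_gt0.
have /cvgrPdist_lt /(_ _ d2) [m _ Hm] := @cvg_harmonic R.
(* The square then contains [q], and the threshold [2 * hn n] lies below the minimal density [dl]
   along the solution. *)
pose n := maxn k m.
have hd : 2 * hn n <= dl.
  have := Hm n (leq_maxr _ _); rewrite /= sub0r normrN gtr0_norm//.
  by rewrite -/(hn n) => h; rewrite mulrC -ler_pdivlMr// ltW.
have hd1 : hn n <= dl by apply: le_trans hd; rewrite ler_peMl ?(ltW (hn0 n))// ler1n.
have [|s s0 st||Rn e] := @sol_reach n q be Y _ tb S.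
- by apply: le_trans qk _; rewrite ler_nat leq_maxl.
- by apply: le_trans hd1 _; exact: Yd.
- by apply: le_trans hd _; have := Yd 0 (lexx 0) t0'; rewrite Y0.
by exists n => //; rewrite e.
Qed.

(** Uniqueness makes the choice inside [flow] immaterial. The flow map becomes the common extension
    of the Lipschitz maps [arrival n] on the measurable sets [reach n], which gives its
    measurability. *)
Lemma flowE q p : flow rho J t q = Some p <-> exists2 n, reach n q & arrival n q = p.
Proof.
rewrite /flow gt_eqF//; split.
  case: pselect => // h [<-]; case: cid => p' /= Hp'.
  exact: flow_rel_reach.
move=> [n Rn Pn]; have [be [Y [tb S Yt Yd]]] := reach_sol Rn.
case: pselect => [h|nh]; last by exfalso; apply: nh; exists p, be, Y; split => //; rewrite Yt.
congr Some; case: cid => p' /= [be' [Y' [tb' [S' Yp']]]].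
rewrite -Yp' -Pn -Yt; have [[_ qn] _] := Rn.
exact: (sol_unique (@L0 n) C0' (@rL n) (@jL n) (@r0 n) (@jC n) JC Hnonneg (@agree n) (@flows n) t0' tT1' (bxt qn) tb' tb S' S).
Qed.

Lemma arrival_QQ n q : reach n q -> QQ (arrival n q).
Proof.
move=> Rn; have [be [Y [tb S <- _]]] := reach_sol Rn.
by have [] := sol_pos Hnonneg S t0' tb.
Qed.

Lemma measurable_reach n : measurable (reach n).
Proof.
apply: measurableI; first by apply: measurableI; [exact: measurable_QQ|exact: measurable_square].
exact: (measurable_safe (@L0 n) C0' (@rL n) (@r0 n) (@FX n) t0' (hn0 n)).
Qed.

Lemma measurable_arrival n : measurable_fun setT (arrival n).
Proof.
have [_ _ _ XL _] := FX n (hn0 n).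
rewrite (_ : arrival n = fun q => ((arrival n q).1, (arrival n q).2)); last first.
  by apply/funext => q; rewrite -surjective_pairing.
apply: measurable_fun_pair.
- apply: (@lipschitz2_measurable R (expR (t * ((1 + C) * L n / hn n)))) => p q.
  by apply: le_trans (fst_norm_le (arrival n p - arrival n q)) _; exact: XL.
- apply: (@lipschitz2_measurable R (expR (t * ((1 + C) * L n / hn n)))) => p q.
  by apply: le_trans (snd_norm_le (arrival n p - arrival n q)) _; exact: XL.
Qed.

Lemma measurable_weight s : 0 <= s -> s <= t + 1 -> measurable_fun setT (weight s).
Proof.
move=> s0 sT.
apply: (@measurable_fun_cvg _ _ R setT (fun n q => \1_(QQ `&` square n%:R) q * r n s q)).
  move=> n; apply: measurable_funM.
    by apply: measurable_indic; apply: measurableI; [exact: measurable_QQ|exact: measurable_square].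
  exact: lipschitz2_measurable (lipschitz3_slice s (@rL n)).
move=> q _; apply: cvg_near_cst; near=> n.
have qn : `|q| <= n%:R by near: n; exact: nbhs_infty_ger.
rewrite /weight !indicE in_setI [X in _ && X]mem_set// andbT.
have [/set_mem Qq|] := boolP (q \in QQ); last by rewrite !mul0r.
by rewrite (agree _ _ _ _).1//; [exact: ltW|exact: sq_bx].
Unshelve. all: by end_near. Qed.

Let G := \bigcup_n reach n.
Let mG : measurable G. Proof. by apply: bigcup_measurable => n _; exact: measurable_reach. Qed.

(** The graveyard is replaced by [q] itself, a harmless value because [start] vanishes at such
    points. *)
Definition landing q := if flow rho J t q is Some p then p else q.

Lemma landing_reach n q : reach n q -> landing q = arrival n q.
Proof.
move=> Rn.
have : flow rho J t q = Some (arrival n q) by apply/flowE; exists n.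
by rewrite /landing => ->.
Qed.

Lemma flow_preimage (A : set (R * R)) :
  [set q | exists p, flow rho J t q = Some p /\ A p] = \bigcup_n (reach n `&` arrival n @^-1` A).
Proof.
apply/seteqP; split => q /=.
  by move=> [p [/flowE[n Rn Pn] Ap]]; exists n => //; split => //=; rewrite Pn.
by move=> [n _ [Rn Ap]]; exists (arrival n q); split => //; apply/flowE; exists n.
Qed.

Lemma measurable_flow_preimage (A : set (R * R)) : measurable A ->
  measurable [set q | exists p, flow rho J t q = Some p /\ A p].
Proof.
move=> mA; rewrite flow_preimage; apply: bigcup_measurable => n _.
apply: measurableI; first exact: measurable_reach.
by have := measurable_arrival n measurableT mA; rewrite setTI.
Qed.

Lemma measurable_landing : measurable_fun setT landing.
Proof.
move=> _ A mA; rewrite setTI.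
rewrite (_ : _ @^-1` _ = [set q | exists p, flow rho J t q = Some p /\ A p] `|` (~` G `&` A)).
  apply: measurableU; first exact: measurable_flow_preimage.
  by apply: measurableI => //; exact: measurableC.
apply/seteqP; split => q /=.
  rewrite /landing; case e : (flow rho J t q) => [p|] Ap; first by left; exists p.
  right; split => // -[n _ Rn].
  by have : flow rho J t q = Some (arrival n q) by [apply/flowE; exists n]; rewrite e.
move=> [[p [e Ap]]|[nG Aq]]; first by rewrite /landing e.
rewrite /landing; case e : (flow rho J t q) => [p|]//.
by exfalso; apply: nG; have /flowE[n Rn _] := e; exists n.
Qed.

Let start q : R := \1_G q * weight 0 q.

Let mw0 : measurable_fun setT (weight 0). Proof. exact: measurable_weight. Qed.
Let mwt : measurable_fun setT (weight t). Proof. exact: measurable_weight. Qed.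

(** In each square, a point of positive weight outside [G] is [unsafe], since safety at any level
    would yield a solution beyond [t]. Monotone convergence over the squares concludes. *)
Lemma lost_null : (\int[@leb2 R]_q (\1_(~` G) q * weight 0 q)%:E = 0)%E.
Proof.
have w0 q : 0 <= weight 0 q by exact: weight_ge0.
apply/eqP; rewrite eq_le; apply/andP; split; last first.
  by apply: integral_ge0 => q _; rewrite lee_fin mulr_ge0 ?indicE.
pose h n q := \1_(~` G `&` square n%:R) q * weight 0 q.
have mh n : measurable_fun setT (h n).
  apply: measurable_funM => //; apply: measurable_indic; apply: measurableI; first exact: measurableC.
  exact: measurable_square.
have h0 n q : 0 <= h n q by rewrite mulr_ge0 ?indicE.
have hm q n m : (n <= m)%N -> h n q <= h m q.
  move=> nm; apply: ler_wpM2r => //; rewrite !indicE !in_setI; case: (q \in ~` G) => //=.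
  have [/set_mem qn|] := boolP (q \in square n%:R) => //.
  by rewrite mem_set//; apply: le_trans qn _; rewrite ler_nat.
have hc q : (fun n => h n q) @ \oo --> \1_(~` G) q * weight 0 q.
  apply: cvg_near_cst; near=> n.
  have qn : `|q| <= n%:R by near: n; exact: nbhs_infty_ger.
  by rewrite /h !indicE in_setI [X in _ && X]mem_set// andbT.
have c := plane_monotone_cvg mh h0 hm hc.
rewrite -(cvg_lim _ c)//; apply: lime_le; first by apply/cvg_ex; eexists; exact: c.
apply: nearW => n.
have at1 : n%:R + 2 * (t * C) + 1 < bx n.
  by rewrite /bx; have := tCT; set x := t * C; set y := (t + 1) * C; lra.
have un := unsafe_null (@L0 n) C0' (@rL n) (@jL n) (@r0 n) (@rB n) (@jC n) (@FX n) t0' (ler0n R n) tT1 at1 (@CE n).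
have mun := measurable_unsafe (@L0 n) C0' (@rL n) (@r0 n) n%:R (@FX n) t0'.
have bun : bf2 (fun q => \1_(unsafe (r n) (X n) t n%:R) q * r n 0 q).
  apply: (bf2M (B := B n)); last by move=> q; rewrite ger0_norm.
    apply: (@bf2_supp _ _ n%:R 1).
    - exact: measurable_indic.
    - by move=> q; rewrite indicE; case: (_ \in _); rewrite ?normr1 ?normr0.
    - move=> q hq; rewrite indicE memNset// => -[[]].
      by rewrite /square /= leNgt hq.
  exact: lipschitz2_measurable (lipschitz3_slice 0 (@rL n)).
apply: (@le_trans _ _ (int2 (fun q => \1_(unsafe (r n) (X n) t n%:R) q * r n 0 q))%:E); last by rewrite lee_fin.
rewrite -int2E//; apply: ge0_le_integral => //.
- by move=> q _; rewrite lee_fin.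
- by apply/measurable_EFinP; exact: mh.
- by apply/measurable_EFinP; exact: bf2_measurable bun.
move=> q _; rewrite lee_fin /h /weight [\1_(_ `&` _) q]indicE.
have u0 : 0 <= \1_(unsafe (r n) (X n) t n%:R) q * r n 0 q by rewrite mulr_ge0 ?indicE.
have [/set_mem [nG qn]|_] := boolP (q \in ~` G `&` square n%:R); last by rewrite mul0r.
rewrite mul1r [\1_QQ q]indicE; have [/set_mem Qq|_] := boolP (q \in QQ); last by rewrite mul0r.
rewrite mul1r; have [rq|rq] := ltP 0 (rho 0 q); last exact: le_trans u0.
have e : r n 0 q = rho 0 q by rewrite (agree _ _ _ _).1//; [exact: ltW|exact: sq_bx].
rewrite e indicE mem_set ?mul1r//; split; first by split => //=; rewrite e.
move=> k _ sk; have [be [Y [tb S Yt _]]] := safe_sol (hn0 k) Qq qn sk.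
have [|m Rm _] := @flow_rel_reach q (Y t); first by exists be, Y.
by apply: nG; exists m.
Unshelve. all: by end_near. Qed.

Lemma start_total : (\int[@leb2 R]_q (start q)%:E = 1)%E.
Proof.
have w0 q : 0 <= weight 0 q by exact: weight_ge0.
rewrite -(weight_total (lexx 0)) -[LHS]adde0 -lost_null -ge0_integralD//.
- apply: eq_integral => q _; rewrite -EFinD /start -mulrDl; congr (_%:E).
  by rewrite !indicE in_setC; case: (q \in G); rewrite /= ?addr0 ?add0r mul1r.
- by move=> q _; rewrite lee_fin mulr_ge0 ?indicE.
- by apply/measurable_EFinP; apply: measurable_funM => //; exact: measurable_indic.
- by move=> q _; rewrite lee_fin mulr_ge0 ?indicE.
- by apply/measurable_EFinP; apply: measurable_funM => //; apply: measurable_indic; exact: measurableC.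
Qed.

(** The folded density also has mass below the diagonal. This factor vanishes there, so that only
    the original density is tested, and it increases to the indicator of [QQ], in which all arrivals
    lie. *)
Let edge (n : nat) (p : R * R) : R := Num.min 1 (n%:R * Num.max 0 (p.2 - p.1)).

Let edge_ge0 n p : 0 <= edge n p.
Proof. by rewrite le_min ler01 mulr_ge0// le_max lexx. Qed.

Let edge_le1 n p : edge n p <= 1. Proof. by rewrite ge_min lexx. Qed.

Let edge_lip n : lipschitz2 (n%:R * 2) (edge n).
Proof.
move=> p q; apply: le_trans (minr_dist _ _ _) _; rewrite -mulrBr normrM normr_nat -mulrA.
apply: ler_wpM2l => //; apply: le_trans (maxr_dist _ _ _) _.
have -> : p.2 - p.1 - (q.2 - q.1) = (p.2 - q.2) - (p.1 - q.1) by ring.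
apply: le_trans (ler_normB _ _) _.
have h1 := fst_norm_le (p - q); have h2 := snd_norm_le (p - q).
by apply: le_trans (lerD h2 h1) _; rewrite mulr_natl mulr2n.
Qed.

(** [transport_le] for the folded fields, tested on [g * edge n * cutoff a2]. On the left the cutoff
    is one at every arrival; on the right both factors only lower the integral and may be
    dropped. *)
Lemma chart_transport n (g : R * R -> R) M : 0 <= M -> lipschitz2 M g ->
  (forall q, 0 <= g q) -> (forall q, g q <= 1) ->
  (\int[@leb2 R]_q (\1_(reach n) q * (g (landing q) * edge n (landing q)) * weight 0 q)%:E <=
   average id (weight t) g)%E.
Proof.
move=> M0 gM g0 g1.
pose a2 := n%:R + t * C + 1.
have a20 : 0 <= a2 by rewrite !addr_ge0// mulr_ge0.
pose g' p := g p * edge n p * cutoff a2 p.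
pose M' := M + n%:R * 2 + 1.
have M'0 : 0 <= M' by rewrite !addr_ge0// mulr_ge0.
have prodL (f k : R * R -> R) A A' : lipschitz2 A f -> lipschitz2 A' k -> (forall q, 0 <= f q) -> (forall q, f q <= 1) ->
    (forall q, 0 <= k q) -> (forall q, k q <= 1) -> lipschitz2 (A + A') (fun q => f q * k q).
  move=> fA kA f0 f1 k0 k1 p q.
  have -> : f p * k p - f q * k q = (f p - f q) * k p + f q * (k p - k q) by ring.
  apply: le_trans (ler_normD _ _) _; rewrite [leRHS](mulrDl A) !normrM (ger0_norm (k0 p)) (ger0_norm (f0 q)).
  apply: lerD; first exact: le_trans (ler_piMr (normr_ge0 _) (k1 p)) (fA _ _).
  exact: le_trans (ler_piMl (normr_ge0 _) (f1 q)) (kA _ _).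
have ge0 q : 0 <= g q * edge n q by rewrite mulr_ge0.
have ge1 q : g q * edge n q <= 1 by rewrite -[leRHS]mul1r; apply: ler_pM.
have g'L : lipschitz2 M' g'.
  have p1 := prodL _ _ _ _ gM (@edge_lip n) g0 g1 (edge_ge0 n) (edge_le1 n).
  exact: (prodL _ _ _ _ p1 (cutoff_lipschitz a2) ge0 ge1 (cutoff_ge0 a2) (cutoff_le1 a2)).
have g'0 q : 0 <= g' q by rewrite mulr_ge0 ?cutoff_ge0.
have g'a q : a2 <= `|q| -> g' q = 0 by move=> hq; rewrite /g' cutoff_supp// mulr0.
have [X0 _ _ XL _] := FX n (hn0 n).
have XD q : reach n q -> trajectory (r n) (j n) (hn n) (2 * ((1 + C) * L n / hn n * (1 + C))) t ((X n (hn n))^~ q).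
  move=> [_ [_ /= /(@lowest_ge _ _ (hn n) t q (density_ge0 (@r0 n) _ _) t0') low]].
  apply: (flow_trajectory (FX n (hn0 n)) (lexx t)) => s s0 st.
  by have := low s s0 st; rewrite densityE.
have K0 : 0 <= 2 * ((1 + C) * L n / hn n * (1 + C)).
  by rewrite mulr_ge0// mulr_ge0 ?addr_ge0// divr_ge0 ?mulr_ge0 ?addr_ge0// ltW.
have abx : a2 + t * C < bx n.
  by rewrite /a2 /bx; have := tCT; set x := t * C; set y := (t + 1) * C; lra.
have mgX : measurable_fun setT (fun q : R * R => g' (X n (hn n) t q)).
  exact: measurableT_comp (lipschitz2_measurable g'L) (measurable_arrival n).
have Dsq : reach n `<=` square n%:R by move=> q [[]].
have mR := measurable_reach n.
have := transport_le (@L0 n) C0' (@rL n) (@jL n) (@r0 n) (@rB n) (@jC n) (hn0 n) K0 t0 tT1 a20 (ler0n R n)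
  M'0 abx (@CE n) mR Dsq (fun q _ => X0 q) XD mgX g'L g'0 g'a.
have g'B := lipschitz2_cpt_bounded M'0 a20 g'L g'a.
have rN s q : `|r n s q| <= B n by rewrite ger0_norm.
have mr s : measurable_fun setT (r n s) by exact: lipschitz2_measurable (lipschitz3_slice s (@rL n)).
have bD : bf2 (\1_(reach n) : R * R -> R).
  apply: (@bf2_supp _ _ n%:R 1).
  - exact: measurable_indic.
  - by move=> q; rewrite indicE; case: (_ \in _); rewrite ?normr1 ?normr0.
  - by move=> q hq; rewrite indicE memNset// => /Dsq; rewrite /square /= leNgt hq.
have b1 : bf2 (fun q => \1_(reach n) q * g' (X n (hn n) t q) * r n 0 q).
  by apply: (bf2M (B := B n)) => //; apply: (bf2M (B := M' * (2 * a2))).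
have b2 : bf2 (fun q => g' q * r n t q).
  apply: (bf2M (B := B n)) => //; apply: (@bf2_supp _ _ a2 (M' * (2 * a2))) => // [|q hq].
    exact: lipschitz2_measurable g'L.
  by rewrite g'a// ltW.
rewrite -lee_fin -!int2E// => h.
rewrite (_ : (fun q => (\1_(reach n) q * (g (landing q) * edge n (landing q)) * weight 0 q)%:E) =
   (fun q => (\1_(reach n) q * g' (X n (hn n) t q) * r n 0 q)%:E)); last first.
  apply/funext => q; congr (_%:E); rewrite indicE; have [/set_mem Rq|_] := boolP (q \in reach n); last first.
    by rewrite !mul0r.
  rewrite !mul1r (landing_reach Rq) -/(arrival n q).
  have [[Qq qn] _] := Rq.
  rewrite /g' cutoff1 ?mulr1; last first.
    rewrite /a2 addrK; apply: le_trans (flow_norm (FX n (hn0 n)) q t0') _.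
    by rewrite lerD2r.
  congr (_ * _); rewrite (agree _ _ _ _).1//; [|exact: ltW|exact: sq_bx].
  by rewrite /weight indicE mem_set// mul1r.
apply: le_trans h _; apply: ge0_le_integral => //.
- by move=> q _; rewrite lee_fin mulr_ge0.
- by apply/measurable_EFinP; exact: bf2_measurable b2.
- by apply/measurable_EFinP; apply: measurable_funM => //; exact: lipschitz2_measurable gM.
move=> q _; rewrite lee_fin /=.
have wt0 : 0 <= g q * weight t q by rewrite mulr_ge0// weight_ge0.
have [hq|hq] := leP a2 `|q|; first by rewrite g'a// mul0r.
have [Qq|Qq] := ltP q.1 q.2; last first.
  rewrite /g' /edge (max_idPl _) ?subr_le0// mulr0 (min_idPr _)//.
  by rewrite mulr0 !mul0r.
rewrite /weight indicE mem_set// mul1r (agree _ _ _ _).1//; [|exact: ltW|].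
  apply: ler_wpM2r; first by apply: Hnonneg => //; exact: ltW.
  apply: le_trans (ler_piMr (ge0 q) (cutoff_le1 _ _)) _; exact: ler_piMr.
by apply: ltW; apply: lt_trans hq _; apply: le_lt_trans abx; rewrite lerDl mulr_ge0.
Qed.

Lemma landing_average_le (g : R * R -> R) M : 0 <= M -> lipschitz2 M g ->
  (forall q, 0 <= g q) -> (forall q, g q <= 1) ->
  (average landing start g <= average id (weight t) g)%E.
Proof.
move=> M0 gM g0 g1.
have w0 q : 0 <= weight 0 q by exact: weight_ge0.
pose h n q := \1_(reach n) q * (g (landing q) * edge n (landing q)) * weight 0 q.
have mg := lipschitz2_measurable gM.
have mh n : measurable_fun setT (h n).
  apply: measurable_funM => //; apply: measurable_funM; first exact: measurable_indic (measurable_reach n).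
  apply: measurable_funM; first exact: measurableT_comp mg measurable_landing.
  exact: measurableT_comp (lipschitz2_measurable (@edge_lip n)) measurable_landing.
have h0 n q : 0 <= h n q by rewrite /h indicE mulr_ge0// mulr_ge0// mulr_ge0.
have hm q n m : (n <= m)%N -> h n q <= h m q.
  move=> nm; apply: ler_wpM2r => //; rewrite !indicE.
  have [/set_mem Rn|_] := boolP (q \in reach n); last by rewrite mul0r mulr_ge0// mulr_ge0.
  rewrite mem_set; last exact: (reach_mono nm Rn).1.
  rewrite !mul1r; apply: ler_wpM2l => //.
  rewrite /edge le_min !ge_min lexx /=; apply/orP; right.
  by apply: ler_wpM2r; rewrite ?le_max ?lexx// ler_nat.
have hc q : (fun n => h n q) @ \oo --> g (landing q) * start q.
  rewrite /start indicE; have [/set_mem [k _ Rk]|nG] := boolP (q \in G); last first.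
    apply: cvg_near_cst; apply: nearW => n; rewrite mul0r mulr0 /h indicE memNset ?mul0r// => Rn.
    by move/negP: nG; apply; apply/mem_set; exists n.
  have /= := arrival_QQ Rk; rewrite -(landing_reach Rk) /QQ /= -subr_gt0 => p.
  apply: cvg_near_cst; near=> n.
  have kn : (k <= n)%N by near: n; exact: nbhs_infty_ge.
  rewrite /h indicE mem_set; last exact: (reach_mono kn Rk).1.
  rewrite !mul1r /edge (max_idPr (ltW p)) (min_idPl _) ?mulr1//.
  by rewrite -ler_pdivrMr// mul1r; near: n; exact: nbhs_infty_ger.
have c := plane_monotone_cvg mh h0 hm hc.
rewrite /average -(cvg_lim _ c)//; apply: lime_le; first by apply/cvg_ex; eexists; exact: c.
by apply: nearW => n; exact: (chart_transport n M0 gM g0 g1).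
Unshelve. all: by end_near. Qed.

Lemma equivariant_chart (A : set (R * R)) : measurable A ->
  measurable [set q | exists p, flow rho J t q = Some p /\ A p] /\
  mu rho 0 [set q | exists p, flow rho J t q = Some p /\ A p] = mu rho t A.
Proof.
move=> mA; split; first exact: measurable_flow_preimage.
have start0 q : 0 <= start q by rewrite mulr_ge0 ?indicE ?weight_ge0.
have ms : measurable_fun setT start by apply: measurable_funM => //; exact: measurable_indic.
have := average_determined measurable_landing ms mwt start0 (fun q => weight_ge0 q t0') start_total (weight_total t0')
  landing_average_le mA.
rewrite !mu_weight => e; rewrite -[RHS]e; apply: eq_integral => q _; congr (_%:E).
rewrite /start [RHS]mulrA; congr (_ * _); rewrite !indicE.
have [/set_mem [n _ Rn]|nG] := boolP (q \in G); last first.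
  rewrite mulr0 memNset// => -[p [e1 _]].
  by move/negP: nG; apply; apply/mem_set; have /flowE[n Rn _] := e1; exists n.
rewrite mulr1; congr ((nat_of_bool _)%:R); rewrite (landing_reach Rn).
have e1 : flow rho J t q = Some (arrival n q) by apply/flowE; exists n.
apply/idP/idP => /set_mem h; apply/mem_set; last by exists (arrival n q).
by have [p [e2 Ap]] := h; move: e2; rewrite e1 => -[->].
Qed.

Lemma survivors : exists G' : set (R * R), [/\ measurable G',
  (\int[@leb2 R]_q (\1_(~` G') q * weight 0 q)%:E = 0)%E &
  forall q, G' q <-> exists be Y, t < be /\ is_sol rho J q be Y].
Proof.
exists G; split => //; first exact: lost_null.
move=> q; split => [[n _ Rn]|[be [Y [tb S]]]].
  by have [be [Y [tb S _ _]]] := reach_sol Rn; exists be, Y.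
have [|n Rn _] := @flow_rel_reach q (Y t); first by exists be, Y.
by exists n.
Qed.

End Charts.

Lemma charts : exists L B X, forall n, chart n (L n) (B n) (X n).
Proof.
have [L HL] := choice (fun n => chart_exists n).
have [B HB] := choice HL; have [X HX] := choice HB.
by exists L, B, X.
Qed.

End Time.
End Equivariance.

Theorem theorem3 (R : realType) (rho : R -> R * R -> R) (J : R -> R * R -> R * R)
  (* rho and J are locally Lipschitz on [0,oo) x closure(Q) *)
  (Hlip_rho : loc_lipschitz_on dom (fun p => rho p.1 p.2))
  (Hlip_J1 : loc_lipschitz_on dom (fun p => (J p.1 p.2).1))
  (Hlip_J2 : loc_lipschitz_on dom (fun p => (J p.1 p.2).2))
  (* rho takes values in [0,oo) *)
  (Hnonneg : forall t q, 0 <= t -> QQbar q -> 0 <= rho t q)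
  (* (1) continuity equation, Lebesgue-almost everywhere *)
  (H1 : exists N : set (R * (R * R)), leb3.-negligible N /\
     forall t q, 0 < t -> QQ q -> ~ N (t, q) ->
       [/\ derivable (fun s => rho s q) t 1,
           derivable (fun x => (J t (x, q.2)).1) q.1 1,
           derivable (fun y => (J t (q.1, y)).2) q.2 1
         & derive1 (fun s => rho s q) t
           + derive1 (fun x => (J t (x, q.2)).1) q.1
           + derive1 (fun y => (J t (q.1, y)).2) q.2 = 0])
  (* (2) *)
  (H2 : forall t q, 0 <= t -> QQbar q -> rho t q != 0 -> 0 < rho t q)
  (* (3) *)
  (H3 : forall t, 0 <= t -> (\int[leb2]_(q in QQ) (rho t q)%:E = 1%:E)%E)
  (* (4) *)
  (H4 : exists C : R, 0 < C /\ forall t q, 0 <= t -> QQbar q ->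
     Num.sqrt ((J t q).1 ^+ 2 + (J t q).2 ^+ 2) <= C * rho t q)
  (* (5) J and the first-order derivatives of rho (where they exist)
         are bounded on bounded sets *)
  (H5 : forall M : R, exists K : R, forall t q, 0 <= t -> QQbar q ->
     `|t| <= M -> `|q.1| <= M -> `|q.2| <= M ->
     [/\ `|(J t q).1| <= K, `|(J t q).2| <= K,
         (0 < t -> QQ q -> derivable (fun s => rho s q) t 1 ->
            `|derive1 (fun s => rho s q) t| <= K),
         (0 < t -> QQ q -> derivable (fun x => rho t (x, q.2)) q.1 1 ->
            `|derive1 (fun x => rho t (x, q.2)) q.1| <= K)
       & (0 < t -> QQ q -> derivable (fun y => rho t (q.1, y)) q.2 1 ->
            `|derive1 (fun y => rho t (q.1, y)) q.2| <= K)])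
  (* (6) no flux through the boundary of Q *)
  (H6 : forall t q, 0 <= t -> q.1 = q.2 -> `|(J t q).1 - (J t q).2| = 0) :
  (* for mu_0-a.e. q in Q the solution exists for all t >= 0 and stays in Q *)
  (exists N : set (R * R), measurable N /\ mu rho 0 N = 0%E /\
     forall q, QQ q -> ~ N q ->
       forall t, 0 <= t -> exists p, flow rho J t q = Some p /\ QQ p) /\
  (* equivariance: mu_0 o phi_t^{-1} = mu_t as measures on Q *)
  (forall t, 0 <= t -> forall A : set (R * R), measurable A -> A `<=` QQ ->
     measurable [set q | QQ q /\ exists p, flow rho J t q = Some p /\ A p] /\
     mu rho 0 [set q | exists p, flow rho J t q = Some p /\ A p] = mu rho t A).
Proof.
have [C [C0 HC]] := H4.
(* Positive integer times suffice: a solution beyond [k.+1%:R] covers all earlier times, so the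
   exceptional set is a countable union. *)
have surv (k : nat) : exists G : set (R * R), [/\ measurable G,
  (\int[@leb2 R]_q (\1_(~` G) q * weight rho 0 q)%:E = 0)%E &
  forall q, G q <-> exists be Y, k.+1%:R < be /\ is_sol rho J q be Y].
  have k0 : 0 < k.+1%:R :> R by [].
  have [L [B [X CH]]] := charts Hlip_rho Hlip_J1 Hlip_J2 Hnonneg C0 HC H6 k0.
  exact: (survivors Hnonneg H1 C0 HC k0 CH).
have [G HG] := choice surv.
have flow_QQ t q : 0 < t -> (exists be Y, t < be /\ is_sol rho J q be Y) ->
    exists p, flow rho J t q = Some p /\ QQ p.
  move=> t0 [be [Y [tb S]]]; rewrite /flow gt_eqF//.
  case: pselect => [h|nh]; last by exfalso; apply: nh; exists (Y t), be, Y.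
  case: cid => p /= [be' [Y' [tb' [S' <-]]]]; exists (Y' t); split => //.
  by have [] := sol_pos Hnonneg S' (ltW t0) tb'.
split.
- exists (\bigcup_k ~` G k); split; last split.
  + by apply: bigcup_measurable => k _; apply: measurableC; have [] := HG k.
  + rewrite mu_weight.
    pose h k q := \1_(~` G k) q * weight rho 0 q.
    have mono k m q : (k <= m)%N -> G m q -> G k q.
      move=> km; have [_ _ e] := HG m; have [_ _ e'] := HG k => /e [be [Y [mb S]]].
      apply/e'; exists be, Y; split => //; apply: le_lt_trans mb.
      by rewrite ler_nat ltnS.
    have mw : measurable_fun setT (weight rho 0).
      (* Charts for any positive time yield measurability of the weight at time zero; time 1 is an
         arbitrary choice. *)
      have t0 : 0 < 1 :> R by [].
      have [L [B [X CH]]] := charts Hlip_rho Hlip_J1 Hlip_J2 Hnonneg C0 HC H6 t0.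
      by apply: (measurable_weight C0 t0 CH).
    have h0 n q : 0 <= h n q by rewrite mulr_ge0 ?indicE ?weight_ge0.
    have mh n : measurable_fun setT (h n).
      apply: measurable_funM => //; apply: measurable_indic; apply: measurableC.
      by have [] := HG n.
    have hm q n m : (n <= m)%N -> h n q <= h m q.
      move=> nm; apply: ler_wpM2r; first exact: weight_ge0.
      rewrite !indicE; have [/set_mem nG|] := boolP (q \in ~` G n) => //.
      by rewrite mem_set// => Gm; apply: nG; exact: mono Gm.
    have hc q : (fun n => h n q) @ \oo --> \1_(\bigcup_k ~` G k) q * weight rho 0 q.
      apply: cvgM; last exact: cvg_cst.
      have [[k _ nGk]|nG] := pselect ((\bigcup_k ~` G k) q).
        rewrite indicE mem_set; last by exists k.
        apply: cvg_near_cst; exists k => // n /= kn.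
        by rewrite indicE mem_set// => Gn; apply: nGk; exact: mono Gn.
      rewrite indicE memNset//; apply: cvg_near_cst; apply: nearW => n.
      by rewrite indicE memNset// => nGn; apply: nG; exists n.
    have c := plane_monotone_cvg mh h0 hm hc.
    rewrite -(cvg_lim _ c)//; apply: cvg_lim => //.
    by apply: cvg_near_cst; apply: nearW => n; have [_ + _] := HG n.
  + move=> q Qq nN t; rewrite le_eqVlt => /orP[/eqP <-|t0]; first by exists q; rewrite /flow eqxx.
    apply: flow_QQ => //.
    have [_ _ e] := HG (Num.truncn t).
    have /e [be [Y [kb S]]] : G (Num.truncn t) q.
      by apply: contrapT => nG; apply: nN; exists (Num.truncn t).
    by exists be, Y; split => //; apply: lt_trans kb; exact: truncnS_gt.
(* Charts require a positive time; at time zero the flow is the identity by definition. *)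
- move=> t; rewrite le_eqVlt => /orP[/eqP <-|t0] A mA AQ.
    have e : [set q | exists p, flow rho J 0 q = Some p /\ A p] = A.
      apply/seteqP; split => q /=; rewrite /flow eqxx; first by move=> [p [[<-]]].
      by move=> Aq; exists q.
    split; last by rewrite e.
    suff -> : [set q | QQ q /\ exists p, flow rho J 0 q = Some p /\ A p] = QQ `&` A.
      by apply: measurableI; [exact: measurable_QQ|].
    by rewrite -[in RHS]e.
  have [L [B [X CH]]] := charts Hlip_rho Hlip_J1 Hlip_J2 Hnonneg C0 HC H6 t0.
  have [m1 m2] := equivariant_chart Hnonneg H1 H3 C0 HC t0 CH mA.
  split => //.
  suff -> : [set q | QQ q /\ exists p, flow rho J t q = Some p /\ A p] =
    QQ `&` [set q | exists p, flow rho J t q = Some p /\ A p].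
    by apply: measurableI; [exact: measurable_QQ|].
  by [].
Qed.
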